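(* Let $G$ be a directed graph. 1. The following statements are equivalent: (1) $G$ is acyclic; (2) $\mathscr H_0(G)$ is a finitely generated $\mathbb{Z}$-module; (3) $\mathscr H_*(G)$ is a finitely generated $\mathbb{Z}$-module; (4) there is an $n\ge1$ such that $x^n\in I(G)$ for all $x\in E(G)$; (5) $\mathrm{Kdim}_{\mathbb{Z}[E(G)]}\mathscr H_0(G)=1$; (6) $\mathrm{Kdim}_{\mathbb{Q}[E(G)]}\mathscr H_0^{\mathbb{Q}}(G)=0$. 2. $\alpha(G)=\mathrm{Kdim}_{\mathbb{Q}[E(G)]}\mathscr H_0^{\mathbb{Q}}(G)\le\mathrm{Kdim}_{\mathbb{Z}[E(G)]}\mathscr H_0(G)-1\le\beta(G)$. In particular, if $G$ is planar, then $\alpha(G)=\mathrm{Kdim}_{\mathbb{Q}[E(G)]}\mathscr H_0^{\mathbb{Q}}(G)=\mathrm{Kdim}_{\mathbb{Z}[E(G)]}\mathscr H_0(G)-1=\beta(G)$.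
   Context: A directed graph $G$: finite sets $V(G)$, $E(G)$, each edge with an initial and a terminal vertex; loops and multiple edges allowed; no vertex of degree $0$. Directed cycles are closed directed paths with pairwise distinct vertices (up to circular permutation); $G$ is acyclic if it has none. $\alpha(G)$ is the maximal number of pairwise edge-disjoint directed cycles; $\beta(G)$ is the minimal number of edges whose removal destroys all directed cycles. $\mathbb{Z}[E(G)]$ is graded with every edge of degree $1$. For a vertex $v$ with outgoing edges $x_1,\dots,x_m$ and incoming edges $y_1,\dots,y_n$ (a loop appears in both lists), $k_v=\max\{m,n\}$, $\delta_{v,l}=e_l(x_1,\dots,x_m)-e_l(y_1,\dots,y_n)$ ($1\le l\le k_v$, $e_l$ the elementary symmetric polynomials). $\Delta_G$ is the list of all $\delta_{v,l}$ and $I(G)$ the ideal they generate. For a graded commutative ring $R$ and homogeneous $r$, the graded Koszul complex $C^R(r)$ is $0\to R\{\deg r\}\xrightarrow{r}R\to0$ in homological degrees $1,0$ (where $M\{l\}$ shifts the grading up by $l$); for a sequence, $C^R(r_1,\dots,r_k)=C^R(r_1)\otimes_R\cdots\otimes_R C^R(r_k)$. The Khovanov–Rozansky complex is $\mathscr C_*(G)=C^{\mathbb{Z}[E(G)]}_*(\Delta_G)$, $\mathscr H_*(G)$ its homology and $\mathscr H_0(G)$ its homological-degree-$0$ part; $\mathscr H^{\mathbb{Q}}_*(G)$ is the homology of $\mathbb{Q}\otimes_{\mathbb{Z}}\mathscr C_*(G)$. For a commutative ring $R$ and $R$-module $M$, $\mathrm{ann}_R(M)=\{r\in R: rM=0\}$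 and $\mathrm{Kdim}_R M$ is the Krull dimension of $R/\mathrm{ann}_R(M)$. *)

(* Defs.v *)
From HB Require Import structures.
From mathcomp Require Import all_boot all_order all_algebra.
From mathcomp Require Import ring_quotient generic_quotient.
(* mpoly has to be imported before the topology files: their notations clash
   in the other order. *)
From mathcomp Require Import mpoly.
From mathcomp Require Import boolp classical_sets reals topology normedtype.

Set Implicit Arguments.
Unset Strict Implicit.
Unset Printing Implicit Defensive.

Import GRing.Theory.
Local Open Scope ring_scope.
Local Open Scope quotient_scope.

Section Modules.
Variable A : comNzRingType.

Record submodule (V : lmodType A) := Submodule {
  mem_submodule :> V -> bool;
  submodule_closed : submod_closed mem_submodule }.

HB.instance Definition _ (V : lmodType A) (S : submodule V) :=
  GRing.isSubmodClosed.Build A V (mem_submodule S) (submodule_closed S).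

Record submod_type (V : lmodType A) (S : submodule V) := SubmodElt {
  submod_val : V;
  _ : submod_val \in mem_submodule S }.

HB.instance Definition _ (V : lmodType A) (S : submodule V) :=
  [isSub for @submod_val V S].
HB.instance Definition _ (V : lmodType A) (S : submodule V) :=
  [Choice of submod_type S by <:].
HB.instance Definition _ (V : lmodType A) (S : submodule V) :=
  [SubChoice_isSubLmodule of submod_type S by <:].

(* The quotient V / S: the library's quotient group, with the induced
   scalar multiplication. *)
Definition quotmod (V : lmodType A) (S : submodule V) : Type :=
  @Quotient.quot V (GRing.ZmodClosed.clone V (mem_submodule S) _).

Section QuotMod.
Variables (V : lmodType A) (S : submodule V).

HB.instance Definition _ := GRing.Zmodule.on (quotmod S).
HB.instance Definition _ := EqQuotient.on (quotmod S).

Definition quotmod_scale (a : A) : quotmod S -> quotmod S :=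
  fun h => \pi_(quotmod S) (a *: repr h).

Lemma quotmod_scale_pi a x :
  quotmod_scale a (\pi_(quotmod S) x) = \pi_(quotmod S) (a *: x).
Proof.
rewrite /quotmod_scale; apply/eqP.
have := Quotient.idealrBE (GRing.ZmodClosed.clone V (mem_submodule S) _).
move=> idealrBE; rewrite -[_ == _]idealrBE -scalerBr rpredZ //.
by rewrite idealrBE reprK.
Qed.

Let pi_add (x y : V) :
  \pi_(quotmod S) x + \pi_(quotmod S) y = \pi_(quotmod S) (x + y).
Proof.
exact/esym/(@Quotient.pi_add V (GRing.ZmodClosed.clone V (mem_submodule S) _)).
Qed.

Fact quotmod_scalerA a b (h : quotmod S) :
  quotmod_scale a (quotmod_scale b h) = quotmod_scale (a * b) h.
Proof. by elim/quotW: h => x; rewrite (quotmod_scale_pi b x) !quotmod_scale_pi scalerA. Qed.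

Fact quotmod_scale1r : left_id 1 quotmod_scale.
Proof. by elim/quotW=> x; rewrite quotmod_scale_pi scale1r. Qed.

Fact quotmod_scalerDr : right_distributive quotmod_scale +%R.
Proof.
move=> a; elim/quotW=> x; elim/quotW=> y.
by rewrite pi_add (quotmod_scale_pi a x) (quotmod_scale_pi a y)
  quotmod_scale_pi pi_add scalerDr.
Qed.

Fact quotmod_scalerDl (h : quotmod S) :
  {morph quotmod_scale^~ h : a b / a + b}.
Proof.
elim/quotW: h => x a b.
by rewrite (quotmod_scale_pi a x) (quotmod_scale_pi b x) quotmod_scale_pi
  pi_add scalerDl.
Qed.

HB.instance Definition _ := GRing.Zmodule_isLmodule.Build A (quotmod S)
  quotmod_scalerA quotmod_scale1r quotmod_scalerDr quotmod_scalerDl.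

Definition quot_pr (x : V) : quotmod S := \pi_(quotmod S) x.

Fact quot_pr_linear : linear quot_pr.
Proof. by move=> a x y; rewrite /quot_pr -pi_add -quotmod_scale_pi. Qed.
HB.instance Definition _ :=
  GRing.isLinear.Build A V (quotmod S) _ quot_pr quot_pr_linear.

Lemma quot_pr_eq0 x : (quot_pr x == 0) = (x \in mem_submodule S).
Proof.
have := Quotient.idealrBE (GRing.ZmodClosed.clone V (mem_submodule S) _).
move=> idealrBE; rewrite -(linear0 quot_pr) -[_ == _]idealrBE.
by rewrite subr0.
Qed.

End QuotMod.
End Modules.

Definition fin_gen_Z (M : zmodType) : Prop :=
  exists s : seq M, forall m : M,
    exists c : 'I_(size s) -> int, m = \sum_(i < size s) s`_i *~ c i.

Definition in_ideal (A : comNzRingType) (s : seq A) (a : A) : Prop :=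
  exists c : 'I_(size s) -> A, a = \sum_(i < size s) c i * s`_i.

Definition prime_chain (A : comNzRingType) (n : nat) : Prop :=
  exists p : nat -> prime_idealr A, forall i, (i < n)%N ->
    {subset p i <= p i.+1} /\ exists2 a, a \in p i.+1 & a \notin p i.

Definition has_krull_dim (A : comNzRingType) (d : nat) : Prop :=
  prime_chain A d /\ forall n, prime_chain A n -> (n <= d)%N.

Definition in_ann (A : comNzRingType) (M : lmodType A) (a : A) : Prop :=
  forall m : M, a *: m = 0.

(* [idealr] only covers proper ideals, so the zero module has no Krull
   dimension in the sense of [has_Kdim]. *)
Definition has_Kdim (A : comNzRingType) (M : lmodType A) (d : nat) : Prop :=
  exists I : idealr A, (forall a, a \in I <-> in_ann M a) /\
    has_krull_dim {ideal_quot I} d.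

(* Complexes of free modules with a finite basis of homogeneous elements;
   [diff i j] is the coefficient of the basis element [j] in the differential
   of the basis element [i]. *)
Record complex (A : comNzRingType) := Complex {
  gen : finType;
  hdeg : gen -> nat;
  diff : gen -> gen -> A;
  diff_hdeg : forall i j, diff i j != 0 -> hdeg i = (hdeg j).+1;
  diff_diff : forall i k, \sum_j diff i j * diff j k = 0 }.

Section Operations.
Variable A : comNzRingType.

Section UnitComplex.
Let d (_ _ : unit) : A := 0.
Fact unit_diff_hdeg i j : d i j != 0 -> 0%N = 1%N.
Proof. by rewrite eqxx. Qed.
Fact unit_diff_diff i k : \sum_j d i j * d j k = 0.
Proof. by rewrite big1 // => j _; rewrite mul0r. Qed.
Definition unit_complex : complex A :=
  @Complex A unit (fun=> 0%N) d unit_diff_hdeg unit_diff_diff.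
End UnitComplex.

(* 0 -> A --r--> A -> 0; the basis elements in degrees 1 and 0 are
   [true] and [false]. *)
Section Koszul1.
Variable r : A.
Let d (i j : bool) : A := if i && ~~ j then r else 0.
Fact koszul1_diff_hdeg i j : d i j != 0 -> nat_of_bool i = (nat_of_bool j).+1.
Proof. by case: i; case: j; rewrite /d /= ?eqxx. Qed.
Fact koszul1_diff_diff i k : \sum_j d i j * d j k = 0.
Proof.
by rewrite big1 // => j _; rewrite /d; case: i j k => [] [] [] /=;
  rewrite ?mulr0 ?mul0r.
Qed.
Definition koszul1 : complex A :=
  @Complex A bool nat_of_bool d koszul1_diff_hdeg koszul1_diff_diff.
End Koszul1.

(* d (x (x) y) = dx (x) y + (-1)^(deg x) x (x) dy *)
Section Tensor.
Variables C D : complex A.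
Let deg (i : gen C * gen D) : nat := (hdeg i.1 + hdeg i.2)%N.
Let d (i j : gen C * gen D) : A :=
  diff i.1 j.1 * (i.2 == j.2)%:R
  + (-1) ^+ hdeg i.1 * (i.1 == j.1)%:R * diff i.2 j.2.

Fact tensor_diff_hdeg i j : d i j != 0 -> deg i = (deg j).+1.
Proof.
rewrite /d /deg; case: i j => [i i'] [j j'] /=.
have [<-|ne] := eqVneq i j; have [<-|ne'] := eqVneq i' j'.
- have [e1|/diff_hdeg] := eqVneq (diff i i) 0; last by move/n_Sn.
  have [e2|/diff_hdeg] := eqVneq (diff i' i') 0; last by move/n_Sn.
  by rewrite e1 e2 mul0r mulr0 addr0 eqxx.
- rewrite mulr0 add0r; have [->|/diff_hdeg -> _] := eqVneq (diff i' j') 0.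
    by rewrite mulr0 eqxx.
  by rewrite addnS.
- rewrite mulr0 mul0r addr0 mulr1 => /diff_hdeg ->.
  by rewrite addSn.
- by rewrite !mulr0 mul0r addr0 eqxx.
Qed.

Fact tensor_diff_diff i k : \sum_j d i j * d j k = 0.
Proof.
case: i k => [i i'] [k k']; rewrite /d /=.
rewrite (eq_bigr (fun p : gen C * gen D =>
  (diff i p.1 * diff p.1 k) * ((i' == p.2)%:R * (p.2 == k')%:R)
  + (diff i p.1 * ((-1) ^+ hdeg p.1 * (p.1 == k)%:R))
    * ((i' == p.2)%:R * diff p.2 k')
  + ((-1) ^+ hdeg i * (i == p.1)%:R * diff p.1 k)
    * (diff i' p.2 * (p.2 == k')%:R)
  + ((-1) ^+ hdeg i * (i == p.1)%:R * ((-1) ^+ hdeg p.1 * (p.1 == k)%:R))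
    * (diff i' p.2 * diff p.2 k'))); last first.
  move=> [j j'] _ /=; rewrite mulrDl !mulrDr !addrA.
  by congr (_ + _ + _ + _); exact: mulrACA.
rewrite !big_split /=.
have split2 (f : gen C -> A) (g : gen D -> A) :
    \sum_p f p.1 * g p.2 = (\sum_j f j) * (\sum_j g j).
  by rewrite big_distrlr /= pair_bigA.
have suml (I : finType) (x : I) (f : I -> A) : \sum_y (x == y)%:R * f y = f x.
  rewrite (bigD1 x) //= eqxx mul1r big1 ?addr0 // => y ne.
  by rewrite eq_sym (negPf ne) mul0r.
have sumr (I : finType) (x : I) (f : I -> A) : \sum_y f y * (y == x)%:R = f x.
  rewrite (bigD1 x) //= eqxx mulr1 big1 ?addr0 // => y ne.
  by rewrite (negPf ne) mulr0.
rewrite (split2 (fun j => diff i j * diff j k)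
               (fun j' => (i' == j')%:R * (j' == k')%:R)).
rewrite (split2 (fun j => diff i j * ((-1) ^+ hdeg j * (j == k)%:R))
               (fun j' => (i' == j')%:R * diff j' k')).
rewrite (split2 (fun j => (-1) ^+ hdeg i * (i == j)%:R * diff j k)
               (fun j' => diff i' j' * (j' == k')%:R)).
rewrite (split2 (fun j => (-1) ^+ hdeg i * (i == j)%:R
                          * ((-1) ^+ hdeg j * (j == k)%:R))
               (fun j' => diff i' j' * diff j' k')).
rewrite !diff_diff mul0r mulr0 add0r addr0 !suml !sumr.
under [X in _ + X * _]eq_bigr do rewrite -mulrA.
rewrite -mulr_sumr suml.
under [X in X * _ + _]eq_bigr do rewrite mulrA.
rewrite sumr.
have [->|/diff_hdeg ->] := eqVneq (diff i k) 0.
  by rewrite mulr0 !mul0r addr0.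
by rewrite exprS mulN1r mulNr [diff i k * _]mulrC mulNr subrr.
Qed.

Definition tensor : complex A :=
  @Complex A (gen C * gen D)%type deg d tensor_diff_hdeg tensor_diff_diff.
End Tensor.

Definition koszul (s : seq A) : complex A :=
  foldr (fun r C => tensor (koszul1 r) C) unit_complex s.

End Operations.

(* B (x)_A C along f : A -> B *)
Section BaseChange.
Variables (A B : comNzRingType) (f : {rmorphism A -> B}) (C : complex A).
Let d (i j : gen C) : B := f (diff i j).
Fact base_change_diff_hdeg i j : d i j != 0 -> hdeg i = (hdeg j).+1.
Proof.
move=> ne; apply: diff_hdeg; apply: contraNneq ne => e.
by rewrite /d e rmorph0.
Qed.
Fact base_change_diff_diff i k : \sum_j d i j * d j k = 0.
Proof.
under eq_bigr do rewrite -rmorphM.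
by rewrite -rmorph_sum diff_diff rmorph0.
Qed.
Definition base_change : complex B :=
  @Complex B (gen C) (@hdeg A C) d base_change_diff_hdeg base_change_diff_diff.
End BaseChange.

Section Homology.
Variables (A : comNzRingType) (C : complex A).

Definition chains : lmodType A := {ffun gen C -> A^o}.

Definition bd (x : chains) : chains := [ffun j => \sum_i x i * diff i j].

Fact bd_linear : linear bd.
Proof.
move=> a x y; apply/ffunP => j; rewrite !ffunE.
rewrite scaler_sumr -big_split /=; apply: eq_bigr => i _.
by rewrite !ffunE mulrDl -scalerAl.
Qed.
HB.instance Definition _ := GRing.isLinear.Build A chains chains _ bd bd_linear.

Fact cycles_closed : submod_closed (fun x : chains => bd x == 0).
Proof.
split=> [|a x y]; rewrite ?unfold_in; first by rewrite linear0.
move=> /eqP x0 /eqP y0.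
by rewrite linearP /= x0 y0 scaler0 addr0.
Qed.
Definition cycles : submodule chains := Submodule cycles_closed.

Fact boundaries_closed : submod_closed
  (fun z : submod_type cycles => `[< exists y, submod_val z = bd y >]).
Proof.
split=> [|a x y]; rewrite ?unfold_in.
  by apply/asboolP; exists 0; rewrite linear0.
move=> /asboolP[x' ex] /asboolP[y' ey].
by apply/asboolP; exists (a *: x' + y'); rewrite linearP /= -ex -ey.
Qed.
Definition boundaries : submodule (submod_type cycles) :=
  Submodule boundaries_closed.

Definition homology : lmodType A := quotmod boundaries.

Definition homogeneous (n : nat) (x : chains) : Prop :=
  forall i, x i != 0 -> hdeg i = n.

Fact homology_deg_closed (n : nat) : submod_closed (fun h : homology =>
  `[< exists2 z, homogeneous n (submod_val z) & h = quot_pr boundaries z >]).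
Proof.
split=> [|a g h]; rewrite ?unfold_in.
  apply/asboolP; exists 0 => [i|]; last by rewrite linear0.
  by rewrite ffunE eqxx.
move=> /asboolP[x hx ->] /asboolP[y hy ->]; apply/asboolP.
exists (a *: x + y).
  move=> i; rewrite !ffunE; have [x0|/hx //] := eqVneq (submod_val x i) 0.
  have [y0|/hy //] := eqVneq (submod_val y i) 0.
  by rewrite x0 y0 scaler0 addr0 eqxx.
by rewrite linearP.
Qed.
Definition homology_deg (n : nat) : lmodType A :=
  submod_type (Submodule (homology_deg_closed n)).

End Homology.

Record digraph := Digraph {
  vertex : finType;
  edge : finType;
  source : edge -> vertex;
  target : edge -> vertex;
  no_isolated : forall v, exists e, source e = v \/ target e = v }.

Section Graph.
Variable G : digraph.
Implicit Types (c : seq (edge G)) (v : vertex G) (F : {set edge G}).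

(* A directed cycle as its sequence of edges, starting anywhere on it. *)
Definition dicycle c : bool :=
  [&& c != [::], cycle (fun e f => target e == source f) c
    & uniq [seq source e | e <- c]].

(* The edge sets of directed cycles: these represent the directed cycles up to
   circular permutation. *)
Definition dicycle_set F : bool :=
  [exists c : #|F|.-tuple (edge G), dicycle c && ([set e in c] == F)].

Lemma dicycle_setP F :
  reflect (exists2 c, dicycle c & [set e in c] = F) (dicycle_set F).
Proof.
apply: (iffP existsP) => [[c /andP[cc /eqP <-]]|[c cc <-]]; first by exists c.
have sc : size c == #|[set e in c]|.
  by case/and3P: cc => _ _ /map_uniq/card_uniqP <-; rewrite cardsE.
exists (tcast (eqP sc) (in_tuple c)); rewrite /= val_tcast cc.
apply/eqP/setP => e; rewrite !inE.
by rewrite -[e \in tcast _ _]/(e \in tval (tcast _ _)) val_tcast.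
Qed.

Definition acyclic : Prop := forall c, ~~ dicycle c.

Definition alpha : nat :=
  \max_(P : {set {set edge G}} | finset.trivIset P && [forall F in P, dicycle_set F])
    #|P|.

(* Removing the edges of F destroys all directed cycles. *)
Definition feedback F : bool :=
  [forall D : {set edge G}, dicycle_set D ==> (D :&: F != finset.set0)].

Fact feedback_setT : feedback [set: edge G].
Proof.
apply/forallP => D; apply/implyP => /dicycle_setP[[|e c] // _ <-].
by rewrite finset.setIT; apply/set0Pn; exists e; rewrite !inE eqxx.
Qed.

Definition beta : nat := #|[arg min_(F < [set: edge G] | feedback F) #|F|]|.

Definition edge_ring : comNzRingType := {mpoly int[#|edge G|]}.

Definition edge_var (e : edge G) : edge_ring := 'X_(enum_rank e).

(* e_l in the variables of F *)
Definition edge_esym F (l : nat) : edge_ring :=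
  \sum_(D : {set edge G} | (D \subset F) && (#|D| == l))
    \prod_(e in D) edge_var e.

Definition out_edges v : {set edge G} := [set e | source e == v].
Definition in_edges v : {set edge G} := [set e | target e == v].

Definition delta v (l : nat) : edge_ring :=
  edge_esym (out_edges v) l - edge_esym (in_edges v) l.

Definition Delta : seq edge_ring :=
  [seq delta v l | v <- enum (vertex G),
                   l <- iota 1 (maxn #|out_edges v| #|in_edges v|)].

Definition KR_complex : complex edge_ring := koszul Delta.

Definition edge_ringQ : comNzRingType := {mpoly rat[#|edge G|]}.

(* Q (x)_Z Z[E(G)] is identified with Q[E(G)]. *)
Definition KR_complexQ : complex edge_ringQ :=
  base_change (map_mpoly intr : {rmorphism edge_ring -> edge_ringQ}) KR_complex.

Definition KR_H : lmodType edge_ring := homology KR_complex.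
Definition KR_H0 : lmodType edge_ring := homology_deg KR_complex 0.
Definition KR_H0Q : lmodType edge_ringQ := homology_deg KR_complexQ 0.

End Graph.

Section Planar.
Import numFieldNormedType.Exports.
Local Open Scope classical_set_scope.
Variable R : realType.

(* A drawing in the plane: vertices are distinct points, edges are arcs (closed
   curves, for loops) that meet only at vertices. *)
Record drawing (G : digraph) (pos : vertex G -> R * R)
    (arc : edge G -> R -> R * R) : Prop := {
  pos_inj : injective pos;
  arc_continuous : forall e, {within `[0, 1], continuous (arc e)};
  arc_source : forall e, arc e 0 = pos (source e);
  arc_target : forall e, arc e 1 = pos (target e);
  arc_disjoint : forall e f s t, 0 < s < 1 -> 0 < t < 1 ->
    arc e s = arc f t -> e = f /\ s = t;
  arc_avoids : forall e v t, 0 < t < 1 -> arc e t <> pos v }.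

Definition planar (G : digraph) : Prop :=
  exists (pos : vertex G -> R * R) (arc : edge G -> R -> R * R),
    drawing pos arc.

End Planar.

(* Main.v *)
(** The common zeros of [I(G)] in a domain assign to the edges values such that,
    at every vertex, the nonzero values of the outgoing edges are, with
    multiplicity, those of the incoming edges. The edges with a given nonzero
    value therefore form a balanced set, which contains a directed cycle, and
    distinct values give disjoint cycles: modulo a prime over [I(G)] there are at
    most [alpha G] nonzero values, and [alpha G] disjoint cycles carry
    independent values. Hence both Krull dimensions are determined by
    [alpha G]: they are [alpha G] over the rationals and [alpha G + 1] over the
    integers. The dimension of a polynomial ring is bounded by extracting from an
    algebraic relation between the elements which separate the primes of a chain
    its lexicographically lowest term.

    If [G] is acyclic, an edge whose predecessors are nilpotent modulo [I(G)] is
    itself nilpotent; since the Koszul homology is killed by [I(G)] and the edge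
    ring is noetherian, the homology is then finitely generated over the
    integers. Conversely a directed cycle gives a morphism from the edge ring to
    [int[T]] which kills [I(G)].

    For a plane graph, rounding the arcs to a fine grid exhibits [G] as a minor
    of the grid, so that the integral circulations of [G] are the coboundaries on
    a set of faces. Directed cycles then become directed cuts of the dual, and
    [alpha G = beta G] is the Lucchesi-Younger theorem, for which we follow
    Lovasz: a packing of cuts with doubled capacities can be made laminar, and the
    parity of the depth in the laminar family splits it in two halves. *)

Require Import Defs.
From HB Require Import structures.
From mathcomp Require Import all_boot all_order all_algebra.
From mathcomp Require Import ring_quotient generic_quotient.
From mathcomp Require Import mpoly.
From mathcomp Require Import boolp reals.
From mathcomp Require Import zify ring lra.

Set Implicit Arguments.
Unset Strict Implicit.
Unset Printing Implicit Defensive.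

Import Order.TTheory GRing.Theory Num.Theory.
Local Open Scope ring_scope.

(** * Directed cycles *)

Section Graph.
Variable G : digraph.
Implicit Types (v : vertex G) (F S C D : {set edge G}) (e f : edge G).

Definition balanced S := forall v,
  #|[set e in S | source e == v]| = #|[set e in S | target e == v]|.

(* Walking backwards inside [S] must eventually repeat a vertex. *)
Lemma dicycle_of_predecessors S : S != finset.set0 ->
    (forall e, e \in S -> exists2 f, f \in S & target f = source e) ->
  exists2 C, dicycle_set C & C \subset S.
Proof.
case/set0Pn=> e0 e0S pred.
pose r := fun e f => target e == source f.
pose good (c : seq (edge G)) := [&& c != [::], all (mem S) c & sorted r c].
have long n : exists c, good c /\ size c = n.+1.
  elim: n => [|n [c [gc sc]]]; first by exists [:: e0]; rewrite /good /= e0S.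
  case: c gc sc => // e c /and3P[_ /= /andP[eS cS] cp] sc.
  have [f fS fe] := pred e eS.
  exists [:: f, e & c]; rewrite /good /= fS eS cS /= cp /r fe eqxx /=.
  by split=> //; rewrite -sc.
have [c [/and3P[_ cS cp] sc]] := long #|vertex G|.
have nuniq : ~~ uniq [seq source e | e <- c].
  apply/negP => /card_uniqP; rewrite size_map sc => eqc.
  by have := max_card (mem [seq source e | e <- c]); rewrite eqc ltnn.
pose Q n := (n <= size c)%N && ~~ uniq [seq source e | e <- take n c].
have exQ : exists n, Q n by exists (size c); rewrite /Q leqnn take_size.
case: (ex_minnP exQ) => n /andP[nc nu] nmin.
case: n => [|n] in nc nu nmin *; first by rewrite take0 in nu.
have un : uniq [seq source e | e <- take n c].
  by apply/negPn/negP => nun; have := nmin n; rewrite /Q nun (ltnW nc) /= ltnn => /(_ isT).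
move: nu; rewrite (take_nth e0) // map_rcons rcons_uniq un andbT negbK.
case/mapP=> f ft fe.
set t := take n c in un ft.
set i := index f t; have it : (i < size t)%N by rewrite index_mem.
have st : size t = n by rewrite size_takel // ltnW.
have fE : nth e0 c i = f by rewrite -[RHS](nth_index e0 ft) nth_take // -st.
pose d := drop i t.
have dS : {subset d <= S} by move=> x /mem_drop/mem_take; apply/allP.
have tp : sorted r (take n.+1 c) by apply: take_sorted.
have ddef : drop i (take n.+1 c) = rcons d (nth e0 c n).
  by rewrite (take_nth e0) // -/t -drop_rcons // ltnW.
have dp : sorted r (rcons d (nth e0 c n)) by rewrite -ddef; apply: drop_sorted.
have dE : d = f :: drop i.+1 t.
  by rewrite /d (drop_nth e0) // /t nth_take ?fE // -st.
exists [set x in d]; last by apply/subsetP => x; rewrite inE; apply: dS.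
apply/dicycle_setP; exists d => //; apply/and3P; split.
- by rewrite dE.
- have := dp; rewrite dE /= !rcons_path => /andP[-> /=].
  by rewrite /r fe.
- by rewrite /d map_drop drop_uniq.
Qed.

Lemma dicycle_of_balanced S : S != finset.set0 -> balanced S ->
  exists2 C, dicycle_set C & C \subset S.
Proof.
move=> S0 bal; apply: dicycle_of_predecessors => // e eS.
have : (0 < #|[set f in S | target f == source e]|)%N.
  by rewrite -bal card_gt0; apply/set0Pn; exists e; rewrite inE eS eqxx.
by rewrite card_gt0 => /set0Pn[f]; rewrite inE => /andP[fS /eqP]; exists f.
Qed.

Lemma dicycle_set_neq0 C : dicycle_set C -> C != finset.set0.
Proof.
case/dicycle_setP=> -[|e c] // _ <-.
by apply/set0Pn; exists e; rewrite !inE eqxx.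
Qed.

Lemma dicycle_set_balanced C : dicycle_set C -> balanced C.
Proof.
case/dicycle_setP=> c /and3P[_ cc /map_uniq uc] <- v.
have cnt (P : pred (edge G)) : #|[set e in [set x in c] | P e]| = count P c.
  rewrite -size_filter -(card_uniqP (filter_uniq P uc)).
  by apply: eq_card => e; rewrite !inE mem_filter andbC.
rewrite !{}cnt -[LHS](count_map (@source G) (pred1 v)) -[RHS](count_map (@target G) (pred1 v)).
have -> : [seq target e | e <- c] = rot 1 [seq source e | e <- c].
  have shift x y d : path (fun e f => target e == source f) x (rcons d y) ->
      [seq target e | e <- x :: d] = [seq source e | e <- rcons d y].
    by elim: d x => [|f d IH] x /= /andP[/eqP-> // /IH <-].
  by case: c cc {uc} => // e c /shift ->; rewrite map_rcons /= rot1_cons.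
by apply/permP; rewrite perm_sym perm_rot.
Qed.

Lemma balanced0 : balanced finset.set0.
Proof. by move=> v; congr #|pred_of_set _|; apply/setP => e; rewrite !inE. Qed.

Lemma acyclicP : acyclic G <-> forall C, ~~ dicycle_set C.
Proof.
split=> [ac C|nd c]; first by apply/negP => /dicycle_setP[c cc _]; move: (ac c); rewrite cc.
by apply/negP => cc; move: (nd [set e in c]) => /dicycle_setP; case; exists c.
Qed.

Lemma alpha_ge (P : {set {set edge G}}) : finset.trivIset P ->
  (forall C, C \in P -> dicycle_set C) -> (#|P| <= alpha G)%N.
Proof.
move=> tP dP; rewrite /alpha.
by apply: (leq_bigmax_cond (F := fun P : {set {set edge G}} => #|P|));
  rewrite tP; apply/forall_inP.
Qed.

Lemma alpha_witness : exists2 P : {set {set edge G}},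
  finset.trivIset P /\ (forall C, C \in P -> dicycle_set C) & #|P| = alpha G.
Proof.
rewrite /alpha.
have P0 : finset.trivIset (@finset.set0 {set edge G})
    && [forall F : {set edge G} in finset.set0, dicycle_set F].
  apply/andP; split; first by apply/trivIsetP => A B; rewrite inE.
  by apply/forall_inP => F; rewrite inE.
have [|P] := @eq_bigmax_cond _ (fun P : {set {set edge G}} =>
    finset.trivIset P && [forall F in P, dicycle_set F]) (fun P => #|P|).
  by apply/card_gt0P; exists finset.set0.
by move=> /andP[tP /forall_inP dP] ->; exists P.
Qed.

Lemma card_le_alpha (I : finType) (S : I -> {set edge G}) :
    (forall i, exists2 C, dicycle_set C & C \subset S i) ->
    (forall i j, i != j -> [disjoint S i & S j]) ->
  (#|I| <= alpha G)%N.
Proof.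
move=> dS disj.
have ex i : exists C, dicycle_set C && (C \subset S i).
  by have [C dC CS] := dS i; exists C; rewrite dC.
pose C i := xchoose (ex i).
have /all_and2[dC CS] i : dicycle_set (C i) /\ C i \subset S i.
  exact/andP/(xchooseP (ex i)).
have disjC i j : i != j -> [disjoint C i & C j].
  by move=> /disj; apply: disjointW.
have injC : injective C.
  move=> i j eqC; apply/eqP/negPn/negP => /disjC.
  rewrite eqC -setI_eq0 setIid => /eqP C0.
  by have := dicycle_set_neq0 (dC j); rewrite C0 eqxx.
rewrite -(card_codom injC) -[#|_|](@cardsE _ (mem (codom C))).
apply: alpha_ge => [|D]; last by rewrite inE => /codomP[i ->].
apply/trivIsetP => A B; rewrite !inE => /codomP[i ->] /codomP[j ->] ne.
by apply: disjC; apply: contraNneq ne => ->.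
Qed.

Lemma card_feedback_le F : feedback F -> (alpha G <= #|F|)%N.
Proof.
move/forallP=> fF; have [P [tP dP] <-] := alpha_witness.
have ex C : C \in P -> exists e, e \in C :&: F.
  by move=> CP; apply/set0Pn/(implyP (fF C))/dP.
have inj := subset_leq_card.
pose h C := if C \in P then [pick e in C :&: F] else None.
have hP C : C \in P -> exists2 e, h C = Some e & e \in C :&: F.
  move=> CP; rewrite /h CP; case: pickP => [e eC|no]; first by exists e.
  by have [e] := ex C CP; rewrite no.
rewrite -(card_in_imset (f := h)); last first.
  move=> C D CP DP; have [e -> eC] := hP C CP; have [f -> fD] := hP D DP.
  case=> ef; move: eC; rewrite ef => fC; apply/eqP/negPn/negP => ne.
  have /disjointFr/(_ _) := trivIsetP tP C D CP DP ne.
  move: fC fD; rewrite !inE => /andP[fC _] /andP[fD _] /(_ f fC).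
  by rewrite fD.
rewrite -(card_imset F (@Some_inj _)); apply: subset_leq_card.
apply/subsetP => _ /imsetP[C CP ->]; have [e -> ] := hP C CP.
by rewrite inE => /andP[_ eF]; apply: imset_f.
Qed.

Lemma alpha_le_beta : (alpha G <= beta G)%N.
Proof.
rewrite /beta; case: arg_minnP => [|F fF _]; first exact: feedback_setT.
exact: card_feedback_le.
Qed.

Lemma beta_le F : feedback F -> (beta G <= #|F|)%N.
Proof. by rewrite /beta; case: arg_minnP => [|? _ min /min //]; apply: feedback_setT. Qed.

Lemma alpha_gt0 : (0 < alpha G)%N <-> exists C : {set edge G}, dicycle_set C.
Proof.
split=> [|[C dC]].
  have [P [_ dP] <-] := alpha_witness; rewrite card_gt0 => /set0Pn[C /dP].
  by exists C.
rewrite -(cards1 C); apply: alpha_ge => [|D]; last by rewrite inE => /eqP->.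
by apply/trivIsetP => A B; rewrite !inE => /eqP-> /eqP->; rewrite eqxx.
Qed.

Lemma acyclic_alpha : acyclic G <-> alpha G = 0%N.
Proof.
rewrite acyclicP; split=> [nd|a0 C].
  apply/eqP; rewrite -leqn0 leqNgt; apply/negP => /alpha_gt0[C].
  exact/negP.
by apply/negP => dC; have : (0 < alpha G)%N by [apply/alpha_gt0; exists C]; rewrite a0.
Qed.

End Graph.

(** * The Lucchesi-Younger theorem *)

Section Parity.
Local Open Scope nat_scope.

(* The rank of the elements of a chain takes consecutive values. *)
Lemma card_same_parity (T : finType) (C : {set T}) (lt : rel T) (K : nat) (b : bool) :
    irreflexive lt -> transitive lt ->
    {in C &, forall i j, i != j -> lt i j || lt j i} ->
  #|[set i in C | odd (K + #|[set j in C | lt i j]|) == b]| <= uphalf #|C|.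
Proof.
move=> irr tr tot; set rank := fun i => #|[set j in C | lt i j]|.
have rank_lt i : i \in C -> rank i < #|C|.
  move=> iC; apply: proper_card; apply/properP; split.
    by apply/subsetP => j; rewrite inE => /andP[].
  by exists i => //; rewrite inE irr andbF.
have rank_ltr i j : i \in C -> j \in C -> lt i j -> rank j < rank i.
  move=> iC jC ij; apply: proper_card; apply/properP; split.
    by apply/subsetP => k; rewrite !inE => /andP[-> /(tr _ _ _ ij)].
  by exists j; rewrite inE jC // irr.
have rank_inj : {in C &, injective rank}.
  move=> i j iC jC eq_r; apply/eqP/negPn/negP => /(tot _ _ iC jC)/orP[] /rank_ltr.
    by move/(_ iC jC); rewrite eq_r ltnn.
  by move/(_ jC iC); rewrite eq_r ltnn.
set S := [set i in C | _].
case: (posnP #|C|) => [C0|C_gt0].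
  rewrite C0 leqn0 cards_eq0 -subset0; move/eqP: C0; rewrite cards_eq0 => /eqP C0.
  by apply/subsetP => i; rewrite inE C0 inE.
have half_lt r k : r < k -> r./2 < uphalf k by lia.
have k_gt0 : 0 < uphalf #|C| by move/half_lt: C_gt0; lia.
pose h i := inord (rank i)./2 : 'I_(uphalf #|C|).-1.+1.
have hE i : i \in S -> h i = (rank i)./2 :> nat.
  by rewrite inE => /andP[/rank_lt/half_lt lt_r _]; rewrite inordK ?prednK.
rewrite -[leqRHS]prednK // -[leqRHS]card_ord -(card_in_imset (f := h)).
  exact: max_card.
move=> i j iS jS hij; move: (iS) (jS); rewrite !inE => /andP[iC /eqP pi] /andP[jC /eqP pj].
have := congr1 val hij; rewrite /= !hE // => eq_half.
apply: rank_inj => //; rewrite -(odd_double_half (rank i)) -(odd_double_half (rank j)).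
congr (nat_of_bool _ + _); last by rewrite eq_half.
by move: pi pj; rewrite !oddD => <- /addbI.
Qed.

Lemma ltn_sqr_uncross a b x y : a < x -> a < y -> a + b = x + y ->
  x ^ 2 + y ^ 2 < a ^ 2 + b ^ 2.
Proof.
move=> /subnKC <- /subnKC <-; move: (x - a.+1) (y - a.+1) => p q eq_ab.
have -> : b = a + p + q.+2 by lia.
by have := leq0n (p * q); rewrite !expnS !expn0 !muln1; lia.
Qed.

Lemma sum_nat_of_bool (T : finType) (P : pred T) : \sum_i (P i : nat) = #|[set i | P i]|.
Proof. by rewrite -sum1dep_card [RHS]big_mkcond; apply: eq_bigr => i _; case: (P i). Qed.

Lemma leq_uphalf_double k w : k <= 2 * w -> uphalf k <= w.
Proof. lia. Qed.

End Parity.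

Section LucchesiYounger.
Local Open Scope nat_scope.
Variables (E F : finType) (tl hd : E -> F) (V : pred {set F}).

Definition entering (X : {set F}) : {set E} :=
  [set e | (hd e \in X) && (tl e \notin X)].

Hypothesis V_dicut : forall X, V X -> forall e, tl e \in X -> hd e \in X.
Hypothesis V_setI : forall X Y, V X -> V Y -> V (X :&: Y).
Hypothesis V_setU : forall X Y, V X -> V Y -> V (X :|: Y).
Hypothesis V_conn : forall X, V X -> entering X = finset.set0 ->
  X = finset.set0 \/ X = finset.setT.

Definition packing m (w : E -> nat) (t : {ffun 'I_m -> {set F}}) : bool :=
  [forall i, V (t i) && (entering (t i) != finset.set0)]
  && [forall e, \sum_i (e \in entering (t i)) <= w e].

Definition packs (w : E -> nat) m : bool :=
  [exists t : {ffun 'I_m -> {set F}}, packing w t].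

Lemma packs_le w m : packs w m -> m <= \sum_e w e.
Proof.
case/existsP=> t /andP[/forallP tV /forallP tw].
apply: (@leq_trans (\sum_e \sum_i (e \in entering (t i)))); last exact: leq_sum.
rewrite exchange_big /= -[leqLHS]card_ord -sum1_card; apply: leq_sum => i _.
have /andP[_ /set0Pn[e ei]] := tV i.
by rewrite (bigD1 e) //= ei.
Qed.

Lemma packs_mono w w' m : (forall e, w e <= w' e) -> packs w m -> packs w' m.
Proof.
move=> ww' /existsP[t /andP[tV /forallP tw]]; apply/existsP; exists t.
by rewrite /packing tV; apply/forallP => e; apply: leq_trans (tw e) (ww' e).
Qed.

Lemma packs0 w : packs w 0.
Proof.
apply/existsP; exists [ffun _ => finset.set0]; apply/andP; split.
  by apply/forallP => -[].
by apply/forallP => e; rewrite big_ord0.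
Qed.

Lemma packsD w w' m m' : packs w m -> packs w' m' ->
  packs (fun e => w e + w' e) (m + m').
Proof.
case/existsP=> t /andP[/forallP tV /forallP tw].
case/existsP=> t' /andP[/forallP tV' /forallP tw'].
apply/existsP; exists [ffun i => match split i with inl j => t j | inr j => t' j end].
apply/andP; split; apply/forallP.
  by move=> i; rewrite ffunE; case: (split i).
move=> e; rewrite big_split_ord /=; apply: leq_add.
- apply: leq_trans (tw e); apply: leq_sum => i _.
  by rewrite ffunE (unsplitK (inl i)).
- apply: leq_trans (tw' e); apply: leq_sum => i _.
  by rewrite ffunE (unsplitK (inr i)).
Qed.

Lemma entering_uncross X Y e : V X -> V Y ->
  (e \in entering (X :&: Y)) + (e \in entering (X :|: Y))
  = (e \in entering X) + (e \in entering Y).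
Proof.
move=> /V_dicut/(_ e) VX /V_dicut/(_ e) VY; rewrite !inE.
by move: VX VY; do 4!case: (_ \in _) => //=; do ?[by move=> /(_ isT)|by move=> _ /(_ isT)].
Qed.

Definition laminar m (t : {ffun 'I_m -> {set F}}) := forall i j,
  [|| t i \subset t j, t j \subset t i, [disjoint t i & t j] | t i :|: t j == finset.setT].

Lemma uncross w m : packs w m -> exists2 t : {ffun 'I_m -> {set F}}, packing w t & laminar t.
Proof.
case/existsP=> t0 pt0.
case: (arg_maxnP (fun t : {ffun 'I_m -> {set F}} => \sum_i #|t i| ^ 2) pt0).
move=> t pt tmax; exists t => // i j.
apply/negPn/negP; rewrite !negb_or => /and4P[ij ji dj uT].
have ne : j != i by apply: contraNneq ij => ->.
move: (pt) => /andP[/forallP tV /forallP tw].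
have /andP[Vi ei] := tV i; have /andP[Vj ej] := tV j.
pose t' := [ffun k => if k == i then t i :&: t j else if k == j then t i :|: t j else t k].
have sumE (f : {set F} -> nat) :
    \sum_k f (t' k) = f (t i :&: t j) + (f (t i :|: t j) + \sum_(k | (k != i) && (k != j)) f (t k)).
  rewrite (bigD1 i) //= (bigD1 j) //= !ffunE eqxx (negPf ne) eqxx; do 2!congr (_ + _).
  by apply: eq_bigr => k /andP[/negPf ki /negPf kj]; rewrite ffunE ki kj.
have sumE' (f : {set F} -> nat) :
    \sum_k f (t k) = f (t i) + (f (t j) + \sum_(k | (k != i) && (k != j)) f (t k)).
  by rewrite (bigD1 i) //= (bigD1 j).
have pt' : packing w t'.
  apply/andP; split; apply/forallP; [move=> k|move=> e]; last first.
    by apply: leq_trans (tw e); rewrite (sumE (fun X => (e \in entering X) : nat))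
      (sumE' (fun X => (e \in entering X) : nat)) !addnA entering_uncross.
  rewrite ffunE; case: eqP => [_|_]; last case: eqP => [_|_] //.
  - rewrite V_setI //=; apply/eqP => /(V_conn (V_setI Vi Vj))[I0|IT].
      by move: dj; rewrite -setI_eq0 I0 eqxx.
    by move: ij; rewrite (subset_trans (finset.subsetT (t i))) // -IT finset.subsetIr.
  - rewrite V_setU //=; apply/eqP => /(V_conn (V_setU Vi Vj))[U0|UT].
      by move: ij; rewrite (subset_trans (subsetUl _ (t j))) // U0 sub0set.
    by rewrite UT eqxx in uT.
have := tmax t' pt'; rewrite (sumE (fun X => #|X| ^ 2)) (sumE' (fun X => #|X| ^ 2)).
have := cardsUI (t i) (t j).
have lti : #|t i :&: t j| < #|t i|.
  by apply: proper_card; rewrite properEneq finset.subsetIl andbT; apply: contraNneq ij => /finset.setIidPl.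
have ltj : #|t i :&: t j| < #|t j|.
  by apply: proper_card; rewrite properEneq finset.subsetIr andbT; apply: contraNneq ji => /finset.setIidPr.
move=> /eqP; rewrite addnC => /eqP/(ltn_sqr_uncross lti ltj) lt_sq.
by rewrite /geq /= !addnA leq_add2r leqNgt lt_sq.
Qed.

(* In a laminar family the members entered by a fixed edge form a chain, and
   the parity of the depth [N] alternates along each of these chains. *)
Lemma packs_half w m : packs (fun e => 2 * w e) m -> exists2 m', m <= 2 * m' & packs w m'.
Proof.
case/uncross=> t /andP[/forallP tV /forallP tw] lam.
pose lt i j := (t i \proper t j) || (t i == t j) && (i < j).
pose N i := #|[set j | lt i j || (t i :|: t j == finset.setT)]|.
have lt_sub i j : lt i j -> t i \subset t j.
  by case/orP=> [/proper_sub|/andP[/eqP-> _]].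
have irr : irreflexive lt by move=> i; rewrite /lt properxx ltnn andbF.
have tr : transitive lt.
  move=> j i k /orP[ij|/andP[/eqP ij ltij]] /orP[jk|/andP[/eqP jk ltjk]]; apply/orP.
  - by left; apply: proper_trans jk.
  - by left; rewrite -jk.
  - by left; rewrite ij.
  - by right; rewrite ij jk eqxx (ltn_trans ltij).
pose C e := [set i | e \in entering (t i)].
have chain e : {in C e &, forall i j, i != j -> lt i j || lt j i}.
  move=> i j; rewrite !inE => /andP[hi ti] /andP[hj tj] ne.
  have [eqt|neqt] := eqVneq (t i) (t j).
    by rewrite /lt eqt eqxx /= properxx /= -neq_ltn.
  have := lam i j; rewrite /lt !properEneq neqt [t j == t i]eq_sym neqt.
  rewrite -setI_eq0 => /or4P[-> //|->|/eqP/setP/(_ (hd e))|/eqP/setP/(_ (tl e))].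
  - by rewrite orbT.
  - by rewrite !inE hi hj.
  - by rewrite !inE (negPf ti) (negPf tj).
pose out e i := [set j | j \notin C e & lt i j || (t i :|: t j == finset.setT)].
have NE e i : i \in C e -> N i = #|out e i| + #|[set j in C e | lt i j]|.
  rewrite inE inE => /andP[hi ti]; rewrite /N.
  rewrite -(cardsID (C e)) addnC; congr (_ + _); apply: eq_card => j; rewrite !inE.
    by rewrite andbC.
  rewrite andbC; apply: andb_id2l => /andP[hj tj].
  have -> // : (t i :|: t j == finset.setT) = false; last by rewrite orbF.
  by apply/negP => /eqP/setP/(_ (tl e)); rewrite !inE (negPf ti) (negPf tj).
have out_le e i i' : i \in C e -> i' \in C e -> lt i i' -> out e i = out e i'.
  move=> iC i'C ii'; have ii's := lt_sub _ _ ii'.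
  move: (iC) (i'C); rewrite !inE => /andP[hi ti] /andP[hi' ti'].
  apply/setP => j; rewrite !inE; apply: andb_id2l => jC.
  have Vj : tl e \in t j -> hd e \in t j by have /andP[/V_dicut Vd _] := tV j; apply: Vd.
  have ij := lam i j; have i'j := lam i' j.
  apply/idP/idP => [/orP[ltij|/eqP uT]|/orP[lti'j|/eqP uT]]; last 2 first.
  - by rewrite (tr _ _ _ ii' lti'j).
  - have tj : tl e \in t j by move/setP/(_ (tl e)): uT; rewrite !inE (negPf ti').
    have hj := Vj tj.
    case/or4P: ij => [sub|sub|dj|->]; last by rewrite orbT.
    + by rewrite /lt properE sub /=; case: (boolP (t j \subset t i)) => // /subsetP/(_ _ tj); rewrite (negPf ti).
    + by have := subsetP sub _ tj; rewrite (negPf ti).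
    + by have := disjointFr dj hi; rewrite hj.
  - have sub := lt_sub _ _ ltij; have hj := subsetP sub _ hi.
    case: (boolP (lt i' j)) => //= nlt.
    have tj : tl e \in t j by move: jC; rewrite hj /= negbK.
    case/or4P: i'j => [sub'|sub'|dj|] //.
    + case/negP: nlt; rewrite /lt properE sub' /=.
      by case: (boolP (t j \subset t i')) => // /subsetP/(_ _ tj); rewrite (negPf ti').
    + by have := subsetP sub' _ tj; rewrite (negPf ti').
    + by have := disjointFr dj hi'; rewrite hj.
  - apply/orP; right; apply/eqP/setP => f; move/setP/(_ f): uT; rewrite !inE => /orP[/(subsetP ii's)->|->] //.
    by rewrite orbT.
have out_const e i i' : i \in C e -> i' \in C e -> out e i = out e i'.
  move=> iC i'C; case: (eqVneq i i') => [->//|/(chain e i i' iC i'C)/orP[]].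
    exact: out_le.
  by move/out_le => <-.
have colour e b : #|[set i in C e | odd (N i) == b]| <= w e.
  have [i0 i0C|C0] := pickP (mem (C e)); last first.
    by rewrite (_ : [set i in _ | _] = finset.set0) ?cards0 //; apply/setP => i;
      have /= := C0 i; rewrite !inE => ->.
  have := @card_same_parity _ (C e) lt #|out e i0| b irr tr (chain e).
  have -> : [set i in C e | odd (#|out e i0| + #|[set j in C e | lt i j]|) == b]
      = [set i in C e | odd (N i) == b].
    apply/setP => i; rewrite [LHS]inE [RHS]inE; apply: andb_id2l => iC.
    by rewrite (NE e) // (out_const e i0 i).
  move/leq_trans; apply.
  by apply: leq_uphalf_double; have := tw e; rewrite sum_nat_of_bool.
pose K b := [set i | odd (N i) == b].
have packK b : packs w #|K b|.
  apply/existsP; exists [ffun i => t (enum_val i)]; apply/andP; split; apply/forallP; [move=> i|move=> e].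
    by rewrite ffunE.
  apply: leq_trans (colour e b).
  rewrite sum_nat_of_bool -(card_imset _ enum_val_inj).
  apply: subset_leq_card; apply/subsetP => _ /imsetP[i ei ->].
  have := enum_valP i; move: ei; rewrite !inE ffunE => -> ->; done.
have mE : m = #|K true| + #|K false|.
  rewrite -[LHS]card_ord -cardsT -(cardsID (K true)); congr (_ + _); apply: eq_card => i.
    by rewrite !inE.
  by rewrite !inE eqb_id; case: (odd _).
case: (leqP #|K true| #|K false|) => le.
  by exists #|K false| => //; apply: leq_trans (eq_leq mE) _; rewrite mul2n -addnn leq_add2r.
by exists #|K true| => //; apply: leq_trans (eq_leq mE) _; rewrite mul2n -addnn leq_add2l ltnW.
Qed.

(* Lovasz: packings equal coverings as soon as doubling the capacities at most
   doubles the packings. *)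
Lemma packing_covering (A : {set E}) : exists m (S : {set E}),
  [/\ packs (fun e => e \in A) m, #|S| <= m &
      forall X, V X -> entering X != finset.set0 -> entering X \subset A ->
        entering X :&: S != finset.set0].
Proof.
have [n] := ubnP #|A|; elim: n A => // n IH A /ltnSE leAn.
have exm : exists m, packs (fun e => e \in A) m by exists 0; apply: packs0.
case: (ex_maxnP exm (@packs_le _)) => m pm mmax.
have [/existsP[x /andP[xA npx]]|] :=
  boolP [exists x in A, ~~ packs (fun e => e \in A :\ x) m].
  have [|m' [S [pm' Sm' hit]]] := IH (A :\ x).
    by apply: leq_trans leAn; rewrite [in leqRHS](cardsD1 x) xA.
  have lem : m' <= m.
    apply: mmax; apply: packs_mono pm' => e; rewrite !inE.
    by case: (e \in A); rewrite ?andbF ?leq_b1.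
  have ltm : m' < m by rewrite ltn_neqAle lem andbT; apply: contraNneq npx => <-.
  exists m, (x |: S); split=> // [|X VX X0 XA].
    by rewrite cardsU1; apply: leq_trans ltm; case: (x \notin S); rewrite ?add1n ?ltnS //; lia.
  have [xX|xX] := boolP (x \in entering X).
    by apply/set0Pn; exists x; rewrite !inE eqxx; rewrite inE in xX; rewrite xX.
  have /set0Pn[y] : entering X :&: S != finset.set0.
    by apply: hit; rewrite // subsetD1 XA.
  by rewrite in_setI => /andP[yX yS]; apply/set0Pn; exists y; rewrite in_setI yX !inE yS orbT.
rewrite negb_exists_in => /forall_inP pA.
case: (posnP m) => [m0|m_gt0].
  exists m, finset.set0; split; rewrite ?cards0 // => X VX X0 XA.
  suff /mmax : packs (fun e => e \in A) 1 by rewrite m0.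
  apply/existsP; exists [ffun _ => X]; apply/andP; split; apply/forallP.
    by move=> i; rewrite ffunE VX.
  move=> e; rewrite big_ord1 ffunE.
  by case: (boolP (e \in entering X)) => // /(subsetP XA)->.
exfalso.
pose w (B : {set E}) e := (e \in A) + (e \in B).
pose big (B : {set E}) := (B \subset A) && [exists m' : 'I_(\sum_e w B e).+1, (m < m') && packs (w B) m'].
have bigP (B : {set E}) m' : B \subset A -> packs (w B) m' -> m < m' -> big B.
  move=> BA pB mm'; rewrite /big BA; apply/existsP.
  have lem' : m' < (\sum_e w B e).+1 by rewrite ltnS packs_le.
  by exists (Ordinal lem'); rewrite /= mm'.
have bigA : big A.
  by apply: (bigP _ (m + m)) => //; [apply: packsD | lia].
case: (arg_minnP (fun B : {set E} => #|B|) bigA) => B /andP[BA /existsP[m' /andP[mm' pB]]] minB.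
have [B0|/set0Pn[x xB]] := eqVneq B finset.set0.
  have /mmax : packs (fun e => e \in A) m'.
    by apply: packs_mono pB => e; rewrite /w B0 inE addn0.
  by rewrite leqNgt mm'.
have xA := subsetP BA x xB.
have pAx : packs (fun e => e \in A :\ x) m by have := pA x xA; rewrite negbK.
have [|m'' le'' p''] := @packs_half (w (B :\ x)) (m' + m).
  apply: packs_mono (packsD pB pAx) => e; rewrite /w !inE.
  case: (eqVneq e x) => [->|_] /=; first by rewrite xA xB.
  by case: (boolP (e \in B)) => [/(subsetP BA)->|_]; case: (e \in A).
have := minB (B :\ x); rewrite [#|B|](cardsD1 x) xB ltnn => noB.
suff /noB : big (B :\ x) by [].
apply: bigP p'' _; last by lia.
exact: subset_trans (subD1set _ _) BA.
Qed.

End LucchesiYounger.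

Section Dual.
Variable G : digraph.

Definition circulation (c : edge G -> int) : Prop := forall v,
  \sum_(e | source e == v) c e = \sum_(e | target e == v) c e.

Lemma circulation_balanced (S : {set edge G}) :
  circulation (fun e => (e \in S)%:R) <-> balanced S.
Proof.
have sumE (P : pred (edge G)) :
    \sum_(e | P e) (e \in S)%:R = #|[set e in S | P e]|%:R :> int.
  rewrite -sum1_card natr_sum big_mkcond [RHS]big_mkcond; apply: eq_bigr => e _.
  by rewrite inE; case: (e \in S) (P e) => [] [].
split=> bal v; have := bal v; rewrite !sumE; last by move=> ->.
by move/eqP; rewrite eqr_nat => /eqP.
Qed.

(* [l e] and [r e] are the faces to the left and to the right of [e]. *)
Variables (F : finType) (l r : edge G -> F).
Hypothesis coboundary_circulation :
  forall p : F -> int, circulation (fun e => p (l e) - p (r e)).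
Hypothesis circulation_coboundary : forall c : edge G -> int, circulation c ->
  exists p : F -> int, forall e, c e = p (l e) - p (r e).

Let adj : rel F := fun f g =>
  [exists e, ((l e == f) && (r e == g)) || ((l e == g) && (r e == f))].

Let adj_sym : connect_sym adj.
Proof.
apply: sym_connect_sym => f g; rewrite /adj.
by apply: eq_existsb => e; rewrite orbC.
Qed.

Let const_root (T : eqType) (p : F -> T) :
  (forall e, p (l e) = p (r e)) -> forall f, p (fingraph.root adj f) = p f.
Proof.
move=> pe f; have /connectP[s sp ->] := connect_root adj f.
elim: s f sp => //= g s IH f /andP[/existsP[e ad] /IH ->].
by case/orP: ad => /andP[/eqP<- /eqP<-].
Qed.

(* Normalizing the potentials to be constant on a set of representatives of
   the connected components makes the dual behave as a connected graph. *)
Let dicut (X : {set F}) := [forall e, (r e \in X) ==> (l e \in X)]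
  && [forall f, forall g, (fingraph.root adj f \in X) == (fingraph.root adj g \in X)].

Let dicut_sub X : dicut X -> forall e, r e \in X -> l e \in X.
Proof. by case/andP=> /forallP d _ e; apply/implyP. Qed.

Let dicut_roots X : dicut X -> forall f g, (fingraph.root adj f \in X) = (fingraph.root adj g \in X).
Proof. by case/andP=> _ /forallP d f g; apply/eqP; move/forallP: (d f). Qed.

Let dicutI X Y : dicut X -> dicut Y -> dicut (X :&: Y).
Proof.
move=> dX dY; apply/andP; split.
  apply/forallP => e; apply/implyP; rewrite !inE => /andP[eX eY].
  by rewrite !dicut_sub.
apply/forallP => f; apply/forallP => g; rewrite !inE.
by rewrite (dicut_roots dX f g) (dicut_roots dY f g).
Qed.

Let dicutU X Y : dicut X -> dicut Y -> dicut (X :|: Y).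
Proof.
move=> dX dY; apply/andP; split.
  apply/forallP => e; apply/implyP; rewrite !inE => /orP[eX|eY].
    by rewrite (dicut_sub dX eX).
  by rewrite (dicut_sub dY eY) orbT.
apply/forallP => f; apply/forallP => g; rewrite !inE.
by rewrite (dicut_roots dX f g) (dicut_roots dY f g).
Qed.

Let dicut_conn X : dicut X -> entering r l X = finset.set0 ->
  X = finset.set0 \/ X = finset.setT.
Proof.
move=> dX X0.
have rootX := @const_root _ (fun f => f \in X).
have {}rootX f : (fingraph.root adj f \in X) = (f \in X).
  apply: rootX => e; have := dicut_sub dX (e := e).
  move/setP/(_ e): X0; rewrite !inE.
  by case: (l e \in X); case: (r e \in X) => //= _ /(_ isT).
have [X0'|/set0Pn[f fX]] := eqVneq X finset.set0; [by left|right].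
by apply/setP => g; rewrite inE -rootX -(dicut_roots dX f) rootX.
Qed.

Let entering_balanced X : dicut X -> balanced (entering r l X).
Proof.
move=> dX; apply/circulation_balanced => v.
have := coboundary_circulation (fun f => (f \in X)%:R) v.
have E e : (l e \in X)%:R - (r e \in X)%:R = (e \in entering r l X)%:R :> int.
  rewrite inE; have := dicut_sub dX (e := e).
  by case: (l e \in X); case: (r e \in X) => //= /(_ isT).
by under eq_bigr do rewrite E; under [RHS]eq_bigr do rewrite E.
Qed.

Let dicycle_dicut D : dicycle_set D -> exists2 X, dicut X &
  entering r l X != finset.set0 /\ entering r l X \subset D.
Proof.
move=> dD; have /circulation_balanced/circulation_coboundary[p pE] := dicycle_set_balanced dD.
have /set0Pn[e eD] := dicycle_set_neq0 dD.
pose q f := p f - p (fingraph.root adj f).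
have qE e' : (e' \in D)%:R = q (l e') - q (r e').
  rewrite pE /q; suff -> : fingraph.root adj (l e') = fingraph.root adj (r e') by ring.
  apply/eqP; rewrite fingraph.root_connect //; apply: connect1; apply/existsP; exists e'.
  by rewrite !eqxx.
have q0 f : q (fingraph.root adj f) = 0 by rewrite /q fingraph.root_root ?subrr.
exists [set f | q (l e) <= q f].
  apply/andP; split; apply/forallP; [move=> e'|move=> f].
    by apply/implyP; rewrite !inE => /le_trans; apply; rewrite -subr_ge0 -qE ler0n.
  by apply/forallP => g; rewrite !inE !q0.
split.
  apply/set0Pn; exists e; rewrite !inE lexx /= -ltNge -subr_gt0 -qE eD.
  exact: ltr01.
apply/subsetP => e'; rewrite !inE -ltNge => /andP[le1 lt2].
have : 0 < q (l e') - q (r e') by rewrite subr_gt0 (lt_le_trans lt2).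
by rewrite -qE; case: (e' \in D).
Qed.

Theorem dual_alpha_beta : alpha G = beta G.
Proof.
apply/eqP; rewrite eqn_leq alpha_le_beta /=.
have [m [S [/existsP[t /andP[/forallP tV /forallP tw]] Sm hit]]] :=
  packing_covering dicut_sub dicutI dicutU dicut_conn finset.setT.
apply: leq_trans (beta_le _) (leq_trans Sm _).
  apply/forallP => D; apply/implyP => /dicycle_dicut[X dX [X0 XD]].
  have /set0Pn[e] := hit X dX X0 (finset.subsetT _).
  rewrite in_setI => /andP[/(subsetP XD) eD eS].
  by apply/set0Pn; exists e; rewrite in_setI eD.
rewrite -[leqLHS]card_ord; apply: (card_le_alpha (S := fun i => entering r l (t i))).
  move=> i; have /andP[dt t0] := tV i.
  exact: dicycle_of_balanced t0 (entering_balanced dt).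
move=> i j ij; rewrite -setI_eq0; apply/eqP/setP => e; rewrite in_setI in_set0.
apply/negP => /andP[ei ej]; have := tw e.
by rewrite (bigD1 i) //= (bigD1 j) 1?eq_sym //= ei ej inE.
Qed.

End Dual.

(** * Grid minors *)

Section Grid.

(* Horizontal ([true]) and vertical edges of the grid [nat * nat], given by
   their lower left endpoint. *)
Definition grid_edge : Type := (bool * (nat * nat))%type.
HB.instance Definition _ := Choice.on grid_edge.

Definition gsrc (h : grid_edge) : nat * nat := h.2.
Definition gtgt (h : grid_edge) : nat * nat :=
  if h.1 then (h.2.1.+1, h.2.2) else (h.2.1, h.2.2.+1).

(* The face [(x.+1, y.+1)] is the square with lower left corner [(x, y)]. *)
Definition lface (h : grid_edge) : nat * nat :=
  if h.1 then (h.2.1.+1, h.2.2.+1) else (h.2.1, h.2.2.+1).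
Definition rface (h : grid_edge) : nat * nat :=
  if h.1 then (h.2.1.+1, h.2.2) else (h.2.1.+1, h.2.2.+1).

Definition div (k : grid_edge -> int) (g : nat * nat) : int :=
  k (true, g) + k (false, g)
  - (if g.1 is x.+1 then k (true, (x, g.2)) else 0)
  - (if g.2 is y.+1 then k (false, (g.1, y)) else 0).

Definition delta_chain (h : grid_edge) : grid_edge -> int := fun h' => (h' == h)%:R.

Lemma div_delta h g : div (delta_chain h) g = (g == gsrc h)%:R - (g == gtgt h)%:R.
Proof.
case: h g => -[] [a b] [x y]; rewrite /div /delta_chain /gsrc /gtgt /= !xpair_eqE ?andbF /=.
- by case: x => [|x]; case: y => [|y]; rewrite /= ?xpair_eqE ?eqSS ?addr0 ?subr0.
- by case: x => [|x]; case: y => [|y]; rewrite /= ?xpair_eqE ?eqSS ?andbF ?addr0 ?add0r ?subr0.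
Qed.

Lemma div_comb (I : finType) (a : I -> int) (k : I -> grid_edge -> int) g :
  div (fun h => \sum_i a i * k i h) g = \sum_i a i * div (k i) g.
Proof.
rewrite /div; case: g => -[|x] [|y] /=;
  under [RHS]eq_bigr do rewrite ?subr0 ?mulrBr ?mulrDr;
  by rewrite ?sumrB ?big_split /= ?subr0.
Qed.

Lemma div_add k k' g : div (fun h => k h + k' h) g = div k g + div k' g.
Proof. by rewrite /div; case: g => -[|x] [|y] /=; ring. Qed.

Lemma div_opp k g : div (fun h => - k h) g = - div k g.
Proof. by rewrite /div; case: g => -[|x] [|y] /=; ring. Qed.

Lemma grid_potential (k : grid_edge -> int) : (forall g, div k g = 0) ->
  exists q : nat * nat -> int, forall h, k h = q (lface h) - q (rface h).
Proof.
move=> k0; pose q (f : nat * nat) :=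
  if f.1 is x.+1 then \sum_(j < f.2) k (true, (x, nat_of_ord j)) else 0.
exists q => -[[] [x y]]; rewrite /lface /rface /=.
  by rewrite /q /= big_ord_recr /= [X in _ = X - _]addrC addrK.
elim: y => [|y IH].
  have := k0 (x, 0%N); rewrite /div /q /= !big_ord_recr !big_ord0 /=.
  by case: x => [|x] /=; rewrite ?big_ord_recr ?big_ord0 /=; lia.
have := k0 (x, y.+1); rewrite /div /=.
have -> : q (x.+1, y.+2) = q (x.+1, y.+1) + k (true, (x, y.+1)).
  by rewrite /q /= [in LHS]big_ord_recr.
have -> : q (x, y.+2) = q (x, y.+1) + (if x is x'.+1 then k (true, (x', y.+1)) else 0).
  by rewrite /q /=; case: (x) => [|x'] //; rewrite [in LHS]big_ord_recr.
by move: IH; case: (x) => [|x'] /=; lia.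
Qed.

Lemma div_coboundary (q : nat * nat -> int) x y :
  div (fun h => q (lface h) - q (rface h)) (x.+1, y.+1) = 0.
Proof. by rewrite /div /lface /rface /=; ring. Qed.

Lemma sum_shift K (f a : nat -> int) : f K = 0 ->
  \sum_(x < K) f x * (if nat_of_ord x is x'.+1 then a x' else 0)
  = \sum_(x < K) f x.+1 * a x.
Proof.
case: K => [|K] fK; first by rewrite !big_ord0.
by rewrite big_ord_recl big_ord_recr /= mulr0 add0r fK mul0r addr0.
Qed.

Lemma sum_by_parts K (phi : nat * nat -> int) (k : grid_edge -> int) :
    (forall y, phi (K, y) = 0) -> (forall x, phi (x, K) = 0) ->
  \sum_(x < K) \sum_(y < K) phi (nat_of_ord x, nat_of_ord y) * div k (nat_of_ord x, nat_of_ord y)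
  = \sum_(b : bool) \sum_(x < K) \sum_(y < K)
      k (b, (nat_of_ord x, nat_of_ord y))
      * (phi (gsrc (b, (nat_of_ord x, nat_of_ord y))) - phi (gtgt (b, (nat_of_ord x, nat_of_ord y)))).
Proof.
move=> phix phiy.
have E1 : \sum_(x < K) \sum_(y < K) phi (nat_of_ord x, nat_of_ord y)
      * (if nat_of_ord x is x'.+1 then k (true, (x', nat_of_ord y)) else 0)
    = \sum_(x < K) \sum_(y < K) phi (x.+1, nat_of_ord y) * k (true, (nat_of_ord x, nat_of_ord y)).
  rewrite exchange_big [RHS]exchange_big; apply: eq_bigr => y _.
  exact: (@sum_shift K (fun x => phi (x, nat_of_ord y)) (fun x => k (true, (x, nat_of_ord y)))).
have E2 : \sum_(x < K) \sum_(y < K) phi (nat_of_ord x, nat_of_ord y)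
      * (if nat_of_ord y is y'.+1 then k (false, (nat_of_ord x, y')) else 0)
    = \sum_(x < K) \sum_(y < K) phi (nat_of_ord x, y.+1) * k (false, (nat_of_ord x, nat_of_ord y)).
  apply: eq_bigr => x _.
  exact: (@sum_shift K (fun y => phi (nat_of_ord x, y)) (fun y => k (false, (nat_of_ord x, y)))).
rewrite big_bool /= /gsrc /gtgt /=.
under eq_bigr => x _.
  under eq_bigr => y _ do rewrite /div /= mulrBr mulrBr mulrDr.
  rewrite !sumrB big_split /=.
  over.
rewrite !sumrB big_split /= E1 E2.
under [in RHS]eq_bigr => x _.
  under eq_bigr => y _ do rewrite mulrBr.
  rewrite sumrB /=.
  over.
under [X in _ = _ + X]eq_bigr => x _.
  under eq_bigr => y _ do rewrite mulrBr.
  rewrite sumrB /=.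
  over.
rewrite !sumrB.
have C (A B : 'I_K -> 'I_K -> int) :
    \sum_x \sum_y A x y * B x y = \sum_x \sum_y B x y * A x y.
  by apply: eq_bigr => x _; apply: eq_bigr => y _; rewrite mulrC.
rewrite [X in X + _ - _ - _]C [X in _ + X - _ - _]C [X in _ - X - _]C [X in _ - _ - X]C.
by rewrite [RHS]addrACA !addrA.
Qed.

End Grid.

Section GridMinor.
Variables (G : digraph) (M : nat) (mu : nat * nat -> option (vertex G)).
Variables (base : vertex G -> nat * nat) (iota : edge G -> grid_edge) (sg : edge G -> bool).

Let nl (e : edge G) := source e != target e.

(* The fibres of [mu] are the branch sets of [G] as a minor of the grid;
   connectedness is expressed by flows. *)
Hypothesis mu_box : forall g v, mu g = Some v ->
  [/\ (0 < g.1)%N, (0 < g.2)%N, (g.1 < M)%N & (g.2 < M)%N].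
Hypothesis mu_linked : forall g v, mu g = Some v -> exists2 k : grid_edge -> int,
  (forall h, k h != 0 -> mu (gsrc h) = Some v /\ mu (gtgt h) = Some v) &
  forall g', div k g' = (g' == g)%:R - (g' == base v)%:R.
Hypothesis iota_src : forall e, nl e ->
  mu (if sg e then gsrc (iota e) else gtgt (iota e)) = Some (source e).
Hypothesis iota_tgt : forall e, nl e ->
  mu (if sg e then gtgt (iota e) else gsrc (iota e)) = Some (target e).
Hypothesis iota_inj : forall e f, nl e -> nl f -> iota e = iota f -> e = f.

Let face : finType := ('I_M.+1 * 'I_M.+1)%type.
Let fpos (f : face) : nat * nat := (nat_of_ord f.1, nat_of_ord f.2).
Let toF (g : nat * nat) : face := (inord g.1, inord g.2).

Let toFK g : (g.1 <= M)%N -> (g.2 <= M)%N -> fpos (toF g) = g.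
Proof. by case: g => a b /= aM bM; rewrite /fpos /toF /= !inordK. Qed.

Let deleted (h : grid_edge) :=
  ~ (exists v, mu (gsrc h) = Some v /\ mu (gtgt h) = Some v)
  /\ ~ exists2 e, nl e & iota e = h.

Let adj : rel face := fun f g => `[< exists2 h, deleted h &
  (lface h = fpos f /\ rface h = fpos g) \/ (lface h = fpos g /\ rface h = fpos f) >].

Let adj_sym : connect_sym adj.
Proof.
by apply: sym_connect_sym => f g; apply/asboolP/asboolP => -[h dh [?|?]];
  exists h => //; [right|left|right|left].
Qed.

Let dual_face : finType := (face + edge G)%type.
Let frep g : dual_face := inl (fingraph.root adj (toF g)).
Let l (e : edge G) : dual_face :=
  if nl e then frep (if sg e then lface (iota e) else rface (iota e)) else inr e.
Let r (e : edge G) : dual_face :=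
  if nl e then frep (if sg e then rface (iota e) else lface (iota e)) else frep (0%N, 0%N).

Let sgn (e : edge G) : int := if sg e then 1 else -1.

Let mem_box h v : mu (gsrc h) = Some v \/ mu (gtgt h) = Some v ->
  [/\ (lface h).1 <= M, (lface h).2 <= M, (rface h).1 <= M & (rface h).2 <= M]%N.
Proof.
by case: h => -[] [x y] [] /mu_box[]; rewrite /gsrc /gtgt /lface /rface /= => *; split; lia.
Qed.

Let iota_ends e : nl e ->
  [\/ mu (gsrc (iota e)) = Some (source e) /\ mu (gtgt (iota e)) = Some (target e)
    | mu (gsrc (iota e)) = Some (target e) /\ mu (gtgt (iota e)) = Some (source e)].
Proof.
by move=> ne; have := iota_src ne; have := iota_tgt ne; case: (sg e) => ? ?; [left|right].
Qed.

Let coboundary_circulation (p : dual_face -> int) :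
  circulation (fun e => p (l e) - p (r e)).
Proof.
move=> v; set c := fun e => p (l e) - p (r e).
pose q (g : nat * nat) := p (frep g).
pose k h := q (lface h) - q (rface h).
pose phi g : int := (mu g == Some v)%:R.
pose d e : int := (source e == v)%:R - (target e == v)%:R.
have dE e : nl e -> k (iota e) * (phi (gsrc (iota e)) - phi (gtgt (iota e))) = c e * d e.
  move=> ne; have := iota_src ne; have := iota_tgt ne.
  rewrite /c /l /r ne /k /q /phi /d; case: (sg e) => -> ->;
    by rewrite !(inj_eq (@Some_inj _)) //; ring.
have k_del h : deleted h -> k h * (phi (gsrc h) - phi (gtgt h)) = 0.
  move=> dh; case: (boolP ((mu (gsrc h) == Some v) || (mu (gtgt h) == Some v))); last first.
    by rewrite negb_or /phi => /andP[/negPf-> /negPf->]; rewrite subrr mulr0.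
  move=> inc; have [|a1 a2 b1 b2] := @mem_box h v.
    by case/orP: inc => /eqP; [left|right].
  rewrite /k /q /frep; suff -> : fingraph.root adj (toF (lface h)) = fingraph.root adj (toF (rface h)).
    by rewrite subrr mul0r.
  apply/eqP; rewrite fingraph.root_connect //; apply: connect1; apply/asboolP; exists h => //.
  by left; rewrite !toFK.
have zero : \sum_(x < M) \sum_(y < M) phi (nat_of_ord x, nat_of_ord y)
    * div k (nat_of_ord x, nat_of_ord y) = 0.
  rewrite big1 // => x _; rewrite big1 // => y _; rewrite /phi.
  case: eqP => [/mu_box[/=]|_]; last by rewrite mul0r.
  by case: (nat_of_ord x) (nat_of_ord y) => [//|x'] [//|y'] _ _ _ _; rewrite div_coboundary mulr0.
move: zero; rewrite sum_by_parts; last 2 first.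
- by move=> y; rewrite /phi; case: eqP => // /mu_box[/= _ _]; rewrite ltnn.
- by move=> x; rewrite /phi; case: eqP => // /mu_box[/= _ _ _]; rewrite ltnn.
pose hb (b : bool * ('I_M * 'I_M)) : grid_edge := (b.1, (nat_of_ord b.2.1, nat_of_ord b.2.2)).
have -> : \sum_(b : bool) \sum_(x < M) \sum_(y < M) k (b, (nat_of_ord x, nat_of_ord y))
      * (phi (gsrc (b, (nat_of_ord x, nat_of_ord y))) - phi (gtgt (b, (nat_of_ord x, nat_of_ord y))))
    = \sum_b k (hb b) * (phi (gsrc (hb b)) - phi (gtgt (hb b))).
  under eq_bigr => b _ do rewrite pair_bigA /=.
  by rewrite pair_bigA.
have -> : \sum_b k (hb b) * (phi (gsrc (hb b)) - phi (gtgt (hb b)))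
    = \sum_b \sum_(e | nl e) (iota e == hb b)%:R * (c e * d e).
  apply: eq_bigr => b _; set h := hb b.
  have [[e ne eh]|no] := pselect (exists2 e, nl e & iota e = h).
    rewrite (bigD1 e) //= eh eqxx mul1r -dE // eh big1 ?addr0 // => f /andP[nf ef].
    case: eqP; rewrite ?mul0r // => fh; case/eqP: ef.
    by apply: iota_inj; rewrite // fh.
  rewrite [RHS]big1; last first.
    by move=> e ne; case: eqP; rewrite ?mul0r // => eh; case: no; exists e.
  have [[w [sw tw]]|no'] := pselect (exists v, mu (gsrc h) = Some v /\ mu (gtgt h) = Some v).
    by rewrite /phi sw tw subrr mulr0.
  exact: k_del.
rewrite exchange_big /=.
have -> : \sum_(e | nl e) \sum_b (iota e == hb b)%:R * (c e * d e) = \sum_e c e * d e.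
  rewrite [RHS](bigID nl) /= [X in _ + X]big1 ?addr0; last first.
    by move=> e; rewrite /nl /d negbK => /eqP->; rewrite subrr mulr0.
  apply: eq_bigr => e ne; rewrite -mulr_suml.
  have [x1 x2] : ((gsrc (iota e)).1 < M)%N /\ ((gsrc (iota e)).2 < M)%N.
    by case: (iota_ends ne) => -[/mu_box[]].
  pose b0 := ((iota e).1, (Ordinal x1, Ordinal x2)).
  have b0E : hb b0 = iota e by rewrite /hb /b0 /=; case: (iota e) => ? [].
  rewrite (bigD1 b0) //= b0E eqxx big1 ?addr0 ?mul1r // => b bb0.
  case: eqP => // eb; case/eqP: bb0; move: eb; rewrite -b0E /hb /=.
  case: b => b [x y] /= [eb ex ey]; rewrite /b0 eb.
  by congr (_, (_, _)); apply: val_inj; rewrite /= ?ex ?ey.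
rewrite (eq_bigr (fun e => c e * (source e == v)%:R - c e * (target e == v)%:R)); last first.
  by move=> e _; rewrite mulrBr.
rewrite sumrB => /eqP; rewrite subr_eq0 => /eqP sum_eq.
rewrite [LHS]big_mkcond [RHS]big_mkcond.
by under eq_bigr do rewrite -mulrb -mulr_natr; under [RHS]eq_bigr do rewrite -mulrb -mulr_natr.
Qed.

Let circulation_coboundary (c : edge G -> int) : circulation c ->
  exists p : dual_face -> int, forall e, c e = p (l e) - p (r e).
Proof.
move=> circ.
have exk (e : edge G) : exists k : grid_edge -> int, nl e ->
    [/\ k (iota e) = sgn e,
        forall f, nl f -> f != e -> k (iota f) = 0,
        forall h, deleted h -> k h = 0
      & forall g, div k g = (g == base (source e))%:R - (g == base (target e))%:R].
  have [ne|] := boolP (nl e); last by exists (fun=> 0).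
  have [ks ks0 kd] := mu_linked (iota_src ne).
  have [kt kt0 td] := mu_linked (iota_tgt ne).
  have iota0 f : nl f -> ks (iota f) = 0 /\ kt (iota f) = 0.
    move=> nf; split; apply/eqP/negPn/negP; [move/ks0|move/kt0]; case=> E1 E2.
      by case: (iota_ends nf); rewrite E1 E2 => -[[E3] [E4]]; case/eqP: nf; rewrite -E3 -E4.
    by case: (iota_ends nf); rewrite E1 E2 => -[[E3] [E4]]; case/eqP: nf; rewrite -E3 -E4.
  exists (fun h => sgn e * delta_chain (iota e) h + (- ks h + kt h)) => _; split.
  - by have [-> ->] := iota0 e ne; rewrite /delta_chain eqxx mulr1 oppr0 !addr0.
  - move=> f nf fe; have [-> ->] := iota0 f nf; rewrite /delta_chain.
    case: eqP => [/iota_inj ef|_]; last by rewrite mulr0 oppr0 !addr0.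
    by case/eqP: fe; apply: ef.
  - move=> h [nin nio].
    have -> : ks h = 0.
      by apply/eqP/negPn/negP => /ks0 ?; apply: nin; exists (source e).
    have -> : kt h = 0.
      by apply/eqP/negPn/negP => /kt0 ?; apply: nin; exists (target e).
    rewrite /delta_chain; case: eqP => [he|_]; last by rewrite mulr0 oppr0 !addr0.
    by case: nio; exists e.
  - move=> g; rewrite (@div_add (fun h => sgn e * delta_chain (iota e) h)) div_add div_opp kd td.
    have -> : div (fun h => sgn e * delta_chain (iota e) h) g = sgn e * div (delta_chain (iota e)) g.
      by rewrite /div; case: (g) => -[|x] [|y] /=; ring.
    by rewrite div_delta /sgn; case: (sg e); ring.
pose W e := projT1 (cid (exk e)).
have WP e : nl e -> [/\ W e (iota e) = sgn e,
    forall f, nl f -> f != e -> W e (iota f) = 0,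
    forall h, deleted h -> W e h = 0
  & forall g, div (W e) g = (g == base (source e))%:R - (g == base (target e))%:R].
  exact: (projT2 (cid (exk e))).
pose cc h := \sum_e (if nl e then c e else 0) * W e h.
have cc0 g : div cc g = 0.
  rewrite div_comb.
  have -> : \sum_e (if nl e then c e else 0) * div (W e) g
      = \sum_e (c e * (g == base (source e))%:R - c e * (g == base (target e))%:R).
    apply: eq_bigr => e _; have [ne|] := boolP (nl e).
      by have [_ _ _ ->] := WP e ne; rewrite mulrBr.
    by rewrite /nl negbK => /eqP->; rewrite mul0r subrr.
  rewrite sumrB (partition_big (@source G) xpredT) //= [X in _ - X](partition_big (@target G) xpredT) //=.
  rewrite -sumrB big1 // => v _.
  rewrite (eq_bigr (fun e => c e * (g == base v)%:R)); last by move=> e /eqP->.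
  rewrite [X in _ - X](eq_bigr (fun e => c e * (g == base v)%:R)); last by move=> e /eqP->.
  by rewrite -!mulr_suml circ subrr.
have [q qE] := grid_potential cc0.
have q_del h : deleted h -> q (lface h) = q (rface h).
  move=> dh; apply/eqP; rewrite -subr_eq0 -qE /cc big1 // => e _.
  by have [ne|] := boolP (nl e); rewrite ?mul0r //; have [_ _ -> //] := WP e ne; rewrite mulr0.
have q_root f : q (fpos (fingraph.root adj f)) = q (fpos f).
  have /connectP[s sp ->] := fingraph.connect_root adj f.
  elim: s f sp => //= g s IH f /andP[/asboolP[h dh fg] /IH ->].
  by move: (q_del h dh); case: fg => -[-> ->].
have cc_iota e : nl e -> cc (iota e) = sgn e * c e.
  move=> ne; rewrite /cc (bigD1 e) //= ne; have [-> _ _ _] := WP e ne.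
  rewrite big1 ?addr0 1?mulrC // => f fe.
  have [nf|] := boolP (nl f); last by rewrite mul0r.
  by have [_ -> //] := WP f nf; rewrite ?mulr0 // eq_sym.
pose p (f : dual_face) := match f with
  | inl f => q (fpos f)
  | inr e => q (fpos (toF (0%N, 0%N))) + c e end.
exists p => e; rewrite /l /r; have [ne|_] := boolP (nl e); last first.
  by rewrite /p /frep q_root addrC addKr.
have [|a1 a2 b1 b2] := @mem_box (iota e) (if sg e then source e else target e).
  by left; have := iota_src ne; have := iota_tgt ne; case: (sg e).
have := cc_iota e ne; rewrite qE /p /frep !q_root !toFK; try by case: (sg e).
by rewrite /sgn; case: (sg e); lia.
Qed.

Lemma grid_minor_alpha_beta : alpha G = beta G.
Proof. exact: dual_alpha_beta coboundary_circulation circulation_coboundary. Qed.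

End GridMinor.

Section GridDrawing.

Definition grid_step (a b : nat * nat) : Prop := a = b \/ exists h,
  (gsrc h = a /\ gtgt h = b) \/ (gsrc h = b /\ gtgt h = a).

Variables (G : digraph) (M n : nat) (pos : vertex G -> nat * nat).
Variable walk : edge G -> nat -> nat * nat.

(* A walk lasts [3 * n]; its first and last thirds belong to the blobs of its
   ends. *)
Definition at_end (e : edge G) (i : nat) (v : vertex G) : Prop :=
  ((i <= n)%N /\ source e = v) \/ ((2 * n <= i <= 3 * n)%N /\ target e = v).

Hypothesis walk0 : forall e, walk e 0%N = pos (source e).
Hypothesis walk1 : forall e, walk e (3 * n)%N = pos (target e).
Hypothesis walk_step : forall e i, (i < 3 * n)%N -> grid_step (walk e i) (walk e i.+1).
Hypothesis walk_box : forall e i, (i <= 3 * n)%N ->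
  [/\ (0 < (walk e i).1)%N, (0 < (walk e i).2)%N, ((walk e i).1 < M)%N & ((walk e i).2 < M)%N].
Hypothesis ends_disjoint : forall e i v f j w, at_end e i v -> at_end f j w ->
  walk e i = walk f j -> v = w.
Hypothesis mid_disjoint : forall e i f j, (n <= i <= 2 * n)%N -> (n <= j <= 2 * n)%N ->
  walk e i = walk f j -> e = f.
Hypothesis mid_end_disjoint : forall e i f j w, (n <= i <= 2 * n)%N -> at_end f j w ->
  walk e i = walk f j -> w = source e \/ w = target e.

Let blob (v : vertex G) (g : nat * nat) : Prop := exists e i, at_end e i v /\ walk e i = g.

Let last_exit (e : edge G) : exists k, source e != target e ->
  [/\ (n <= k < 2 * n)%N, blob (source e) (walk e k)
    & forall j, (k < j <= 2 * n)%N -> ~ blob (source e) (walk e j)].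
Proof.
have [ne|] := boolP (source e != target e); last by exists 0%N.
pose P k := (n <= k <= 2 * n)%N && `[< blob (source e) (walk e k) >].
have exP : exists k, P k.
  by exists n; apply/andP; split; [lia | apply/asboolP; exists e, n; split; [left|]].
have boundP k : P k -> (k <= 2 * n)%N by case/andP; lia.
case: (ex_maxnP exP boundP) => k /andP[kn /asboolP bk] kmax; exists k => _; split=> //.
  suff : k != (2 * n)%N by lia.
  apply/eqP => k2; case: bk => f [j [fj fe]].
  have /esym/eqP : source e = target e.
    by apply: ends_disjoint fj _ fe; right; rewrite k2; split=> //; lia.
  by rewrite eq_sym (negPf ne).
move=> j /andP[kj jn] bj; have : P j by apply/andP; split; [lia | apply/asboolP].
by move/kmax; lia.
Qed.

Let exit (e : edge G) := projT1 (cid (last_exit e)).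
Let exitP e : source e != target e ->
  [/\ (n <= exit e < 2 * n)%N, blob (source e) (walk e (exit e))
    & forall j, (exit e < j <= 2 * n)%N -> ~ blob (source e) (walk e j)].
Proof. exact: (projT2 (cid (last_exit e))). Qed.

Let tail (e : edge G) (g : nat * nat) : Prop :=
  source e != target e /\ exists2 j, (exit e < j <= 2 * n)%N & walk e j = g.

Let branch (v : vertex G) (g : nat * nat) : Prop :=
  blob v g \/ exists2 e, target e = v & tail e g.

Let branch_inj v w g : branch v g -> branch w g -> v = w.
Proof.
have bt u e : blob u g -> tail e g -> u = target e.
  move=> bu [ne [j jn jg]]; case: (bu) => f [i [fi fg]].
  have [k1 _ kl] := exitP ne.
  have jm : (n <= j <= 2 * n)%N by lia.
  have [ue|//] := mid_end_disjoint jm fi (etrans jg (esym fg)).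
  by case: (kl j jn); rewrite jg -ue.
case=> [bv|[e <- te]] [bw|[f <- tf]].
- case: bv bw => e [i [ei eg]] [f [j [fj fg]]].
  by apply: ends_disjoint ei fj _; rewrite eg fg.
- exact: bt tf.
- by rewrite (bt _ _ bw te).
- case: te tf => [ne [i ie ig]] [nf [j jf jg]].
  have [k1 _ _] := exitP ne; have [k2 _ _] := exitP nf.
  by rewrite (@mid_disjoint e i f j) ?ig ?jg //; lia.
Qed.

Let mu (g : nat * nat) : option (vertex G) := [pick v | `[< branch v g >]].

Let muP g v : mu g = Some v <-> branch v g.
Proof.
rewrite /mu; case: pickP => [w /asboolP bw|no].
  by split=> [[<-]//|bv]; congr Some; apply: branch_inj bw bv.
by split=> // bv; have := no v; rewrite asboolT.
Qed.

Let mu_box g v : mu g = Some v ->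
  [/\ (0 < g.1)%N, (0 < g.2)%N, (g.1 < M)%N & (g.2 < M)%N].
Proof.
case/muP=> [[e [i [ei <-]]]|[e _ [ne [j jn <-]]]]; apply: walk_box.
  by case: ei => -[]; lia.
by have [] := exitP ne; lia.
Qed.

Let linked v g := exists2 k : grid_edge -> int,
  (forall h, k h != 0 -> mu (gsrc h) = Some v /\ mu (gtgt h) = Some v) &
  forall g', div k g' = (g' == g)%:R - (g' == pos v)%:R.

Let linked_step v a b : branch v a -> branch v b -> grid_step a b \/ grid_step b a ->
  linked v a -> linked v b.
Proof.
move=> /muP ma /muP mb st [k k0 kd].
have [ab|[h hab]] : a = b \/ exists h,
    (gsrc h = a /\ gtgt h = b) \/ (gsrc h = b /\ gtgt h = a).
  case: st => -[ab|[h hh]]; [by left| |by left|]; right; exists h => //.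
  by case: hh; [right|left].
  by exists k => //; rewrite -ab.
have [s sE] : exists s : int, forall g, s * ((g == gsrc h)%:R - (g == gtgt h)%:R)
    = (g == b)%:R - (g == a)%:R.
  case: hab => -[-> ->]; [exists (-1)|exists 1] => g; ring.
exists (fun h' => s * delta_chain h h' + k h') => [h'|g].
  rewrite /delta_chain; have [-> _|_] := eqVneq h' h; last by rewrite mulr0 add0r => /k0.
  by case: hab => -[-> ->].
rewrite (@div_add (fun h' => s * delta_chain h h')) kd.
have -> : div (fun h' => s * delta_chain h h') g = s * div (delta_chain h) g.
  by rewrite /div; case: (g) => -[|x] [|y] /=; ring.
by rewrite div_delta sE; ring.
Qed.

Let linked_pos v : linked v (pos v).
Proof. by exists (fun=> 0) => [h|g]; rewrite ?eqxx // subrr /div; case: g => -[|x] [|y]. Qed.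

Let linked_tgt e i : (2 * n <= i <= 3 * n)%N -> linked (target e) (walk e i).
Proof.
move=> /andP[n2 n3]; move: n2; have -> : i = (3 * n - (3 * n - i))%N by lia.
have : (3 * n - i <= 3 * n)%N by lia.
elim: (3 * n - i)%N => [|k IH] kn n2; first by rewrite subn0 walk1; apply: linked_pos.
have bt j : (2 * n <= j <= 3 * n)%N -> branch (target e) (walk e j).
  by move=> jn; left; exists e, j; split=> //; right.
apply: linked_step (IH _ _); [apply: bt|apply: bt| |..]; try lia.
right; have -> : (3 * n - k = (3 * n - k.+1).+1)%N by lia.
by apply: walk_step; lia.
Qed.

Let mu_linked g v : mu g = Some v -> linked v g.
Proof.
case/muP=> [[e [i [[[i_n <-]|[i_n <-]] <-]]]|[e <- [ne [j jn <-]]]].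
- elim: i i_n => [|i IH] i_n; first by rewrite walk0; apply: linked_pos.
  apply: linked_step (IH (ltnW i_n)).
  + by left; exists e, i; split=> //; left; split=> //; lia.
  + by left; exists e, i.+1; split=> //; left.
  + by left; apply: walk_step; lia.
- exact: linked_tgt.
- have := jn; have -> : j = (2 * n - (2 * n - j))%N by lia.
  elim: (2 * n - j)%N => [|k IH] kn.
    by apply: linked_tgt; have := exitP ne; lia.
  have bt i : (exit e < i <= 2 * n)%N -> branch (target e) (walk e i).
    by move=> i_n; right; exists e => //; split=> //; exists i.
  apply: linked_step (IH _); [apply: bt|apply: bt| |]; try lia.
  right; have -> : (2 * n - k = (2 * n - k.+1).+1)%N by lia.
  by apply: walk_step; lia.
Qed.

Let crossing (e : edge G) : exists hs : grid_edge * bool, source e != target e ->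
  if hs.2 then gsrc hs.1 = walk e (exit e) /\ gtgt hs.1 = walk e (exit e).+1
  else gsrc hs.1 = walk e (exit e).+1 /\ gtgt hs.1 = walk e (exit e).
Proof.
have [ne|_] := boolP (source e != target e); last by exists ((true, (0, 0))%N, true).
have [en be el] := exitP ne.
have [|eqw|[h [hh|hh]]] := @walk_step e (exit e); first by lia.
- by case: (el (exit e).+1); [lia | rewrite -eqw].
- by exists (h, true).
- by exists (h, false).
Qed.

Let iota e := (projT1 (cid (crossing e))).1.
Let sg e := (projT1 (cid (crossing e))).2.
Let iotaP e : source e != target e ->
  if sg e then gsrc (iota e) = walk e (exit e) /\ gtgt (iota e) = walk e (exit e).+1
  else gsrc (iota e) = walk e (exit e).+1 /\ gtgt (iota e) = walk e (exit e).
Proof. exact: (projT2 (cid (crossing e))). Qed.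

Lemma grid_drawing_alpha_beta : alpha G = beta G.
Proof.
apply: (@grid_minor_alpha_beta G M mu pos iota sg) => //.
- move=> e ne; have [en be el] := exitP ne; apply/muP; left.
  by have := iotaP ne; case: (sg e) => -[E1 E2]; rewrite ?E1 ?E2.
- move=> e ne; have [en be el] := exitP ne; apply/muP; right; exists e => //.
  split=> //; exists (exit e).+1; first by lia.
  by have := iotaP ne; case: (sg e) => -[E1 E2]; rewrite ?E1 ?E2.
- move=> e f ne nf ef.
  have [en _ _] := exitP ne; have [fn _ _] := exitP nf.
  have := iotaP ne; have := iotaP nf; rewrite -ef.
  case: (sg e) (sg f) => [] [] [-> _] [eq1 _];
    apply: (@mid_disjoint e _ f _ _ _ (esym eq1)); lia.
Qed.

End GridDrawing.

(** * Elementary symmetric polynomials at the vertices *)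

Section ElementarySymmetric.
Variables (B : comNzRingType) (E : finType) (x : E -> B).
Implicit Types F : {set E}.

Definition esymv F (l : nat) : B :=
  \sum_(D : {set E} | (D \subset F) && (#|D| == l)) \prod_(e in D) x e.

Lemma esym0 F : esymv F 0 = 1.
Proof.
rewrite /esymv (big_pred1 finset.set0) ?big_set0 // => D.
by rewrite /= cards_eq0; have [->|] := eqVneq D finset.set0; rewrite ?sub0set ?andbF.
Qed.

Lemma prod_XaddC F k : (#|F| <= k)%N ->
  'X^(k - #|F|) * \prod_(e in F) ('X + (x e)%:P) = \sum_(l < k.+1) esymv F l *: 'X^(k - l).
Proof.
move=> Fk.
have -> : \prod_(e in F) ('X + (x e)%:P) =
    \prod_e ((if e \in F then (x e)%:P else 0) + (if e \in F then 'X else 1)).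
  rewrite big_mkcond; apply: eq_bigr => e _.
  by case: (e \in F); rewrite ?add0r // addrC.
rewrite bigA_distr mulr_sumr.
rewrite (bigID (fun D : {set E} => D \subset F)) /= [X in _ + X]big1 ?addr0; last first.
  move=> D /subsetPn[e eD eF]; rewrite (bigD1 e) //= eD (negPf eF) mul0r mulr0 //.
rewrite (eq_bigr (fun D : {set E} => (\prod_(e in D) x e) *: 'X^(k - #|D|))); last first.
  move=> D DF; rewrite (bigID (fun e => e \in D)) /=.
  rewrite (eq_bigr (fun e => (x e)%:P)); last by move=> e eD; rewrite eD (subsetP DF).
  rewrite -rmorph_prod [X in _ * (_ * X)](eq_bigr (fun e => if e \in F then 'X else 1)); last first.
    by move=> e /negPf->.
  rewrite -big_mkcondr /= mulrCA mul_polyC; congr (_ *: _).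
  rewrite prodr_const -exprD; congr ('X^_).
  have -> : #|[pred i | (i \notin D) && (i \in F)]| = #|F :\: D|.
    by apply: eq_card => e; rewrite !inE.
  have DF' := subset_leq_card DF; rewrite cardsDS //; move: (#|D|) (#|F|) DF' Fk => *; lia.
rewrite (partition_big (fun D : {set E} => inord #|D| : 'I_k.+1) xpredT) //=.
apply: eq_bigr => l _; rewrite /esymv scaler_suml; apply: congr_big => // D.
  apply: andb_id2l => DF.
  have Dk : (#|D| < k.+1)%N by rewrite ltnS (leq_trans (subset_leq_card DF)).
  by apply/eqP/eqP => [<-|->]; [rewrite inordK|apply: inord_val].
by case/andP=> DF /eqP <-; rewrite inordK // ltnS (leq_trans (subset_leq_card DF)).
Qed.

Lemma eq_esym F F' k : (#|F| <= k)%N -> (#|F'| <= k)%N ->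
  (forall l, (1 <= l <= k)%N -> esymv F l = esymv F' l) <->
  'X^(k - #|F|) * \prod_(e in F) ('X + (x e)%:P)
  = 'X^(k - #|F'|) * \prod_(e in F') ('X + (x e)%:P).
Proof.
move=> Fk F'k; rewrite !prod_XaddC //; split=> [eq_e|eq_p l /andP[_ lk]].
  apply: eq_bigr => -[[|l] lk] _ /=; first by rewrite !esym0.
  by rewrite eq_e.
have coefE (a : nat -> B) : (\sum_(i < k.+1) a i *: 'X^(k - i))`_(k - l) = a l.
  rewrite coef_sum (bigD1 (Ordinal (lk : l < k.+1)%N)) //= coefZ coefXn eqxx mulr1.
  rewrite big1 ?addr0 // => i ne; rewrite coefZ coefXn; case: eqP; rewrite ?mulr0 // => eqk.
  by case/eqP: ne; apply: val_inj => /=; have := ltn_ord i; lia.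
by rewrite -(coefE (esymv F)) eq_p coefE.
Qed.

Lemma esymv_root F e : e \in F ->
  (- x e) ^+ #|F| = - \sum_(l < #|F|) esymv F l.+1 * (- x e) ^+ (#|F| - l.+1).
Proof.
move=> eF; have := prod_XaddC (leqnn #|F|); rewrite subnn expr0 mul1r.
move/(congr1 (fun p => p.[- x e])).
rewrite horner_prod (bigD1 e eF) /= hornerD hornerX hornerC addNr mul0r.
rewrite horner_sum big_ord_recl /= hornerZ hornerXn esym0 mul1r subn0 => /eqP.
rewrite eq_sym addr_eq0 => /eqP ->; congr (- _).
by apply: eq_bigr => l _; rewrite hornerZ hornerXn.
Qed.

End ElementarySymmetric.

Section MonicFactors.
Variable B : comNzRingType.

Lemma perm_eq_nonzero (s t : seq B) : size s = size t ->
  (forall z, z != 0 -> count_mem z s = count_mem z t) -> perm_eq s t.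
Proof.
move=> st nz; apply/allP => z _ /=; have [->|/nz->//] := eqVneq z 0.
have nz_perm : perm_eq [seq z <- s | z != 0] [seq z <- t | z != 0].
  apply/allP => y _ /=; rewrite !count_filter.
  have [->|y0] := eqVneq y 0.
    by rewrite !(@eq_count _ _ pred0) ?count_pred0 // => u /=; case: eqP.
  rewrite !(@eq_count _ (predI (pred1 y) _) (pred1 y)) ?nz // => u /=;
    by case: eqP => // ->.
have zE (r : seq B) : count_mem 0 r = (size r - count (fun z : B => z != 0%R) r)%N.
  by rewrite -(count_predC (pred1 0) r) addnK.
by have := perm_size nz_perm; rewrite !size_filter !zE st => ->.
Qed.

Hypothesis integral : forall a b : B, a * b = 0 -> (a == 0) || (b == 0).

Lemma perm_eq_prod_XaddC (s t : seq B) :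
  \prod_(a <- s) ('X + a%:P) = \prod_(a <- t) ('X + a%:P) -> perm_eq s t.
Proof.
have prod_monic (r : seq B) : \prod_(a <- r) ('X + a%:P) \is monic.
  by apply: rpred_prod => a _; rewrite -[a]opprK polyCN monicXsubC.
elim: s t => [|a s IH] t.
  move=> st; have : size (\prod_(a <- t) ('X + a%:P)) = 1%N by rewrite -st big_nil size_poly1.
  rewrite (eq_bigr (fun a => 'X - (- a)%:P)); last by move=> a _; rewrite polyCN opprK.
  by rewrite size_prod_XsubC => -[/size0nil ->].
move=> st; have : a \in t.
  have : (\prod_(b <- t) ('X + b%:P)).[- a] = 0.
    by rewrite -st big_cons hornerM !hornerE addNr mul0r.
  rewrite horner_prod; elim: (t) => [|b r IHr]; first by rewrite big_nil => /eqP; rewrite oner_eq0.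
  rewrite big_cons inE => /integral/orP[|/eqP/IHr->]; last by rewrite orbT.
  by rewrite !hornerE addrC subr_eq0 eq_sym => ->.
move=> at_; have tE := perm_to_rem at_.
rewrite perm_sym (perm_trans tE) // perm_cons perm_sym; apply: IH.
move: st; rewrite (perm_big _ tE) !big_cons /=.
have /monic_lreg lreg_a : 'X + a%:P \is monic by have := prod_monic [:: a]; rewrite big_seq1.
by move/lreg_a.
Qed.

End MonicFactors.

Section BalancedValues.
Variables (G : digraph) (B : comNzRingType) (x : edge G -> B).

Definition vdeg (v : vertex G) := maxn #|out_edges v| #|in_edges v|.

Definition values_at k (F : {set edge G}) : seq B :=
  [seq x e | e <- enum F] ++ nseq (k - #|F|) 0.

Lemma prod_values k (F : {set edge G}) :
  \prod_(a <- values_at k F) ('X + a%:P) = 'X^(k - #|F|) * \prod_(e in F) ('X + (x e)%:P).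
Proof.
rewrite /values_at big_cat big_map big_enum /= mulrC; congr (_ * _).
by rewrite big_nseq polyC0 addr0 iter_mulr_1.
Qed.

Lemma count_values k (F : {set edge G}) z : z != 0 ->
  count_mem z (values_at k F) = #|[set e in F | x e == z]|.
Proof.
move=> z0; rewrite count_cat count_nseq /= eq_sym (negPf z0) mul0n addn0 count_map.
rewrite -size_filter cardE /enum_mem -filter_predI; congr size.
by apply: eq_filter => e; rewrite /= !inE andbC.
Qed.

Lemma balanced_valuesP :
  (forall z, z != 0 -> balanced [set e | x e == z]) <->
  forall v z, z != 0 -> count_mem z (values_at (vdeg v) (out_edges v))
                        = count_mem z (values_at (vdeg v) (in_edges v)).
Proof.
have E (P : pred (edge G)) z : #|[set e in [set e | x e == z] | P e]|
    = #|[set e in [set e | P e] | x e == z]|.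
  by apply: eq_card => e; rewrite !inE andbC.
split=> bal; first by move=> v z z0; rewrite !count_values // -!E; apply: bal.
by move=> z z0 v; rewrite !E -!(count_values (vdeg v)) //; apply: bal.
Qed.

Lemma size_values v : size (values_at (vdeg v) (out_edges v)) = size (values_at (vdeg v) (in_edges v)).
Proof.
rewrite !size_cat !size_nseq !size_map -!cardE !subnKC //.
  exact: leq_maxr.
exact: leq_maxl.
Qed.

Lemma esym_of_balanced : (forall z, z != 0 -> balanced [set e | x e == z]) ->
  forall v l, (1 <= l <= vdeg v)%N -> esymv x (out_edges v) l = esymv x (in_edges v) l.
Proof.
move=> /balanced_valuesP bal v; apply/eq_esym; [exact: leq_maxl|exact: leq_maxr|].
rewrite -!prod_values; apply: perm_big.
by apply: perm_eq_nonzero (size_values v) (bal v).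
Qed.

Lemma balanced_of_esym : (forall a b : B, a * b = 0 -> (a == 0) || (b == 0)) ->
    (forall v l, (1 <= l <= vdeg v)%N -> esymv x (out_edges v) l = esymv x (in_edges v) l) ->
  forall z, z != 0 -> balanced [set e | x e == z].
Proof.
move=> int eq_e; apply/balanced_valuesP => v z _.
have := eq_e v; move/eq_esym => /(_ (leq_maxl _ _) (leq_maxr _ _)).
by rewrite -!prod_values => /(perm_eq_prod_XaddC int)/permP/(_ (pred1 z)).
Qed.

End BalancedValues.

Section DeltaValues.
Variables (G : digraph) (B : comNzRingType) (phi : {rmorphism edge_ring G -> B}).

Lemma rmorph_delta v l :
  phi (delta v l) = esymv (phi \o @edge_var G) (out_edges v) l - esymv (phi \o @edge_var G) (in_edges v) l.
Proof.
by rewrite /delta rmorphB /edge_esym /esymv !rmorph_sum; congr (_ - _);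
  apply: eq_bigr => D _; rewrite rmorph_prod.
Qed.

Lemma mem_Delta d : d \in Delta G <-> exists v l, (1 <= l <= vdeg v)%N /\ d = delta v l.
Proof.
split=> [/allpairsPdep[v [l [_]]]|[v [l [lv ->]]]].
  by rewrite mem_iota => lv ->; exists v, l; rewrite /vdeg; split=> //; lia.
by apply/allpairsPdep; exists v, l; rewrite mem_enum mem_iota; split=> //; move: lv; rewrite /vdeg; lia.
Qed.

Lemma rmorph_Delta : (forall d, d \in Delta G -> phi d = 0) <->
  forall v l, (1 <= l <= vdeg v)%N ->
    esymv (phi \o @edge_var G) (out_edges v) l = esymv (phi \o @edge_var G) (in_edges v) l.
Proof.
split=> [H v l lv|H d /mem_Delta[v [l [lv ->]]]].
  by apply/eqP; rewrite -subr_eq0 -rmorph_delta H //; apply/mem_Delta; exists v, l.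
by rewrite rmorph_delta H // subrr.
Qed.

End DeltaValues.

(** * The Koszul complex *)

Section IdealLemmas.
Variable A : comNzRingType.
Implicit Types (s : seq A) (a b : A).

Lemma in_ideal_nil a : in_ideal [::] a <-> a = 0.
Proof.
by split=> [[c ->]|->]; [rewrite big_ord0 | exists (fun=> 0); rewrite big_ord0].
Qed.

Lemma in_ideal_cons r s a :
  in_ideal (r :: s) a <-> exists b, exists2 a', in_ideal s a' & a = b * r + a'.
Proof.
split=> [[c ->]|[b [_ [c ->] ->]]].
  exists (c ord0); exists (\sum_(i < size s) c (lift ord0 i) * s`_i); first by exists (fun i => c (lift ord0 i)).
  by rewrite big_ord_recl.
exists (fun i => if unlift ord0 i is Some j then c j else b).
rewrite big_ord_recl unlift_none; congr (_ + _); apply: eq_bigr => i _.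
by rewrite liftK.
Qed.

Lemma in_ideal0 s : in_ideal s 0.
Proof. by exists (fun=> 0); rewrite big1 // => i _; rewrite mul0r. Qed.

Lemma in_idealD s a b : in_ideal s a -> in_ideal s b -> in_ideal s (a + b).
Proof.
move=> [c ->] [d ->]; exists (fun i => c i + d i); rewrite -big_split.
by apply: eq_bigr => i _; rewrite mulrDl.
Qed.

Lemma in_idealMl s a b : in_ideal s b -> in_ideal s (a * b).
Proof.
move=> [c ->]; exists (fun i => a * c i); rewrite mulr_sumr.
by apply: eq_bigr => i _; rewrite mulrA.
Qed.

Lemma mem_in_ideal s a : a \in s -> in_ideal s a.
Proof.
elim: s => // r s IH; rewrite inE => /predU1P[->|/IH sa]; apply/in_ideal_cons.
  by exists 1, 0; [apply: in_ideal0|rewrite mul1r addr0].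
by exists 0, a; rewrite ?mul0r ?add0r.
Qed.

Lemma in_ideal_sum s (I : Type) (r : seq I) (P : pred I) (F : I -> A) :
  (forall i, P i -> in_ideal s (F i)) -> in_ideal s (\sum_(i <- r | P i) F i).
Proof.
by move=> H; apply: (big_ind (in_ideal s)) => //; [apply: in_ideal0 | apply: in_idealD].
Qed.

Lemma rmorph_in_ideal (B : comNzRingType) (f : {rmorphism A -> B}) s a :
  (forall r, r \in s -> f r = 0) -> in_ideal s a -> f a = 0.
Proof.
move=> s0 [c ->]; rewrite rmorph_sum big1 // => i _.
by rewrite rmorphM (s0 s`_i) ?mulr0 // mem_nth.
Qed.

End IdealLemmas.

Section Homology0.
Variables (A : comNzRingType) (C : complex A) (g0 : gen C).
Hypothesis hdeg0 : forall g : gen C, hdeg g = 0%N <-> g = g0.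

Definition gen_chain (a : A) : chains C := [ffun g => if g == g0 then a else 0].

Let diff_g0 i : diff i g0 != 0 -> hdeg i = 1%N.
Proof. by move/diff_hdeg ->; rewrite (proj2 (hdeg0 g0)). Qed.

Lemma bd_gen_chain a : bd (gen_chain a) = 0.
Proof.
apply/ffunP => j; rewrite !ffunE big1 // => i _; rewrite ffunE.
case: eqP => [->|_]; last by rewrite mul0r.
have [->|/diff_hdeg] := eqVneq (diff g0 j) 0; first by rewrite mulr0.
by rewrite (proj2 (hdeg0 g0)).
Qed.

Definition gen_cycle (a : A) : submod_type (cycles C) :=
  SubmodElt (introT eqP (bd_gen_chain a) : gen_chain a \in mem_submodule (cycles C)).

Lemma bd_restrict (y : chains C) : exists y', bd y' = gen_chain (bd y g0).
Proof.
exists [ffun i => if hdeg i == 1%N then y i else 0].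
apply/ffunP => j; rewrite !ffunE; have [->|ne] := eqVneq j g0.
  apply: eq_bigr => i _; rewrite ffunE; case: eqP => // hi.
  have [->|/diff_g0//] := eqVneq (diff i g0) 0; by rewrite !mulr0.
rewrite big1 // => i _; rewrite ffunE; case: eqP => [hi|_]; last by rewrite mul0r.
have [->|/diff_hdeg] := eqVneq (diff i j) 0; first by rewrite mulr0.
by rewrite hi => -[/esym/hdeg0 jE]; rewrite jE eqxx in ne.
Qed.

Lemma quot_pr_surj (h : homology C) : exists z, h = quot_pr (boundaries C) z.
Proof. by exists (repr h); rewrite /quot_pr reprK. Qed.

Lemma quot_pr_bd (z : submod_type (cycles C)) :
  quot_pr (boundaries C) z = 0 <-> exists y, submod_val z = bd y.
Proof.
split=> [/eqP|[y zy]]; first by rewrite quot_pr_eq0 => /asboolP.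
by apply/eqP; rewrite quot_pr_eq0; apply/asboolP; exists y.
Qed.

Lemma homology_deg0P (m : homology_deg C 0) : exists a,
  submod_val m = quot_pr (boundaries C) (gen_cycle a).
Proof.
case: m => h hm /=; have /asboolP[z hz hE] := hm.
rewrite hE; exists (submod_val z g0); congr quot_pr.
apply: val_inj; apply/ffunP => g; rewrite !ffunE /=.
have [->//|ne] := eqVneq g g0; apply/eqP/negPn/negP => /hz/hdeg0 gE.
by rewrite gE eqxx in ne.
Qed.

Lemma homology_deg0_mem a : exists m : homology_deg C 0,
  submod_val m = quot_pr (boundaries C) (gen_cycle a).
Proof.
have H : quot_pr (boundaries C) (gen_cycle a) \in mem_submodule (Submodule (homology_deg_closed C 0)).
  apply/asboolP; exists (gen_cycle a) => // g /=; rewrite ffunE.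
  by have [-> _|_] := eqVneq g g0; [apply/hdeg0 | rewrite eqxx].
by exists (SubmodElt H).
Qed.

Lemma gen_cycle_bd a : quot_pr (boundaries C) (gen_cycle a) = 0 <->
  exists y : chains C, bd y g0 = a.
Proof.
rewrite quot_pr_bd; split=> [[y /= yE]|[y ya]].
  by exists y; rewrite -yE ffunE eqxx.
by have [y' y'E] := bd_restrict y; exists y'; rewrite y'E ya.
Qed.

Lemma scale_gen_cycle a b : a *: gen_cycle b = gen_cycle (a * b).
Proof.
by apply: val_inj; apply/ffunP => g; rewrite !ffunE; case: eqP; rewrite ?scaler0.
Qed.

Lemma ann_homology0 a : in_ann (homology_deg C 0) a <-> exists y : chains C, bd y g0 = a.
Proof.
split=> [ann|[y ya] m].
  have [m mE] := homology_deg0_mem 1; apply/gen_cycle_bd.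
  rewrite -[a in LHS]mulr1 -scale_gen_cycle linearZ /= -mE.
  by have := congr1 val (ann m).
apply: val_inj; have [b mE] := homology_deg0P m.
rewrite -[val (a *: m)]/(a *: submod_val m) mE.
have -> : a *: quot_pr (boundaries C) (gen_cycle b) = b *: quot_pr (boundaries C) (gen_cycle a).
  by rewrite -!(linearZZ (quot_pr (boundaries C))) !scale_gen_cycle mulrC.
have -> : quot_pr (boundaries C) (gen_cycle a) = 0 by apply/gen_cycle_bd; exists y.
by rewrite scaler0.
Qed.

Definition bot_coef (z : submod_type (cycles C)) : A := submod_val z g0.

Fact bot_coef_zmod_morphism : zmod_morphism bot_coef.
Proof. by move=> z w; rewrite /bot_coef !ffunE. Qed.
HB.instance Definition _ := GRing.isZmodMorphism.Build _ _ bot_coef bot_coef_zmod_morphism.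

Lemma gen_cycle_comb a n (z : 'I_n -> submod_type (cycles C)) (c : 'I_n -> int) :
    quot_pr (boundaries C) (gen_cycle a) = \sum_i quot_pr (boundaries C) (z i) *~ c i ->
  exists y : chains C, a = \sum_i bot_coef (z i) *~ c i + bd y g0.
Proof.
under eq_bigr do rewrite -raddfMz; rewrite -raddf_sum.
move/eqP; rewrite -subr_eq0 -raddfB => /eqP/quot_pr_bd[y yE].
exists y; have -> : bd y g0 = bot_coef (gen_cycle a - \sum_i z i *~ c i) by rewrite /bot_coef yE.
rewrite raddfB raddf_sum /=; under [X in _ = _ + (_ - X)]eq_bigr do rewrite raddfMz.
by rewrite addrCA subrr addr0 /bot_coef /= ffunE eqxx.
Qed.

End Homology0.

Section Koszul.
Variable A : comNzRingType.

Fixpoint koszul_bot (s : seq A) : gen (koszul s) :=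
  if s is r :: s' return gen (koszul s) then (false, koszul_bot s') else tt.

Lemma koszul_hdeg0 (s : seq A) (g : gen (koszul s)) : hdeg g = 0%N <-> g = koszul_bot s.
Proof.
elim: s g => [[]|r s IH [b g]] //=; split=> [|[-> ->]] /=.
  by case: b => //=; rewrite add0n => /IH ->.
by rewrite add0n; apply/IH.
Qed.

Lemma koszul_diffTT (r : A) s i k : @diff A (koszul (r :: s)) (true, i) (true, k) = - diff i k.
Proof. by rewrite /= mul0r add0r expr1 mulr1 mulN1r. Qed.

Lemma koszul_diffTF (r : A) s i k :
  @diff A (koszul (r :: s)) (true, i) (false, k) = r * (i == k)%:R.
Proof. by rewrite /= mulr0 mul0r addr0. Qed.

Lemma koszul_diffFT (r : A) s i k : @diff A (koszul (r :: s)) (false, i) (true, k) = 0.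
Proof. by rewrite /= mul0r mulr0 mul0r addr0. Qed.

Lemma koszul_diffFF (r : A) s i k : @diff A (koszul (r :: s)) (false, i) (false, k) = diff i k.
Proof. by rewrite /= mul0r add0r expr0 !mul1r. Qed.

Lemma sum_bool_pair (V : nmodType) (T : finType) (F : bool * T -> V) :
  \sum_x F x = \sum_j F (true, j) + \sum_j F (false, j).
Proof.
rewrite (eq_bigr (fun x => F (x.1, x.2))); last by case.
by rewrite -(pair_bigA _ (fun b j => F (b, j))) big_bool.
Qed.

Lemma koszul_diff_bot (B : comNzRingType) (f : {rmorphism A -> B}) (s : seq A) a :
  in_ideal [seq f r | r <- s] a <->
  exists y : gen (koszul s) -> B, \sum_i y i * f (diff i (koszul_bot s)) = a.
Proof.
elim: s a => [|r s IH] a /=.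
  split=> [/in_ideal_nil ->|[y <-]].
    by exists (fun=> 0); rewrite big1 // => i _; rewrite mul0r.
  by apply/in_ideal_nil; rewrite big1 // => i _; rewrite rmorph0 mulr0.
have sumE (y : bool * gen (koszul s) -> B) :
    \sum_i y i * f (diff (c := koszul (r :: s)) i (false, koszul_bot s))
    = y (true, koszul_bot s) * f r + \sum_i y (false, i) * f (diff i (koszul_bot s)).
  apply: etrans (sum_bool_pair _) _; congr (_ + _).
    rewrite (bigD1 (koszul_bot s)) // koszul_diffTF eqxx mulr1 big1 => [|i ne]; first exact: addr0.
    by rewrite koszul_diffTF (negPf ne) mulr0 rmorph0 mulr0.
  by apply: eq_bigr => i _; rewrite koszul_diffFF.
split=> [/in_ideal_cons[b [_ /IH[y <-] ->]]|[y <-]].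
  by exists (fun bi => if bi.1 then b else y bi.2); rewrite sumE.
rewrite sumE; apply/in_ideal_cons.
exists (y (true, koszul_bot s)), (\sum_i y (false, i) * f (diff i (koszul_bot s))) => //.
by apply/IH; exists (fun i => y (false, i)).
Qed.

Lemma ann_koszul_homology0 (s : seq A) a :
  in_ann (homology_deg (koszul s) 0) a <-> in_ideal s a.
Proof.
rewrite (ann_homology0 (koszul_hdeg0 (s := s))) -[X in in_ideal X a](map_id s).
rewrite (koszul_diff_bot idfun); split=> [[y <-]|[y <-]].
  by exists y; rewrite ffunE.
by exists [ffun i => y i]; rewrite ffunE; apply: eq_bigr => i _; rewrite ffunE.
Qed.

Lemma ann_base_change_homology0 (B : comNzRingType) (f : {rmorphism A -> B}) (s : seq A) a :
  in_ann (homology_deg (base_change f (koszul s)) 0) a <-> in_ideal [seq f r | r <- s] a.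
Proof.
rewrite (ann_homology0 (C := base_change f (koszul s)) (koszul_hdeg0 (s := s))) koszul_diff_bot.
split=> [[y <-]|[y <-]]; first by exists y; rewrite ffunE.
by exists [ffun i => y i]; rewrite ffunE; apply: eq_bigr => i _; rewrite ffunE.
Qed.

(* A matrix [h] with [h d + d h = t]: multiplication by [t] is null-homotopic. *)
Definition homotopy (C : complex A) (t : A) (h : gen C -> gen C -> A) : Prop := forall i k,
  \sum_j h i j * diff j k + \sum_j diff i j * h j k = t * (i == k)%:R.

Let sum_deltal (I : finType) (x : I) (f : I -> A) : \sum_y (x == y)%:R * f y = f x.
Proof.
rewrite (bigD1 x) //= eqxx mul1r big1 ?addr0 // => y ne.
by rewrite eq_sym (negPf ne) mul0r.
Qed.

Let sum_deltar (I : finType) (x : I) (f : I -> A) : \sum_y f y * (y == x)%:R = f x.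
Proof.
rewrite (bigD1 x) //= eqxx mulr1 big1 ?addr0 // => y ne.
by rewrite (negPf ne) mulr0.
Qed.

Lemma koszul_homotopy (s : seq A) t : t \in s -> exists h, homotopy (C := koszul s) t h.
Proof.
elim: s => // r s IH; rewrite inE.
have Z (T : finType) (F : T -> A) : (forall j, F j = 0) -> \sum_j F j = 0.
  by move=> F0; apply: big1.
have sumP (F : bool * gen (koszul s) -> A) := sum_bool_pair F.
pose D := @diff A (koszul (r :: s)).
have DTT i k : D (true, i) (true, k) = - diff i k := koszul_diffTT r i k.
have DTF i k : D (true, i) (false, k) = r * (i == k)%:R := koszul_diffTF r i k.
have DFT i k : D (false, i) (true, k) = 0 := koszul_diffFT r i k.
have DFF i k : D (false, i) (false, k) = diff i k := koszul_diffFF r i k.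
case/predU1P=> [->|/IH[h hh]].
  pose h (x y : bool * gen (koszul s)) : A := if ~~ x.1 && y.1 then (x.2 == y.2)%:R else 0.
  have hFT i j : h (false, i) (true, j) = (i == j)%:R by [].
  have h0 b b' i j : ~~ (~~ b && b') -> h (b, i) (b', j) = 0 by rewrite /h /= => /negPf->.
  exists h => -[b i] [b' k]; rewrite -/D.
  transitivity (\sum_j h (b, i) (true, j) * D (true, j) (b', k)
      + \sum_j h (b, i) (false, j) * D (false, j) (b', k)
    + (\sum_j D (b, i) (true, j) * h (true, j) (b', k)
      + \sum_j D (b, i) (false, j) * h (false, j) (b', k))).
    by congr (_ + _); apply: sumP.
  have -> : ((b, i) == (b', k)) = (b == b') && (i == k) by [].
  case: b; case: b' => /=.
  - rewrite ![\sum_j h (true, _) _ * _]Z ?[\sum_j _ * h (true, _) _]Z; try by move=> j; rewrite h0 // ?mul0r ?mulr0.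
    by rewrite !add0r; under eq_bigr do rewrite DTF hFT; rewrite sum_deltar.
  - by rewrite !Z ?addr0 ?mulr0 // => j; rewrite h0 // ?mul0r ?mulr0.
  - rewrite [\sum_j h (false, _) (false, _) * _]Z => [|j]; last by rewrite h0 // mul0r.
    rewrite [\sum_j _ * h (true, _) _]Z => [|j]; last by rewrite h0 // mulr0.
    under eq_bigr do rewrite hFT; under [X in _ + _ + (_ + X)]eq_bigr do rewrite hFT.
    by rewrite sum_deltal sum_deltar DTT DFF addr0 add0r addNr mulr0.
  - rewrite [\sum_j h (false, _) (false, _) * _]Z => [|j]; last by rewrite h0 // mul0r.
    rewrite ![\sum_j _ * h _ (false, _)]Z; try by move=> j; rewrite h0 ?andbF // mulr0.
    by under eq_bigr do rewrite hFT; rewrite sum_deltal DTF !addr0.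
pose h2 (x y : bool * gen (koszul s)) : A :=
  if x.1 == y.1 then (-1) ^+ x.1 * h x.2 y.2 else 0.
have hT i j : h2 (true, i) (true, j) = - h i j by rewrite /h2 /= mulN1r.
have hF i j : h2 (false, i) (false, j) = h i j by rewrite /h2 /= mul1r.
have h0 b i j : h2 (b, i) (~~ b, j) = 0 by case: b.
exists h2 => -[b i] [b' k]; rewrite -/D.
transitivity (\sum_j h2 (b, i) (true, j) * D (true, j) (b', k)
    + \sum_j h2 (b, i) (false, j) * D (false, j) (b', k)
  + (\sum_j D (b, i) (true, j) * h2 (true, j) (b', k)
    + \sum_j D (b, i) (false, j) * h2 (false, j) (b', k))).
  by congr (_ + _); apply: sumP.
have -> : ((b, i) == (b', k)) = (b == b') && (i == k) by [].
have hTF := h0 true; have hFT := h0 false; rewrite /= in hTF hFT.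
case: b; case: b' => /=.
- under eq_bigr do rewrite hT DTT mulrNN.
  under [X in _ + X + _]eq_bigr do rewrite hTF mul0r.
  under [X in _ + (X + _)]eq_bigr do rewrite hT DTT mulrNN.
  under [X in _ + (_ + X)]eq_bigr do rewrite hFT mulr0.
  by rewrite !big1_eq !addr0 hh.
- under eq_bigr do rewrite hT DTF mulNr mulrCA mulrA.
  under [X in _ + X + _]eq_bigr do rewrite hTF mul0r.
  under [X in _ + (X + _)]eq_bigr do rewrite hTF mulr0.
  under [X in _ + (_ + X)]eq_bigr do rewrite hF DTF -mulrA.
  rewrite !big1_eq addr0 add0r sumrN sum_deltar -mulr_sumr sum_deltal.
  by rewrite addNr mulr0.
- by rewrite !Z ?addr0 ?mulr0 // => j; rewrite ?hFT ?DFT ?mul0r ?mulr0.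
- under eq_bigr do rewrite hFT mul0r.
  under [X in _ + X + _]eq_bigr do rewrite hF DFF.
  under [X in _ + (X + _)]eq_bigr do rewrite hTF mulr0.
  under [X in _ + (_ + X)]eq_bigr do rewrite hF DFF.
  by rewrite !big1_eq !add0r hh.
Qed.

Lemma homotopy_bd (C : complex A) t (h : gen C -> gen C -> A) (z : chains C) : homotopy t h -> bd z = 0 ->
  exists y, t *: z = bd y.
Proof.
move=> ht zc; exists [ffun j => \sum_i z i * h i j].
apply/ffunP => k; rewrite !ffunE.
transitivity (\sum_i z i * \sum_j h i j * diff j k); last first.
  under [RHS]eq_bigr do rewrite ffunE mulr_suml.
  rewrite exchange_big; apply: eq_bigr => i _; rewrite mulr_sumr.
  by apply: eq_bigr => j _; rewrite mulrA.
transitivity (\sum_i (z i * (t * (i == k)%:R) - z i * \sum_j diff i j * h j k)); last first.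
  by apply: eq_bigr => i _; rewrite -ht mulrDr addrK.
rewrite sumrB [X in _ - X](_ : _ = 0) ?subr0.
  under eq_bigr do rewrite mulrA; rewrite sum_deltar mulrC //.
under eq_bigr do rewrite mulr_sumr; rewrite exchange_big big1 // => j _.
under eq_bigr do rewrite mulrA; rewrite -mulr_suml.
have := congr1 (fun f : chains C => f j) zc; rewrite !ffunE => ->.
by rewrite mul0r.
Qed.

Lemma ann_koszul_homology (s : seq A) a : in_ideal s a -> in_ann (homology (koszul s)) a.
Proof.
case=> c -> m; rewrite scaler_suml big1 // => i _; rewrite -scalerA.
suff -> : s`_i *: m = 0 by rewrite scaler0.
have [z ->] := quot_pr_surj m; rewrite -linearZZ; apply/quot_pr_bd.
have [h hh] := koszul_homotopy (mem_nth 0 (ltn_ord i)).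
have /eqP zc : bd (submod_val z) == 0 by case: z.
by have [y yE] := homotopy_bd hh zc; exists y.
Qed.

End Koszul.

(** * Noetherian rings and finite generation *)

Lemma mpoly_subring_ind (R : comNzRingType) n (Q : {mpoly R[n]} -> Prop) :
    (forall c, Q c%:MP) -> (forall i, Q 'X_i) ->
    (forall p q, Q p -> Q q -> Q (p + q)) -> (forall p q, Q p -> Q q -> Q (p * q)) ->
  forall p, Q p.
Proof.
move=> QC QX QD QM; elim/mpolyind; first by rewrite -mpolyC0.
move=> c m p _ _ Qp; apply: (QD) => //; rewrite -mul_mpolyC; apply: (QM) => //.
have Q1 : Q 1 by rewrite -mpolyC1.
rewrite mpolyXE_id; apply: (big_ind Q Q1 QM) => i _.
elim: (m i) => [|k IH]; first by rewrite expr0.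
by rewrite exprS; apply: QM.
Qed.

Section Span.
Variables (A : comNzRingType) (M : lmodType A).
Implicit Types (s t : seq M) (m : M).

Definition in_span s m := exists c : 'I_(size s) -> A, m = \sum_(i < size s) c i *: s`_i.

Lemma in_span_nil m : in_span [::] m <-> m = 0.
Proof.
by split=> [[c ->]|->]; [rewrite big_ord0 | exists (fun=> 0); rewrite big_ord0].
Qed.

Lemma in_span_cons x s m :
  in_span (x :: s) m <-> exists b, exists2 m', in_span s m' & m = b *: x + m'.
Proof.
split=> [[c ->]|[b [_ [c ->] ->]]].
  exists (c ord0); exists (\sum_(i < size s) c (lift ord0 i) *: s`_i); first by exists (fun i => c (lift ord0 i)).
  by rewrite big_ord_recl.
exists (fun i => if unlift ord0 i is Some j then c j else b).
rewrite big_ord_recl unlift_none; congr (_ + _); apply: eq_bigr => i _.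
by rewrite liftK.
Qed.

Lemma in_span0 s : in_span s 0.
Proof. by exists (fun=> 0); rewrite big1 // => i _; rewrite scale0r. Qed.

Lemma in_spanD s m m' : in_span s m -> in_span s m' -> in_span s (m + m').
Proof.
move=> [c ->] [d ->]; exists (fun i => c i + d i); rewrite -big_split.
by apply: eq_bigr => i _; rewrite scalerDl.
Qed.

Lemma in_spanZ s a m : in_span s m -> in_span s (a *: m).
Proof.
move=> [c ->]; exists (fun i => a * c i); rewrite scaler_sumr.
by apply: eq_bigr => i _; rewrite scalerA.
Qed.

Lemma in_span_cat s t m m' : in_span s m -> in_span t m' -> in_span (s ++ t) (m + m').
Proof.
elim: s m => [|x s IH] m; first by move=> /in_span_nil ->; rewrite add0r.
move=> /in_span_cons[b [m1 sm1 ->]] tm'; apply/in_span_cons.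
by exists b, (m1 + m'); [apply: IH|rewrite addrA].
Qed.

End Span.

Section Noetherian.

Definition is_ideal (A : comNzRingType) (J : A -> Prop) : Prop :=
  [/\ J 0, forall a b, J a -> J b -> J (a + b) & forall a b, J b -> J (a * b)].

Definition noetherian (A : comNzRingType) : Prop := forall J : A -> Prop, is_ideal J ->
  exists2 s, (forall x, x \in s -> J x) & forall a, J a -> in_ideal s a.

Lemma is_ideal_in_ideal (A : comNzRingType) (J : A -> Prop) s a :
  is_ideal J -> (forall x, x \in s -> J x) -> in_ideal s a -> J a.
Proof.
move=> [J0 JD JM]; elim: s a => [|x s IH] a sJ; first by move/in_ideal_nil->.
case/in_ideal_cons=> b [a' sa' ->]; apply: JD; first by apply: JM; apply: sJ; rewrite mem_head.
by apply: IH => // y ys; apply: sJ; rewrite inE ys orbT.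
Qed.

Lemma in_ideal_trans (A : comNzRingType) (s t : seq A) a :
  (forall x, x \in s -> in_ideal t x) -> in_ideal s a -> in_ideal t a.
Proof.
apply: is_ideal_in_ideal; split; [exact: in_ideal0 | exact: in_idealD | exact: in_idealMl].
Qed.

Lemma in_ideal_map (A B : comNzRingType) (f : {rmorphism A -> B}) s a :
  in_ideal s a -> in_ideal [seq f x | x <- s] (f a).
Proof.
elim: s a => [|x s IH] a; first by move/in_ideal_nil->; rewrite rmorph0; apply/in_ideal_nil.
case/in_ideal_cons=> b [a' /IH sa' ->]; apply/in_ideal_cons.
by exists (f b), (f a'); rewrite // rmorphD rmorphM.
Qed.

Lemma noetherian_surj (A B : comNzRingType) (f : {rmorphism A -> B}) :
  (forall b, exists a, f a = b) -> noetherian A -> noetherian B.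
Proof.
move=> surj noeA J [J0 JD JM]; have [|s sJ gen] := noeA (fun a => J (f a)).
  by split=> [|a b|a b]; rewrite ?rmorph0 ?rmorphD ?rmorphM //; [apply: JD|apply: JM].
exists [seq f x | x <- s] => [_ /mapP[x xs ->]|b]; first exact: sJ.
by have [a <-] := surj b => Ja; apply: in_ideal_map; apply: gen.
Qed.

Lemma noetherian_int : noetherian int.
Proof.
move=> J [J0 JD JM].
have [[d Jd d0]|all0] := pselect (exists2 d, J d & d != 0); last first.
  exists [::] => // a Ja; apply/in_ideal_nil/eqP/negPn/negP => a0.
  by apply: all0; exists a.
have exn : exists n, `[< exists2 d, J d & (d != 0) && (`|d|%N == n) >].
  by exists `|d|%N; apply/asboolP; exists d; rewrite ?d0 /=.
case: (ex_minnP exn) => n /asboolP[e Je /andP[e0 /eqP en]] minn.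
exists [:: e] => [x|a Ja]; first by rewrite inE => /eqP->.
apply/in_ideal_cons; exists (a %/ e)%Z, 0; first exact: in_ideal0.
rewrite addr0 {1}(divz_eq a e); suff -> : (a %% e)%Z = 0 by rewrite addr0.
have rE : (a %% e)%Z = a - (a %/ e)%Z * e by [].
have Jr : J (a %% e)%Z by rewrite rE -mulNr; apply: JD => //; apply: JM.
apply/eqP/negPn/negP => r0.
have := minn `|(a %% e)%Z|%N; rewrite asboolT; last by exists (a %% e)%Z; rewrite ?r0 /=.
move=> /(_ isT); rewrite -en; have := ltz_mod a e0; have := modz_ge0 a e0; lia.
Qed.

(* Hilbert's basis theorem, through the ideals of the coefficients of degree
   [d] of the elements of [J] of degree at most [d]. *)
Lemma noetherian_poly (A : comNzRingType) : noetherian A -> noetherian {poly A}.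
Proof.
move=> noeA J idJ; have [J0 JD JM] := idJ.
pose L d (a : A) := exists f : {poly A}, [/\ J f, (size f <= d.+1)%N & f`_d = a].
have idL d : is_ideal (L d).
  split=> [|a b [f [Jf sf <-]] [g [Jg sg <-]]|a b [f [Jf sf <-]]].
  - by exists 0; rewrite size_poly0 coef0.
  - exists (f + g); split; [exact: JD| |by rewrite coefD].
    by rewrite (leq_trans (size_polyD _ _)) // geq_max sf.
  - exists (a%:P * f); split; [exact: JM| |by rewrite coefCM].
    by rewrite mul_polyC (leq_trans (size_scale_leq _ _)).
have Lmono d k a : L d a -> L (d + k)%N a.
  case=> f [Jf sf <-]; exists ('X^k * f); split; first exact: JM.
    apply: leq_trans (size_polyMleq _ _) _; rewrite size_polyXn /= addnC -addSn leq_add2r.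
    exact: sf.
  by rewrite coefXnM ltnNge leq_addl /= addnK.
pose U a := exists d, L d a.
have idU : is_ideal U.
  split=> [|a b [d La] [e Lb]|a b [d Lb]]; first by exists 0%N; case: (idL 0%N).
    exists (d + e)%N; have [_ H _] := idL (d + e)%N; apply: H; first exact: Lmono.
    by rewrite addnC; apply: Lmono.
  by exists d; have [_ _ H] := idL d; apply: H.
have lift d s : (forall x, x \in s -> L d x) -> exists F : seq {poly A},
    (forall f, f \in F -> J f /\ (size f <= d.+1)%N) /\
    (forall a, in_ideal s a -> exists2 g, in_ideal F g & (size g <= d.+1)%N /\ g`_d = a).
  elim: s => [|x s IH] sL.
    exists [::]; split=> // a /in_ideal_nil ->; exists 0; first exact: in_ideal0.
    by rewrite size_poly0 coef0.
  have [f [Jf sf fx]] := sL x (mem_head _ _).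
  have [|F [FJ Fs]] := IH; first by move=> y ys; apply: sL; rewrite inE ys orbT.
  exists (f :: F); split=> [g|a /in_ideal_cons[b [a' /Fs[g Fg [sg ga]] ->]]].
    by rewrite inE => /predU1P[->|/FJ].
  exists (b%:P * f + g); first by apply/in_ideal_cons; exists b%:P, g.
  rewrite coefD coefCM fx ga; split=> //; rewrite (leq_trans (size_polyD _ _)) // geq_max sg andbT.
  by rewrite mul_polyC (leq_trans (size_scale_leq _ _)).
have exF d : exists F : seq {poly A}, (forall f, f \in F -> J f) /\
    (forall a, L d a -> exists2 g, in_ideal F g & (size g <= d.+1)%N /\ g`_d = a).
  have [s sL gen] := noeA _ (idL d); have [F [FJ Fs]] := lift d s sL.
  by exists F; split=> [f /FJ[]//|a /gen/Fs].
have [sU sUU genU] := noeA _ idU.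
have [D sUD] : exists D, forall x, x \in sU -> L D x.
  elim: (sU) sUU => [|x s IH] H; first by exists 0%N.
  have [|D HD] := IH; first by move=> y ys; apply: H; rewrite inE ys orbT.
  have [d Ld] := H x (mem_head _ _); exists (D + d)%N => y.
  by rewrite inE => /predU1P[->|/HD Ly]; [rewrite addnC|]; apply: Lmono.
have [FD [FDJ FDs]] := lift D sU sUD.
pose F d := projT1 (cid (exF d)).
have FP d : (forall f, f \in F d -> J f) /\
    (forall a, L d a -> exists2 g, in_ideal (F d) g & (size g <= d.+1)%N /\ g`_d = a).
  exact: (projT2 (cid (exF d))).
pose S := flatten [seq F d | d <- iota 0 D] ++ FD.
have FS d f : (d < D)%N -> f \in F d -> f \in S.
  move=> dD fF; rewrite mem_cat; apply/orP; left; apply/flattenP; exists (F d) => //.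
  by apply: map_f; rewrite mem_iota.
have SJ f : f \in S -> J f.
  rewrite mem_cat => /orP[/flattenP[_ /mapP[d _ ->]]|]; first by have [H _] := FP d; apply: H.
  by move/FDJ => [].
exists S => // f Jf; have [n] := ubnP (size f); elim: n f Jf => // n IH f Jf sf.
case: n IH sf => [|n] IH sf.
  have /eqP -> : f == 0 by rewrite -size_poly_eq0; move: sf; lia.
  exact: in_ideal0.
have Ln : L n f`_n by exists f.
have [g Sg [sg gn]] : exists2 g, in_ideal S g & (size g <= n.+1)%N /\ g`_n = f`_n.
  have [nD|Dn] := ltnP n D.
    have [_ /(_ _ Ln)[g Fg gP]] := FP n; exists g => //.
    by apply: in_ideal_trans Fg => x xF; apply: mem_in_ideal; apply: FS xF.
  have [|g Fg [sg gn]] := FDs f`_n; first by apply: genU; exists n.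
  exists ('X^(n - D) * g).
    by apply: in_idealMl; apply: in_ideal_trans Fg => x xF; apply: mem_in_ideal; rewrite mem_cat xF orbT.
  rewrite coefXnM ltnNge leq_subr /= subKn // gn; split=> //.
  apply: leq_trans (size_polyMleq _ _) _; rewrite size_polyXn /=.
  by move: sg Dn; move: (size g) => sz; lia.
have -> : f = (f - g) + g by rewrite subrK.
have Jg := is_ideal_in_ideal idJ SJ Sg.
apply: in_idealD Sg; apply: IH.
  by apply: JD => //; rewrite -mulN1r; apply: JM.
rewrite ltnS; apply/leq_sizeP => j; rewrite leq_eqVlt => /predU1P[<-|nj].
  by rewrite coefB gn subrr.
by rewrite coefB !nth_default ?subrr //; apply: leq_trans nj.
Qed.

Lemma noetherian_mpoly (R : comNzRingType) n : noetherian R -> noetherian {mpoly R[n]}.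
Proof.
move=> noeR; elim: n => [|n IH].
  apply: (noetherian_surj (f := @mpolyC 0 R)) noeR; apply: mpoly_subring_ind.
  - by move=> c; exists c.
  - by case.
  - by move=> p q [a <-] [b <-]; exists (a + b); rewrite rmorphD.
  - by move=> p q [a <-] [b <-]; exists (a * b); rewrite rmorphM.
pose w : {rmorphism {mpoly R[n]} -> {mpoly R[n.+1]}} := @mwiden n R.
have cw : commr_rmorph w ('X_ord_max) by move=> x; apply: mulrC.
apply: (noetherian_surj (f := horner_morph cw)) (noetherian_poly IH).
apply: mpoly_subring_ind.
- by move=> c; exists (c%:MP)%:P; apply: etrans (horner_morphC cw _) _; apply: mwidenC.
- move=> i; case: (unliftP ord_max i) => [j|] ->; last by exists 'X; apply: horner_morphX.
  exists ('X_j)%:P; apply: etrans (horner_morphC cw _) _; rewrite /= mwidenX mnmwiden1.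
  by congr (mpolyX _ (mnm1 _)); apply: val_inj; rewrite /= /bump leqNgt ltn_ord.
- by move=> p q [a <-] [b <-]; exists (a + b); rewrite rmorphD.
- by move=> p q [a <-] [b <-]; exists (a * b); rewrite rmorphM.
Qed.

Lemma noetherian_submodule (A : comNzRingType) (T : finType) (S : {ffun T -> A^o} -> Prop) :
    noetherian A -> S 0 -> (forall f g, S f -> S g -> S (f + g)) ->
    (forall a f, S f -> S (a *: f)) ->
  exists2 s, (forall f, f \in s -> S f) & forall f, S f -> in_span s f.
Proof.
move=> noeA; suff H (l : seq T) (P : {ffun T -> A^o} -> Prop) :
    P 0 -> (forall f g, P f -> P g -> P (f + g)) -> (forall a f, P f -> P (a *: f)) ->
    (forall f, P f -> forall t, t \notin l -> f t = 0) ->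
    exists2 s, (forall f, f \in s -> P f) & forall f, P f -> in_span s f.
  move=> S0 SD SZ; apply: (H (enum T)) => // f _ t; by rewrite mem_enum.
elim: l P => [|t l IH] P P0 PD PZ supp.
  exists [::] => // f Pf; apply/in_span_nil/ffunP => t; rewrite ffunE.
  exact: supp.
pose P' f := P f /\ f t = 0.
have P'0 : P' 0 by split; rewrite ?ffunE.
have P'D f g : P' f -> P' g -> P' (f + g).
  by move=> [Pf f0] [Pg g0]; split; [apply: PD|rewrite ffunE f0 g0 addr0].
have P'Z a f : P' f -> P' (a *: f).
  by move=> [Pf f0]; split; [apply: PZ|rewrite ffunE f0 scaler0].
have supp' f : P' f -> forall u, u \notin l -> f u = 0.
  move=> [Pf f0] u ul; have [->//|ut] := eqVneq u t.
  by apply: supp; rewrite // inE negb_or ut.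
have [s sP gen] := IH P' P'0 P'D P'Z supp'.
have [|r rP rgen] := noeA (fun a => exists2 f, P f & f t = a).
  split=> [|a b [f Pf <-] [g Pg <-]|a b [f Pf <-]].
  - by exists 0; rewrite ?ffunE.
  - by exists (f + g); [apply: PD|rewrite ffunE].
  - by exists (a *: f); [apply: PZ|rewrite ffunE].
have [F FP Fs] : exists2 F : seq {ffun T -> A^o}, (forall f, f \in F -> P f) &
    forall a, in_ideal r a -> exists2 g, in_span F g & g t = a.
  elim: r rP {rgen} => [|x r IHr] rP.
    by exists [::] => // a /in_ideal_nil ->; exists 0; [apply: in_span0|rewrite ffunE].
  have [f Pf fx] := rP x (mem_head _ _).
  have [|F FP Fs] := IHr; first by move=> y yr; apply: rP; rewrite inE yr orbT.
  exists (f :: F) => [g|a /in_ideal_cons[b [a' /Fs[g Fg ga] ->]]].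
    by rewrite inE => /predU1P[->|/FP].
  exists (b *: f + g); first by apply/in_span_cons; exists b, g.
  by rewrite !ffunE fx ga.
have spanP f : in_span F f -> P f.
  elim: (F) f FP => [|x s' IHs] f FP; first by move/in_span_nil->.
  case/in_span_cons=> b [m' sm' ->]; apply: PD; first by apply: PZ; apply: FP; rewrite mem_head.
  by apply: IHs => // y ys; apply: FP; rewrite inE ys orbT.
exists (s ++ F) => [f|f Pf]; first by rewrite mem_cat => /orP[/sP[]|/FP].
have [|g Fg gt] := Fs (f t); first by apply: rgen; exists f.
have -> : f = (f - g) + g by rewrite subrK.
apply: in_span_cat => //; apply: gen; split; last by rewrite !ffunE gt subrr.
by apply: PD => //; rewrite -scaleN1r; apply: PZ; apply: spanP.
Qed.

End Noetherian.

Section SpanMore.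
Variables (A : comNzRingType) (M : lmodType A).

Lemma in_span_mem (s : seq M) m : m \in s -> in_span s m.
Proof.
elim: s => // x s IH; rewrite inE => /predU1P[->|/IH sm]; apply/in_span_cons.
  by exists 1, 0; [apply: in_span0 | rewrite scale1r addr0].
by exists 0, m; rewrite ?scale0r ?add0r.
Qed.

Lemma in_span_ind (s : seq M) (Q : M -> Prop) m :
  Q 0 -> (forall x y, Q x -> Q y -> Q (x + y)) -> (forall a x, x \in s -> Q (a *: x)) ->
  in_span s m -> Q m.
Proof.
move=> Q0 QD Qs [c ->]; apply: (big_ind Q) => // i _.
by apply: Qs; apply: mem_nth.
Qed.

End SpanMore.

Lemma fin_gen_ZE (M : zmodType) : fin_gen_Z M <-> exists s : seq (zmodule M), forall m, in_span s m.
Proof. by []. Qed.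

Lemma mpoly_mod_monomials N n (s : seq {mpoly int[N]}) : (forall i, in_ideal s ('X_i ^+ n)) ->
  exists t : seq {mpoly int[N]}, forall a, exists2 b,
    @in_span int (zmodule {mpoly int[N]}) t b & in_ideal s (a - b).
Proof.
move=> Xn; pose mon (f : {ffun 'I_N -> 'I_n}) : {mpoly int[N]} := 'X_[[multinom nat_of_ord (f i) | i < N]].
pose t : seq {mpoly int[N]} := map mon (enum {: {ffun 'I_N -> 'I_n}}).
exists t.
elim/mpolyind; first by exists 0; [apply: in_span0 | rewrite subrr; apply: in_ideal0].
move=> c m p _ _ [b tb Ib].
suff [b' tb' Ib'] : exists2 b', @in_span int (zmodule {mpoly int[N]}) t b'
    & in_ideal s ('X_[m] - b').
  exists (b' *~ c + b); first by apply: in_spanD => //; apply: (in_spanZ c) tb'.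
  rewrite opprD addrACA; apply: in_idealD => //.
  have -> : c *: 'X_[m] - b' *~ c = c%:MP * ('X_[m] - b').
    by rewrite mulrBr mul_mpolyC; congr (_ - _); rewrite -[c in RHS]intz rmorph_int mulrzl.
  exact: in_idealMl.
have [small|] := boolP [forall i, m i < n]%N.
  have lt i : (m i < n)%N by move/forallP: small.
  exists 'X_[m]; last by rewrite subrr; apply: in_ideal0.
  apply: in_span_mem; apply/mapP; exists [ffun i => Ordinal (lt i)]; first by rewrite mem_enum.
  by rewrite /mon; congr mpolyX; apply/mnmP => i; rewrite mnmE ffunE.
rewrite negb_forall => /existsP[i]; rewrite -leqNgt => ni.
exists 0; first exact: in_span0.
have -> : m = ((m - U_(i) *+ n) + U_(i) *+ n)%MM.
  rewrite submK //; apply/mnm_lepP => j; rewrite mulmnE mnm1E.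
  by case: eqP => [<-|_]; rewrite ?mul1n.
by rewrite subr0 mpolyXD -mpolyXn; apply: in_idealMl.
Qed.

Section EdgeRing.
Variable G : digraph.

Lemma mod_Delta_monomials n : (forall e : edge G, in_ideal (Delta G) (edge_var e ^+ n)) ->
  exists t : seq (edge_ring G), forall a, exists2 b,
    @in_span int (zmodule (edge_ring G)) t b & in_ideal (Delta G) (a - b).
Proof.
by move=> En; apply: mpoly_mod_monomials => i; have := En (enum_val i); rewrite /edge_var enum_valK; apply.
Qed.

Lemma fin_gen_KR_H0 n : (forall e : edge G, in_ideal (Delta G) (edge_var e ^+ n)) ->
  fin_gen_Z (KR_H0 G).
Proof.
move=> /mod_Delta_monomials[t gen]; apply/fin_gen_ZE.
pose H := homology_deg0_mem (koszul_hdeg0 (s := Delta G)).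
pose cl a : KR_H0 G := projT1 (cid (H a)).
have clE a : submod_val (cl a) = quot_pr _ (gen_cycle (koszul_hdeg0 (s := Delta G)) a).
  exact: (projT2 (cid (H a))).
have gD a b : gen_cycle (koszul_hdeg0 (s := Delta G)) (a + b)
    = gen_cycle (koszul_hdeg0 (s := Delta G)) a + gen_cycle (koszul_hdeg0 (s := Delta G)) b.
  by apply: val_inj; apply/ffunP => g; rewrite !ffunE; case: eqP; rewrite ?addr0.
have clD a b : cl (a + b) = cl a + cl b.
  by apply: val_inj; rewrite raddfD /= !clE gD raddfD.
have cl0 : cl 0 = 0 by apply: (@addrI _ (cl 0)); rewrite -clD !addr0.
have clI a : in_ideal (Delta G) a -> cl a = 0.
  move/ann_koszul_homology0/(ann_homology0 (koszul_hdeg0 (s := Delta G)))/gen_cycle_bd => E.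
  by apply: val_inj; rewrite /= clE E.
have clZ (c : int) b : cl (b *~ c) = cl b *~ c.
  have clN a : cl (- a) = - cl a by apply/eqP; rewrite -addr_eq0 -clD addNr cl0.
  have clMn a k : cl (a *+ k) = cl a *+ k.
    by elim: k => [|k IH]; rewrite ?mulr0n ?cl0 // !mulrS clD IH.
  by case: c => k; rewrite ?NegzE ?mulrNz ?clN ?clMn // -!pmulrn clMn.
exists [seq cl b | b <- t] => m.
have [a mE] := homology_deg0P (koszul_hdeg0 (s := Delta G)) m.
have -> : m = cl a by apply: val_inj; rewrite /= clE.
have [b tb Ib] := gen a; have -> : a = (a - b) + b by rewrite subrK.
rewrite clD (clI _ Ib) add0r; move: tb; apply: (@in_span_ind int (zmodule (edge_ring G)) t
  (fun b => @in_span int (zmodule (KR_H0 G)) [seq cl b | b <- t] (cl b))).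
- by rewrite cl0; apply: in_span0.
- by move=> x y sx sy; rewrite clD; apply: in_spanD.
- move=> c x xt; rewrite clZ; apply: (in_spanZ c); apply: in_span_mem; exact: map_f.
Qed.

Lemma fin_gen_KR_H n : (forall e : edge G, in_ideal (Delta G) (edge_var e ^+ n)) ->
  fin_gen_Z (KR_H G).
Proof.
move=> /mod_Delta_monomials[t gen]; apply/fin_gen_ZE.
have noe : noetherian (edge_ring G) by apply: noetherian_mpoly; apply: noetherian_int.
have [|||gs gsC gsgen] := @noetherian_submodule _ _ (fun z => bd (C := KR_complex G) z = 0) noe.
- exact: linear0.
- by move=> f g f0 g0; rewrite linearD /= f0 g0 addr0.
- by move=> a f f0; rewrite linearZZ /= f0 scaler0.
pose cyc := submod_type (cycles (KR_complex G)).
have lift (l : seq (chains (KR_complex G))) : (forall z, z \in l -> bd z = 0) ->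
    exists zs : seq cyc, forall z : cyc, in_span l (submod_val z) -> in_span zs z.
  elim: l => [|x l IH] lC.
    exists [::] => z /in_span_nil z0; apply/in_span_nil; exact: val_inj.
  have [|zs zsP] := IH; first by move=> z zl; apply: lC; rewrite inE zl orbT.
  have xC : x \in mem_submodule (cycles (KR_complex G)).
    by rewrite unfold_in /= lC ?mem_head.
  exists (SubmodElt xC :: zs) => z /in_span_cons[b [m' lm' zE]]; apply/in_span_cons.
  exists b, (z - b *: SubmodElt xC); last by rewrite addrC subrK.
  apply: zsP; have -> : submod_val (z - b *: SubmodElt xC) = submod_val z - b *: x by [].
  by rewrite zE addrAC subrr add0r.
have [zs zsP] := lift gs gsC.
pose gen_list : seq (KR_H G) :=
  [seq b *: quot_pr (boundaries (KR_complex G)) z | z <- zs, b <- t].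
exists gen_list => m.
have [z ->] := quot_pr_surj m.
have : in_span zs z by apply/zsP/gsgen; case: z => z /= /eqP.
apply: (@in_span_ind _ _ zs (fun z => @in_span int (zmodule (KR_H G)) gen_list (quot_pr _ z))).
- by rewrite raddf0; apply: in_span0.
- by move=> x y sx sy; rewrite raddfD; apply: in_spanD.
move=> a x xzs; rewrite linearZZ; have [b tb Ib] := gen a.
have -> : a = (a - b) + b by rewrite subrK.
rewrite scalerDl (ann_koszul_homology Ib) add0r; move: tb.
apply: (@in_span_ind int (zmodule (edge_ring G)) t
  (fun b => @in_span int (zmodule (KR_H G)) gen_list (b *: quot_pr _ x))).
- by rewrite scale0r; apply: in_span0.
- by move=> u v su sv; rewrite scalerDl; apply: in_spanD.
move=> c u ut; rewrite -scalerMzl; apply: (in_spanZ c); apply: in_span_mem.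
exact: allpairs_f.
Qed.

Definition radical_mem (a : edge_ring G) := exists n, in_ideal (Delta G) (a ^+ n).

Lemma radical_in a : in_ideal (Delta G) a -> radical_mem a.
Proof. by move=> Ia; exists 1%N; rewrite expr1. Qed.

Lemma radicalM a b : radical_mem b -> radical_mem (a * b).
Proof. by case=> n Ib; exists n; rewrite exprMn; apply: in_idealMl. Qed.

Lemma radicalN a : radical_mem a -> radical_mem (- a).
Proof. by rewrite -mulN1r; apply: radicalM. Qed.

Lemma radicalD a b : radical_mem a -> radical_mem b -> radical_mem (a + b).
Proof.
move=> [n Ia] [m Ib]; exists (n + m)%N; rewrite exprDn; apply: in_ideal_sum => i _.
rewrite -mulr_natl; apply: in_idealMl.
have [ni|im] := leqP m i.
  by rewrite -[X in b ^+ X](subnK ni) exprD mulrA; apply: in_idealMl.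
have le : (n <= n + m - i)%N by lia.
by rewrite mulrC -(subnK le) exprD mulrA; apply: in_idealMl.
Qed.

Lemma radicalX a n : radical_mem (a ^+ n) -> radical_mem a.
Proof. by case=> m; rewrite -exprM; exists (n * m)%N. Qed.

Lemma radical_sum (I : Type) (r : seq I) (P : pred I) (F : I -> edge_ring G) :
  (forall i, P i -> radical_mem (F i)) -> radical_mem (\sum_(i <- r | P i) F i).
Proof.
move=> H; apply: (big_ind radical_mem _ radicalD H).
exact/radical_in/in_ideal0.
Qed.

(* An outgoing edge is a root of the polynomial whose roots are the outgoing
   edges, and the coefficients of this polynomial are modulo [I(G)] those of the
   incoming edges. *)
Lemma radical_edge e : (forall f, target f = source e -> radical_mem (edge_var f)) ->
  radical_mem (edge_var e).
Proof.
move=> Hin; set v := source e; set k := #|out_edges v|.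
have kv : (k <= vdeg v)%N by apply: leq_maxl.
have rad_out l : (1 <= l <= k)%N -> radical_mem (esymv (@edge_var G) (out_edges v) l).
  move=> /andP[l1 lk].
  have -> : esymv (@edge_var G) (out_edges v) l = delta v l + esymv (@edge_var G) (in_edges v) l.
    by rewrite /delta subrK.
  apply: radicalD.
    apply/radical_in/mem_in_ideal/mem_Delta; exists v, l; split=> //.
    by rewrite l1 (leq_trans lk).
  apply: radical_sum => D /andP[Din /eqP Dl].
  have /card_gt0P[f fD] : (0 < #|D|)%N by rewrite Dl.
  rewrite (bigD1 f) //= mulrC; apply: radicalM; apply: Hin.
  by have := subsetP Din f fD; rewrite inE => /eqP.
have ev : e \in out_edges v by rewrite inE.
apply: (@radicalX _ k); have -> : edge_var e ^+ k = (-1) ^+ k * (- edge_var e) ^+ k.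
  by rewrite -exprMn mulN1r opprK.
rewrite (esymv_root (@edge_var G) ev); apply: radicalM; apply: radicalN.
apply: radical_sum => l _; rewrite mulrC; apply: radicalM; apply: rad_out.
exact: ltn_ord.
Qed.

Lemma acyclic_nilpotent : acyclic G -> exists2 n : nat, (1 <= n)%N &
  forall e : edge G, in_ideal (Delta G) (edge_var e ^+ n).
Proof.
move/acyclicP => nc.
have rad e : radical_mem (edge_var e).
  apply: contrapT => ne; pose S := [set e : edge G | `[< ~ radical_mem (edge_var e) >]].
  have [|f fS|C dC _] := @dicycle_of_predecessors G S.
  - by apply/set0Pn; exists e; rewrite inE; apply/asboolP.
  - move: fS; rewrite inE => /asboolP nf; apply: contrapT => no.
    apply: nf; apply: radical_edge => g gf; apply: contrapT => ng.
    by apply: no; exists g => //; rewrite inE; apply/asboolP.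
  - by have := nc C; rewrite dC.
pose m e := projT1 (cid (rad e)).
exists (\sum_e m e).+1 => // e; rewrite (bigD1 e) //= -addnS exprD mulrC.
by apply: in_idealMl; apply: (projT2 (cid (rad e))).
Qed.

End EdgeRing.

Section CycleEvaluation.
Variable G : digraph.

Definition edge_eval (R : comNzRingType) (B : comNzRingType) (f : {rmorphism R -> B})
  (x : edge G -> B) : {rmorphism {mpoly R[#|edge G|]} -> B} :=
  @mmap #|edge G| R B f (fun i => x (enum_val i)).

Lemma edge_evalX (R B : comNzRingType) (f : {rmorphism R -> B}) x (e : edge G) :
  edge_eval f x 'X_(enum_rank e) = x e.
Proof. by apply: etrans (mmapX _ _ _) _; rewrite mmap1U enum_rankK. Qed.

Lemma edge_eval_Delta (B : comNzRingType) (f : {rmorphism int -> B}) x :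
  (forall z, z != 0 -> balanced [set e | x e == z]) ->
  forall d, d \in Delta G -> edge_eval f x d = 0.
Proof.
move=> bal; apply/rmorph_Delta => v l lv; have := esym_of_balanced bal lv.
have E F : esymv (edge_eval f x \o @edge_var G) F l = esymv x F l.
  by apply: eq_bigr => D _; apply: eq_bigr => e _; rewrite /= edge_evalX.
by rewrite !E.
Qed.

Variable C : {set edge G}.
Hypothesis dC : dicycle_set C.

Let x (e : edge G) : {poly int} := if e \in C then 'X else 0.
Let phi : {rmorphism edge_ring G -> {poly int}} :=
  edge_eval (intr : {rmorphism int -> {poly int}}) x.

Let phiE e : phi (edge_var e) = x e.
Proof. exact: edge_evalX. Qed.

Let phi0 a : in_ideal (Delta G) a -> phi a = 0.
Proof.
apply: rmorph_in_ideal; apply: edge_eval_Delta => z z0.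
have -> : [set e | x e == z] = if z == 'X then C else finset.set0.
  apply/setP => e; rewrite inE /x eq_sym.
  have [eC|eC] := boolP (e \in C).
    by case: eqP => _; rewrite ?eC ?inE.
  by rewrite (negPf z0); case: ifP => _; rewrite ?inE // (negPf eC).
by case: eqP => _; [apply: dicycle_set_balanced | apply: balanced0].
Qed.

Lemma not_nilpotent n : ~ forall e : edge G, in_ideal (Delta G) (edge_var e ^+ n).
Proof.
move=> H; have /set0Pn[e eC] := dicycle_set_neq0 dC.
have := phi0 (H e); rewrite rmorphXn /= phiE /x eC => /eqP.
by rewrite -size_poly_eq0 size_polyXn.
Qed.

Lemma not_comb n (z : 'I_n -> submod_type (cycles (KR_complex G))) : ~ forall a, exists c : 'I_n -> int,
  quot_pr _ (gen_cycle (koszul_hdeg0 (s := Delta G)) a)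
  = \sum_i quot_pr (boundaries (KR_complex G)) (z i) *~ c i.
Proof.
move=> H; have /set0Pn[e eC] := dicycle_set_neq0 dC.
pose zc i := phi (bot_coef (koszul_bot (Delta G)) (z i)).
pose N := \max_i size (zc i).
have [c /gen_cycle_comb[y yE]] := H (edge_var e ^+ N).
have /phi0 y0 : in_ideal (Delta G) (bd y (koszul_bot (Delta G))).
  by apply/ann_koszul_homology0/(ann_homology0 (koszul_hdeg0 (s := Delta G))); exists y.
move/(congr1 phi): yE; rewrite rmorphD y0 addr0 rmorphXn /= phiE /x eC rmorph_sum.
move/(congr1 (fun p : {poly int} => size p)); rewrite size_polyXn => /esym sN.
have : (size (\sum_i phi (bot_coef (koszul_bot (Delta G)) (z i) *~ c i))%R <= N)%N.
  apply: leq_trans (size_sum _ _ _) _; apply/bigmax_leqP => i _.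
  rewrite rmorphMz -scaler_int; apply: leq_trans (size_scale_leq _ _) _.
  exact: (leq_bigmax (F := fun i => size (zc i))).
by rewrite sN ltnn.
Qed.

Lemma not_fin_gen_H : ~ fin_gen_Z (KR_H G).
Proof.
case=> s gen; apply: (@not_comb (size s) (fun i => repr s`_i)) => a.
have [c cE] := gen (quot_pr _ (gen_cycle (koszul_hdeg0 (s := Delta G)) a)).
by exists c; rewrite [LHS]cE; apply: eq_bigr => i _; rewrite /quot_pr reprK.
Qed.

Lemma not_fin_gen_H0 : ~ fin_gen_Z (KR_H0 G).
Proof.
case=> s gen; apply: (@not_comb (size s) (fun i => repr (submod_val s`_i))) => a.
have [m mE] := homology_deg0_mem (koszul_hdeg0 (s := Delta G)) a.
have {}mE : val m = _ := mE.
have [c cE] := gen m; exists c; rewrite -mE cE raddf_sum; apply: eq_bigr => i _.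
by rewrite raddfMz /quot_pr reprK.
Qed.

End CycleEvaluation.

(** * Krull dimension *)

Section PrimeIdeals.
Variable A : comNzRingType.

Definition is_prime (P : A -> Prop) : Prop :=
  [/\ is_ideal P, ~ P 1 & forall a b, P (a * b) -> P a \/ P b].

Lemma is_primeN (P : A -> Prop) a : is_ideal P -> P a -> P (- a).
Proof. by case=> _ _ PM Pa; rewrite -mulN1r; apply: PM. Qed.

Lemma is_primeB (P : A -> Prop) a b : is_ideal P -> P a -> P b -> P (a - b).
Proof. by move=> idP Pa Pb; have [_ PD _] := idP; apply: PD => //; apply: is_primeN. Qed.

Lemma is_idealX (P : A -> Prop) a n : is_prime P -> P (a ^+ n) -> P a.
Proof.
case=> _ P1 PM; elim: n => [|n IH]; first by rewrite expr0.
by rewrite exprS => /PM[].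
Qed.

Definition ideal_pred (I : {P : A -> Prop | is_ideal P /\ ~ P 1}) : A -> bool :=
  fun a => `[< sval I a >].

Fact ideal_pred_closed I : idealr_closed (ideal_pred I).
Proof.
case: I => P [[P0 PD PM] P1]; split; rewrite ?unfold_in /ideal_pred /=.
- exact/asboolP.
- exact/asboolP.
- by move=> a u v /asboolP Pu /asboolP Pv; apply/asboolP; apply: PD => //; apply: PM.
Qed.
HB.instance Definition _ I := isIdealr.Build A (ideal_pred I) (ideal_pred_closed I).

Definition prime_pred (I : {P : A -> Prop | is_prime P}) : A -> bool :=
  fun a => `[< sval I a >].

Fact prime_pred_closed I : idealr_closed (prime_pred I).
Proof.
case: I => P [[P0 PD PM] P1 Pp]; split; rewrite ?unfold_in /prime_pred /=.
- exact/asboolP.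
- exact/asboolP.
- by move=> a u v /asboolP Pu /asboolP Pv; apply/asboolP; apply: PD => //; apply: PM.
Qed.
HB.instance Definition _ I := isIdealr.Build A (prime_pred I) (prime_pred_closed I).

Fact prime_pred_prime I : prime_idealr_closed (prime_pred I).
Proof.
case: I => P [idP P1 Pp] u v; rewrite !unfold_in /prime_pred /= => /asboolP/Pp[]/asboolP->//.
by rewrite orbT.
Qed.
HB.instance Definition _ I := isPrimeIdealrClosed.Build A (prime_pred I) (@prime_pred_prime I).

Lemma is_prime_idealr (p : prime_idealr A) : is_prime (fun a => a \in p).
Proof.
split; last by move=> a b; rewrite prime_idealrM => /orP[]; [left|right].
  split; [exact: idealr0|by move=> a b ap bp; rewrite rpredD|].
  by move=> a b; apply: idealMr.
by rewrite idealr1.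
Qed.

Definition chain_over (J : A -> Prop) (n : nat) : Prop :=
  exists p : nat -> A -> Prop,
    [/\ forall i, is_prime (p i), forall i a, J a -> p i a
      & forall i, (i < n)%N -> (forall a, p i a -> p i.+1 a) /\ exists2 a, p i.+1 a & ~ p i a].

End PrimeIdeals.

Lemma is_prime_preim (A B : comNzRingType) (f : {rmorphism A -> B}) P :
  is_prime P -> is_prime (fun a => P (f a)).
Proof.
case=> [[P0 PD PM] P1 Pp]; split; last 1 first.
- by move=> a b; rewrite rmorphM; apply: Pp.
- by split=> [|a b|a b]; rewrite ?rmorph0 ?rmorphD ?rmorphM //; [apply: PD|apply: PM].
- by rewrite rmorph1.
Qed.

Lemma is_prime_ker (A : comNzRingType) (B : idomainType) (f : {rmorphism A -> B}) :
  is_prime (fun a => f a = 0).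
Proof.
apply: (@is_prime_preim A B f (fun b => b = 0)); split.
- by split=> [|a b -> ->|a b ->]; rewrite ?addr0 ?mulr0.
- by move/eqP; rewrite oner_eq0.
- by move=> a b /eqP; rewrite mulf_eq0 => /orP[] /eqP; [left|right].
Qed.

Section KrullDimension.
Local Open Scope quotient_scope.
Variables (A : comNzRingType) (J : A -> Prop).

Lemma prime_chain_quot (I : idealr A) n : (forall a, a \in I <-> J a) ->
  prime_chain {ideal_quot I} n <-> chain_over J n.
Proof.
move=> IJ; pose pi : {rmorphism A -> {ideal_quot I}} := \pi_{ideal_quot I}.
have pi0 a : J a -> pi a = 0.
  by move/IJ => aI; apply/eqP; rewrite -[0](rmorph0 pi) -Quotient.idealrBE subr0.
split=> [[p pP]|[p [pp pJ pS]]].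
  exists (fun i a => pi a \in p i); split=> [i|i a /pi0 ->|i /pP[sub [b bp bn]]].
  - exact: is_prime_preim (is_prime_idealr (p i)).
  - exact: idealr0.
  - split=> [a|]; first exact: sub.
    by exists (repr b); rewrite /pi /= reprK //; apply/negP.
have repr_pi i a : p i (repr (pi a)) <-> p i a.
  have d : p i (a - repr (pi a)).
    by apply/pJ/IJ; rewrite Quotient.idealrBE reprK.
  have [idp _ _] := pp i; have [_ pD _] := idp.
  split=> pa; first by have := pD _ _ d pa; rewrite subrK.
  by have := is_primeB idp pa d; rewrite opprB addrCA subrr addr0.
have ppq i : is_prime (fun q : {ideal_quot I} => p i (repr q)).
  have [[p0 pD pM] p1 pmul] := pp i; split.
  - split=> [|a b pa pb|a b pb].
    + by rewrite -(rmorph0 pi); apply/repr_pi.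
    + by rewrite -[a]reprK -[b]reprK -(rmorphD pi); apply/repr_pi; apply: pD.
    + by rewrite -[a]reprK -[b]reprK -(rmorphM pi); apply/repr_pi; apply: pM.
  - by rewrite -(rmorph1 pi) => /repr_pi.
  - by move=> a b; rewrite -[a in a * b]reprK -[b in _ * b]reprK -(rmorphM pi) => /repr_pi/pmul.
exists (fun i => prime_pred (exist _ _ (ppq i))) => i i_n; have [sub [a pa na]] := pS i i_n.
split=> [q|]; first by rewrite !unfold_in /prime_pred /= => /asboolP/sub ?; apply/asboolP.
exists (pi a); rewrite unfold_in /prime_pred /=; first exact/asboolP/repr_pi.
by apply/asboolP => /repr_pi.
Qed.

Lemma has_KdimP (M : lmodType A) d : (forall a, in_ann M a <-> J a) -> ~ J 1 ->
  has_Kdim M d <-> chain_over J d /\ forall n, chain_over J n -> (n <= d)%N.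
Proof.
move=> annJ J1; split=> [[I [IM [ch ub]]]|[ch ub]].
  have IJ a : a \in I <-> J a by rewrite IM annJ.
  by split=> [|n cn]; [apply/(prime_chain_quot _ IJ) | apply/ub/(prime_chain_quot _ IJ)].
have idJ : is_ideal J.
  split=> [|a b /annJ Ja /annJ Jb|a b /annJ Jb]; apply/annJ => m; rewrite ?scale0r //.
    by rewrite scalerDl Ja Jb addr0.
  by rewrite -scalerA Jb scaler0.
pose I : idealr A := ideal_pred (exist _ J (conj idJ J1)).
have IJ a : a \in I <-> J a by rewrite unfold_in; split=> /asboolP.
exists I; split=> [a|]; first by rewrite IJ annJ.
by split=> [|n]; rewrite (prime_chain_quot _ IJ) //; apply: ub.
Qed.

Lemma has_Kdim_unique (M : lmodType A) d d' : (forall a, in_ann M a <-> J a) -> ~ J 1 ->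
  has_Kdim M d -> has_Kdim M d' -> d = d'.
Proof.
move=> annJ J1 /(has_KdimP _ annJ J1)[c u] /(has_KdimP _ annJ J1)[c' u'].
by apply/eqP; rewrite eqn_leq u' // u.
Qed.

End KrullDimension.

Section BoxPolynomials.

Fixpoint box (N m : nat) : seq (seq nat) :=
  if m is m'.+1 then [seq j :: l | j <- iota 0 N, l <- box N m'] else [:: [::]].

Lemma size_box N m : size (box N m) = (N ^ m)%N.
Proof. by elim: m => //= m IH; rewrite size_allpairs size_iota IH expnS. Qed.

Lemma box_uniq N m : uniq (box N m).
Proof.
elim: m => //= m IH; apply: allpairs_uniq => //; first exact: iota_uniq.
by move=> [i l] [j k] _ _ /= [-> ->].
Qed.

Lemma box_consP N m l : l \in box N m.+1 -> exists j l', [/\ l = j :: l', (j < N)%N & l' \in box N m].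
Proof. by case/allpairsP=> -[j l'] /= [jN lb ->]; exists j, l'; rewrite mem_iota in jN. Qed.

Definition nonzero_on (K : nmodType) N m (c : seq nat -> K) : Prop :=
  exists2 l, l \in box N m & c l != 0.

Variables (K A : comNzRingType) (kappa : {rmorphism K -> A}).

Fixpoint mon (xs : seq A) (l : seq nat) : A :=
  if xs is x :: xs' then x ^+ head 0%N l * mon xs' (behead l) else 1.

Definition box_poly N (xs : seq A) (c : seq nat -> K) : A :=
  \sum_(l <- box N (size xs)) kappa (c l) * mon xs l.

Lemma box_poly_nil N c : box_poly N [::] c = kappa (c [::]).
Proof. by rewrite /box_poly big_seq1 mulr1. Qed.

Lemma box_poly_cons N x xs c : box_poly N (x :: xs) c
  = \sum_(j < N) x ^+ j * box_poly N xs (fun l => c (nat_of_ord j :: l)).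
Proof.
rewrite /box_poly /= big_allpairs_dep -(big_mkord xpredT (fun j => x ^+ j *
  \sum_(l <- box N (size xs)) kappa (c (j :: l)) * mon xs l)) /index_iota subn0.
apply: eq_bigr => j _; rewrite mulr_sumr; apply: eq_bigr => l _ /=.
by rewrite mulrCA.
Qed.

Lemma box_poly_eq0 N xs c : (forall l, l \in box N (size xs) -> c l = 0) -> box_poly N xs c = 0.
Proof. by move=> c0; rewrite /box_poly big_seq big1 // => l /c0 ->; rewrite rmorph0 mul0r. Qed.

Lemma box_polyZ N xs a c c' : (forall l, l \in box N (size xs) -> c l = a * c' l) ->
  box_poly N xs c = kappa a * box_poly N xs c'.
Proof.
move=> cE; rewrite /box_poly mulr_sumr [LHS]big_seq [RHS]big_seq; apply: eq_bigr => l /cE ->.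
by rewrite rmorphM mulrA.
Qed.

(* Coquand-Lombardi: the lowest exponents, in the lexicographic order, can be
   divided out one variable at a time along the chain. *)
Lemma box_poly_lowest N xs1 xs2 c (p : nat -> A -> Prop) :
    (forall i, is_prime (p i)) ->
    (forall i, (i < size xs1)%N ->
      [/\ forall a, p i a -> p i.+1 a, p i.+1 (nth 0 xs1 i) & ~ p i (nth 0 xs1 i)]) ->
    nonzero_on N (size xs1 + size xs2) c -> p 0%N (box_poly N (xs1 ++ xs2) c) ->
  exists l1, nonzero_on N (size xs2) (fun l => c (l1 ++ l))
    /\ p (size xs1) (box_poly N xs2 (fun l => c (l1 ++ l))).
Proof.
elim: xs1 c p => [|x xs1 IH] c p pp chain nz pS; first by exists [::].
have [sub px nx] := chain 0%N isT.
have [[_ pD0 pM0] _ pm0] := pp 0%N; have [id1 _ _] := pp 1%N; have [_ _ pM1] := id1.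
pose Q j := (j < N)%N && `[< nonzero_on N (size xs1 + size xs2) (fun l => c (j :: l)) >].
have exQ : exists j, Q j.
  case: nz => _ /box_consP[j [l [-> jN lb]]] cl; exists j.
  by rewrite /Q jN; apply/asboolP; exists l.
case: (ex_minnP exQ) => j /andP[jN /asboolP nzj] minj.
pose S (k : nat) := box_poly N (xs1 ++ xs2) (fun l => c (k :: l)).
have S0 k : (k < j)%N -> S k = 0.
  move=> kj; apply: box_poly_eq0 => l lb; apply/eqP/negPn/negP => cl.
  have : Q k.
    rewrite /Q (ltn_trans kj jN); apply/asboolP; exists l => //.
    by rewrite -size_cat.
  by move/minj; rewrite leqNgt kj.
have [r SE] : exists r, box_poly N (x :: xs1 ++ xs2) c = x ^+ j * (S j + x * r).
  exists (\sum_(k < N | (j < k)%N) x ^+ (k - j.+1) * S k).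
  rewrite box_poly_cons (bigD1 (Ordinal jN)) //= mulrDr; congr (_ + _).
  rewrite !mulr_sumr [RHS]big_mkcond [LHS]big_mkcond; apply: eq_bigr => k _ /=.
  rewrite -val_eqE /=; case: (ltngtP k j) => [kj|jk|//] /=.
    by rewrite -/(S k) S0 ?mulr0.
  by rewrite mulrA -/(S k) mulrA -exprSr -exprD subnKC.
have pj : p 0%N (S j + x * r).
  have := pS; rewrite /= SE => /pm0[/is_idealX xp|//].
  by case: nx; apply: xp.
have p1 : p 1%N (S j).
  have /sub p1 := pj; have := is_primeB id1 p1 (pM1 r x px).
  by rewrite [r * x]mulrC addrK.
have [|i ix|l1 [nz1 pS1]] := IH _ (fun i => p i.+1) _ _ nzj p1.
- by move=> i; apply: pp.
- exact: (chain i.+1 ix).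
by exists (j :: l1).
Qed.

End BoxPolynomials.

Lemma box_poly_rmorph (K A B : comNzRingType) (k : {rmorphism K -> A}) (k' : {rmorphism K -> B})
    (f : {rmorphism A -> B}) N xs c : (forall a, f (k a) = k' a) ->
  f (box_poly k N xs c) = box_poly k' N [seq f x | x <- xs] c.
Proof.
move=> fk; rewrite /box_poly size_map rmorph_sum; apply: eq_bigr => l _.
rewrite rmorphM fk; congr (_ * _); elim: xs l => [|x xs IH] l /=; first by rewrite rmorph1.
by rewrite rmorphM rmorphXn IH.
Qed.

Lemma box_poly_mod (K A : comNzRingType) (k : {rmorphism K -> A}) (P : A -> Prop) N c
    (f : A -> A) xs : is_ideal P -> (forall a, P (a - f a)) ->
  P (box_poly k N [seq f x | x <- xs] c) -> P (box_poly k N xs c).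
Proof.
move=> idP Pf; have [P0 PD PM] := idP.
suff H : P (box_poly k N xs c - box_poly k N [seq f x | x <- xs] c).
  by move=> Pf'; have := PD _ _ H Pf'; rewrite subrK.
rewrite /box_poly size_map -sumrB; apply: (big_ind P) => // l _.
rewrite -mulrBr; apply: (PM); elim: xs l => [|x xs IH] l /=; first by rewrite subrr.
have PX n : P (x ^+ n - f x ^+ n) by rewrite subrXX mulrC; apply: (PM).
rewrite -[X in P (X - _)](subrK (x ^+ head 0%N l * mon [seq f x | x <- xs] (behead l))) -addrA.
apply: (PD); first by rewrite -mulrBr; apply: (PM).
by rewrite -mulrBl mulrC; apply: (PM).
Qed.

Section Dependence.
Variable K : idomainType.

Lemma dependent_rows r s (M : 'M[K]_(r, s)) : (s < r)%N ->
  exists2 v : 'rV[K]_r, v != 0 & v *m M = 0.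
Proof.
case: r M => // r M sr.
pose M' : 'M[K]_r.+1 := \matrix_(i, j) if insub (nat_of_ord j) is Some j' then M i j' else 0.
have : \det M' == 0.
  rewrite (expand_det_col _ ord_max) big1 // => i _; rewrite mxE insubF ?mul0r //.
  by rewrite /= ltnNge -ltnS sr.
case/det0P=> v v0 vM; exists v => //; apply/rowP => j.
have jr : (j < r.+1)%N := ltn_trans (ltn_ord j) sr.
have := congr1 (fun u : 'rV_r.+1 => u 0 (Ordinal jr)) vM; rewrite !mxE => E.
rewrite -[RHS]E; apply: eq_bigr => i _; rewrite !mxE insubT //= => jj.
by congr (_ * M _ _); apply: val_inj.
Qed.

Variable k : nat.
Local Notation T := {mpoly K[k]}.
Local Notation kappa := (@mpolyC k K : {rmorphism K -> T}).

Lemma coef_exponent_bound (p : T) M : (msize p <= M.+1)%N ->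
  (forall f : {ffun 'I_k -> 'I_M.+1}, p@_[multinom nat_of_ord (f i) | i < k] = 0) -> p = 0.
Proof.
move=> sp p0; apply/mpolyP => m; rewrite mcoeff0; have [mp|] := boolP (m \in msupp p); last first.
  exact: memN_msupp_eq0.
have mM i : (m i < M.+1)%N.
  apply: leq_trans sp; apply: leq_trans (msize_mdeg_lt mp); rewrite ltnS.
  by rewrite mdegE (bigD1 i) //= leq_addr.
rewrite -[RHS](p0 [ffun i => Ordinal (mM i)]); congr (p@__).
by apply/mnmP => i; rewrite mnmE ffunE.
Qed.

Lemma msize_mon (xs : seq T) D N l : (forall x, x \in xs -> (msize x <= D)%N) ->
  l \in box N (size xs) -> (msize (mon xs l) <= size xs * N * D.+2 + 1)%N.
Proof.
have sizeM (p q : T) a b : (msize p <= a)%N -> (msize q <= b)%N -> (msize (p * q) <= a + b + 1)%N.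
  by move=> pa qb; apply: leq_trans (msizeM_le p q) _; rewrite addn1 ltnS leq_add.
elim: xs l => [|x xs IH] l xD /=; first by rewrite msize1.
case/box_consP=> j [l' [-> jN lb]] /=.
have xX n : (msize (x ^+ n) <= n * D.+1 + 1)%N.
  elim: n => [|n IHn]; first by rewrite expr0 msize1.
  rewrite exprS; apply: leq_trans (sizeM _ _ _ _ (xD x (mem_head _ _)) IHn) _.
  by rewrite mulSn; lia.
have := sizeM _ _ _ _ (xX j) (IH l' _ lb) => H; apply: leq_trans (H _) _.
  by move=> y yxs; apply: xD; rewrite inE yxs orbT.
have [N' ->] : exists N', N = (j + N'.+1)%N by exists (N - j.+1)%N; lia.
rewrite mulSn !mulnDl !mulSn !mulnS; lia.
Qed.

Lemma msize_sum_le (I : eqType) (r : seq I) (F : I -> T) M :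
  (forall i, i \in r -> (msize (F i) <= M)%N) -> (msize (\sum_(i <- r) F i) <= M)%N.
Proof.
elim: r => [|i r IH] H; first by rewrite big_nil msize0.
rewrite big_cons; apply: leq_trans (msizeD_le _ _) _; rewrite geq_max H ?mem_head //=.
by apply: IH => j jr; apply: H; rewrite inE jr orbT.
Qed.

(* More than [k] polynomials in [k] variables are algebraically dependent: for
   large [N] there are more monomials in the box than coefficients. *)
Lemma algebraic_dependence (qs : seq T) : (k < size qs)%N ->
  exists N c, nonzero_on N (size qs) c /\ box_poly kappa N qs c = 0.
Proof.
set m := size qs => km.
pose D := \max_(q <- qs) msize q.
have qD q : q \in qs -> (msize q <= D)%N by move=> qqs; apply: leq_bigmax_seq.
pose N := ((m * D.+2 + 2) ^ k).+1; pose M := (m * N * D.+2 + 1)%N.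
have count : (#|{ffun 'I_k -> 'I_M.+1}| < size (box N m))%N.
  rewrite size_box card_ffun !card_ord.
  have : (M.+1 <= N * (m * D.+2 + 2))%N.
    by rewrite mulnDr mulnA [(N * m)%N]mulnC /M; have : (0 < N)%N by []; lia.
  have leXk a b : (a <= b -> a ^ k <= b ^ k)%N.
    by case: (k) => // k' ab; rewrite leq_exp2r.
  move=> /leXk MN; apply: leq_ltn_trans MN _; rewrite expnMn.
  apply: leq_trans (leq_pexp2l _ km); last by [].
  by rewrite expnSr ltn_pmul2l ?expn_gt0 //.
pose lst := box N m.
pose B (i : 'I_(size lst)) (f : 'I_#|{ffun 'I_k -> 'I_M.+1}|) : K :=
  (mon qs (nth [::] lst i))@_[multinom nat_of_ord (enum_val f i) | i < k].
have [v v0 vB] := dependent_rows (\matrix_(i, f) B i f) count.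
pose c (l : seq nat) : K := if insub (index l lst) is Some i then v 0 i else 0.
have cE (i : 'I_(size lst)) : c (nth [::] lst i) = v 0 i.
  rewrite /c index_uniq ?box_uniq // insubT //= => ii; congr (v 0 _); exact: val_inj.
exists N, c; split.
  have /rV0Pn[i vi] := v0; exists (nth [::] lst i); last by rewrite cE.
  exact: mem_nth.
apply: (@coef_exponent_bound _ M).
  apply: msize_sum_le => l lb; rewrite mul_mpolyC; apply: leq_trans (msizeZ_le _ _) _.
  exact: leq_trans (msize_mon qD lb) _.
move=> f; have := congr1 (fun u : 'rV_ _ => u 0 (enum_rank f)) vB; rewrite !mxE => <-.
rewrite /box_poly raddf_sum /= -/m -/lst (big_nth [::]) big_mkord.
apply: eq_bigr => i _; rewrite cE mxE /B enum_rankK mul_mpolyC mcoeffZ //.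
Qed.

End Dependence.

Section KrullBounds.

Lemma chain_witnesses (A : comNzRingType) (p : nat -> A -> Prop) d :
    (forall i, (i < d)%N -> exists2 a, p i.+1 a & ~ p i a) ->
  exists2 xs : seq A, size xs = d &
    forall i, (i < d)%N -> p i.+1 (nth 0 xs i) /\ ~ p i (nth 0 xs i).
Proof.
move=> ex; have exw i : exists a, (i < d)%N -> p i.+1 a /\ ~ p i a.
  by case: (ltnP i d) => [/ex[a pa na]|_]; [exists a|exists 0].
exists (mkseq (fun i => projT1 (cid (exw i))) d); first by rewrite size_mkseq.
by move=> i i_d; rewrite nth_mkseq //; apply: (projT2 (cid (exw i))).
Qed.

Lemma krull_bound (K A : comNzRingType) (kappa : {rmorphism K -> A}) (p : nat -> A -> Prop) d k :
    (forall i, is_prime (p i)) ->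
    (forall i, (i < d)%N -> (forall a, p i a -> p i.+1 a) /\ exists2 a, p i.+1 a & ~ p i a) ->
    (forall ys : seq A, (k < size ys)%N ->
      exists N c, nonzero_on N (size ys) c /\ p 0%N (box_poly kappa N ys c)) ->
    (forall c, p d (kappa c) -> c = 0) ->
  (d <= k)%N.
Proof.
move=> pp ps dep const0; rewrite leqNgt; apply/negP => kd.
have [|xs sxs xsP] := @chain_witnesses _ p d; first by move=> i /ps[].
have [|N [c [nz pc]]] := dep xs; first by rewrite sxs.
have [|||l1 [nz1]] := @box_poly_lowest _ _ kappa N xs [::] c p pp.
- by rewrite sxs => i i_d; have [? ?] := xsP i i_d; split=> //; case: (ps i i_d).
- by rewrite addn0.
- by rewrite cats0.
rewrite box_poly_nil sxs => /const0 c0.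
by case: nz1 => l; rewrite inE => /eqP->; rewrite c0 eqxx.
Qed.

Lemma primitive_coefficients N m (c : seq nat -> int) (q : int) : 1 < q -> nonzero_on N m c ->
  exists e c', (forall l, l \in box N m -> c l = q ^+ e * c' l) /\
    exists2 l, l \in box N m & ~~ (q %| c' l)%Z.
Proof.
move=> q1 [l0 l0b]; have [n] := ubnP `|c l0|%N; elim: n c => // n IH c cn cl0.
have [/allP dv|/allPn[l lb nd]] := boolP (all (fun l => q %| c l)%Z (box N m)); last first.
  by exists 0%N, c; split=> [l' _|]; [rewrite expr0 mul1r | exists l].
have E l : l \in box N m -> c l = q * (c l %/ q)%Z by move=> /dv/divzK {1}<-; rewrite mulrC.
have [||e [c' [cE c'P]]] := IH (fun l => (c l %/ q)%Z).
- move: cn cl0; rewrite {1 2}(E _ l0b) abszM mulf_eq0 negb_or => cn /andP[_ d0].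
  have : (0 < `|(c l0 %/ q)%Z|)%N by rewrite absz_gt0.
  have : (1 < `|q|)%N by lia.
  by move: cn; move: `|q|%N `|(c l0 %/ q)%Z|%N => a b; nia.
- by apply: contraNneq cl0 => d0; rewrite (E _ l0b) d0 mulr0.
exists e.+1, c'; split=> // l lb; rewrite (E _ lb) (cE _ lb) exprS mulrA //.
Qed.

(* Over the integers, a chain may also pass from the primes meeting [int] in [0]
   to those containing a generator [q] of their intersection with [int]. *)
Lemma krull_bound_int (A : comNzRingType) (kappa : {rmorphism int -> A}) (p : nat -> A -> Prop) d k :
    (forall i, is_prime (p i)) ->
    (forall i, (i < d)%N -> (forall a, p i a -> p i.+1 a) /\ exists2 a, p i.+1 a & ~ p i a) ->
    (forall (ys : seq A) q, 1 < q -> (k < size ys)%N ->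
      exists N c, (exists2 l, l \in box N (size ys) & ~~ (q %| c l)%Z)
        /\ p 0%N (box_poly kappa N ys c)) ->
  (d <= k.+1)%N.
Proof.
move=> pp ps dep.
have nz_of N m (c : seq nat -> int) q : (exists2 l, l \in box N m & ~~ (q %| c l)%Z) -> nonzero_on N m c.
  by case=> l lb nd; exists l => //; apply: contraNneq nd => ->; rewrite dvdz0.
have [const0|/existsNP[c0 /not_implyP[pc0 c0n]]] := pselect (forall c, p d (kappa c) -> c = 0).
  apply: leqW; apply: (krull_bound pp ps _ const0) => ys ysk.
  have [N [c [nd pc]]] := dep ys 2 isT ysk; exists N, c; split=> //; exact: nz_of nd.
have [idd pd1 _] := pp d; have [_ _ pdM] := idd.
have exq : exists n, `[< (0 < n)%N /\ p d (kappa n%:Z) >].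
  exists `|c0|%N; apply/asboolP; split; first by rewrite absz_gt0; apply/eqP.
  rewrite abszE; case: (ger0P c0) => _ //.
  by rewrite rmorphN; apply: is_primeN => //; case: (pp d).
case: (ex_minnP exq) => n /asboolP[n0 pn] minn; pose q : int := n%:Z.
have q1 : 1 < q.
  have : n != 1%N by apply/eqP => n1; apply: pd1; move: pn; rewrite n1 rmorph1.
  by rewrite /q; lia.
have q0 : q != 0 by rewrite gt_eqF // (lt_trans _ q1).
have dvd_q c : p d (kappa c) -> (q %| c)%Z.
  move=> pc; apply/dvdz_mod0P/eqP/negPn/negP => r0.
  have pr : p d (kappa (c %% q)%Z).
    have -> : (c %% q)%Z = c - (c %/ q)%Z * q by [].
    by rewrite rmorphB rmorphM; apply: (is_primeB idd pc); apply: pdM.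
  have rg := modz_ge0 c q0; have rl := ltz_pmod c (lt_trans ltr01 q1).
  have := minn `|(c %% q)%Z|%N; rewrite asboolT.
    by move=> /(_ isT); move: rl rg; rewrite /q; lia.
  by rewrite absz_gt0 r0 gez0_abs.
have pkill (i : nat) N ys c : p i (kappa q) -> p i (box_poly kappa N ys c) ->
    p i (box_poly kappa N ys (fun l => if (q %| c l)%Z then 0 else c l)).
  move=> pq pc; have [idp _ _] := pp i; have [_ pD pM] := idp.
  have E : box_poly kappa N ys (fun l => if (q %| c l)%Z then c l else 0)
      = kappa q * box_poly kappa N ys (fun l => if (q %| c l)%Z then (c l %/ q)%Z else 0).
    apply: box_polyZ => l _; case: ifP => [/divzK {1}<-|_]; last by rewrite mulr0.
    by rewrite mulrC.
  have := is_primeB idp pc (pM (box_poly kappa N ys (fun l => if (q %| c l)%Z then (c l %/ q)%Z else 0)) _ pq).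
  rewrite mulrC -E /box_poly -sumrB; congr (p i _); apply: eq_bigr => l _.
  by rewrite -mulrBl -rmorphB; case: ifP => _; rewrite ?subrr ?subr0.
have finish (j : nat) (xs : seq A) N c : (j <= d)%N -> p j (kappa q) -> size xs = (d - j)%N ->
    (forall i, (i < d - j)%N -> p (j + i).+1 (nth 0 xs i) /\ ~ p (j + i)%N (nth 0 xs i)) ->
    (exists2 l, l \in box N (size xs) & ~~ (q %| c l)%Z) ->
    p j (box_poly kappa N xs c) -> False.
  move=> jd pq sxs xsP [l lb nd] /(pkill _ _ _ _ pq) pc.
  have [||||l1 [nz1]] := @box_poly_lowest _ _ kappa N xs [::]
    (fun l => if (q %| c l)%Z then 0 else c l) (fun i => p (j + i)%N).
  - by move=> i; apply: pp.
  - rewrite sxs => i i_d; have [? ?] := xsP i i_d; rewrite addnS; split=> //.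
    by case: (ps (j + i)%N) => //; lia.
  - rewrite addn0; exists l => //.
    by rewrite (negPf nd); apply: contraNneq nd => ->; rewrite dvdz0.
  - by rewrite cats0 addn0; exact: pc.
  - rewrite box_poly_nil sxs subnKC // => /dvd_q.
    case: nz1 => l'; rewrite inE => /eqP ->; rewrite cats0.
    by case: ifP => [|->//]; rewrite eqxx.
have [|xs sxs xsP] := @chain_witnesses _ p d; first by move=> i /ps[].
rewrite leqNgt; apply/negP => kd.
have exj : exists j, `[< p j (kappa q) >] by exists d; apply/asboolP.
case: (ex_minnP exj) => j /asboolP pj minj.
have jd : (j <= d)%N by apply: minj; apply/asboolP.
case: j => [|j] in pj minj jd *.
  have [|N [c [nd pc]]] := dep xs q q1; first by rewrite sxs; lia.
  apply: (finish 0%N xs N c) => //; rewrite ?subn0 //.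
have npj : ~ p j (kappa q) by move=> pjq; have := minj j; rewrite asboolT // ltnn => /(_ isT).
pose xs1 := take j xs; pose xs2 := drop j.+1 xs.
have s1 : size xs1 = j by rewrite size_takel // sxs ltnW.
have s2 : size xs2 = (d - j.+1)%N by rewrite size_drop sxs.
have [|N [c [nd pc]]] := dep (xs1 ++ xs2) q q1; first by rewrite size_cat s1 s2; lia.
have nz := nz_of _ _ _ _ nd.
have [|||l1 [nz1 pc1]] := @box_poly_lowest _ _ kappa N xs1 xs2 c p pp.
- rewrite s1 => i ij; rewrite nth_take //.
  have i_d : (i < d)%N by lia.
  by have [? ?] := xsP i i_d; split=> //; case: (ps i i_d).
- by rewrite -size_cat.
- exact: pc.
have [e [c' [cE c'P]]] := primitive_coefficients q1 nz1.
rewrite s1 in pc1.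
have [_ _ pmj] := pp j.
have pc' : p j (box_poly kappa N xs2 c').
  move: pc1; rewrite (box_polyZ _ cE) rmorphXn => /pmj[/is_idealX pq|//].
  by case: npj; apply: pq.
apply: (finish j.+1 xs2 N c') => //.
- move=> i i_d; rewrite /xs2 nth_drop addSn.
  by apply: xsP; lia.
- by case: (ps j jd) => sub _; apply: sub.
Qed.

End KrullBounds.

Lemma mpoly_rmorph_mod (K B : comNzRingType) n (psi : {rmorphism {mpoly K[n]} -> B})
    (theta : {rmorphism B -> {mpoly K[n]}}) (P : {mpoly K[n]} -> Prop) : is_ideal P ->
    (forall c, P (c%:MP - theta (psi c%:MP))) -> (forall i, P ('X_i - theta (psi 'X_i))) ->
  forall a, P (a - theta (psi a)).
Proof.
move=> [_ PD PM] PC PX; apply: mpoly_subring_ind => // p q Pp Pq.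
  by rewrite (rmorphD psi) (rmorphD theta) opprD addrACA; apply: PD.
rewrite (rmorphM psi) (rmorphM theta).
have -> : p * q - theta (psi p) * theta (psi q)
  = q * (p - theta (psi p)) + theta (psi p) * (q - theta (psi q)) by ring.
by apply: PD; apply: PM.
Qed.

(* The edges with a given nonzero value form a balanced set, which contains a
   directed cycle. *)
Lemma balanced_representatives (G : digraph) (B : comNzRingType) (x : edge G -> B) :
    (forall z, z != 0 -> balanced [set e | x e == z]) ->
  exists (R : {set edge G}) (rep : edge G -> edge G), [/\ (#|R| <= alpha G)%N,
    forall e, x (rep e) = x e & forall e, (rep e \in R) = (x e != 0)].
Proof.
move=> bal; pose rep (e : edge G) := odflt e [pick f | x f == x e].
have repE e : x (rep e) = x e by rewrite /rep; case: pickP => [f /eqP|].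
have rep_x e f : x e = x f -> rep e = rep f.
  by move=> ef; rewrite /rep ef; case: pickP => // /(_ f); rewrite eqxx.
pose R := [set rep e | e in [set e | x e != 0]].
have xR r : r \in R -> x r != 0 /\ rep r = r.
  case/imsetP=> e; rewrite inE => xe ->; rewrite repE; split; first exact: xe.
  exact: rep_x (repE e).
exists R, rep; split=> // [|e]; last first.
  by apply/idP/idP => [/xR[]|xe]; [rewrite repE | apply: imset_f; rewrite inE].
have -> : #|R| = #|{: {r : edge G | r \in R}}| by rewrite card_sig; apply: eq_card.
apply: (@card_le_alpha G {r : edge G | r \in R} (fun r => [set e | x e == x (val r)])).
  move=> [r rR] /=; have [xr _] := xR r rR.
  apply: dicycle_of_balanced (bal _ xr).
  by apply/set0Pn; exists r; rewrite inE.
move=> [r rR] [s sR] /= rs; rewrite -setI_eq0; apply/eqP/setP => e; rewrite !inE.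
apply/negP => /andP[/eqP er /eqP es]; case/eqP: rs; apply: val_inj => /=.
have [_ <-] := xR r rR; have [_ <-] := xR s sR.
by apply: rep_x; rewrite -er es.
Qed.

Section GraphDimension.
Variables (K : idomainType) (G : digraph).

Local Notation A := {mpoly K[#|edge G|]}.

Definition change_coeff : {rmorphism edge_ring G -> A} :=
  map_mpoly (intr : {rmorphism int -> K}).

Definition Delta_ideal (a : A) : Prop := in_ideal [seq change_coeff d | d <- Delta G] a.

Lemma change_coeff_var (e : edge G) : change_coeff (edge_var e) = 'X_(enum_rank e).
Proof. exact: map_mpolyX. Qed.

Lemma mpoly_rmorph_ext (B : comNzRingType) n (f g : {rmorphism {mpoly K[n]} -> B}) :
  (forall c, f c%:MP = g c%:MP) -> (forall i, f 'X_i = g 'X_i) -> f =1 g.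
Proof.
move=> C X; elim/mpoly_subring_ind => // p q fp fq; first by rewrite !rmorphD fp fq.
by rewrite !rmorphM fp fq.
Qed.

Lemma prime_reduction (P : A -> Prop) : is_prime P -> (forall a, Delta_ideal a -> P a) ->
  exists k, (k <= alpha G)%N /\
  exists (psi : {rmorphism A -> {mpoly K[k]}}) (theta : {rmorphism {mpoly K[k]} -> A}),
    (forall c, theta c%:MP = c%:MP) /\ forall a, P (a - theta (psi a)).
Proof.
move=> primeP JP; have [idP P1 PM] := primeP; have [P0 PD PMl] := idP.
pose I : prime_idealr A := prime_pred (exist _ P primeP).
have IP a : a \in I <-> P a by rewrite unfold_in; split=> /asboolP.
pose pi : {rmorphism A -> {ideal_quot I}} := \pi_({ideal_quot I})%qT.
have pi0 a : pi a = 0 <-> P a.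
  by rewrite -IP -[a in a \in _]subr0 Quotient.idealrBE -[0 in RHS](rmorph0 pi); split=> [->|/eqP].
pose x (e : edge G) := pi 'X_(enum_rank e).
have bal : forall z, z != 0 -> balanced [set e | x e == z].
  apply: balanced_of_esym => [a b|]; first exact: Quotient.rquot_IdomainAxiom.
  have kill d : d \in Delta G -> (pi \o change_coeff : {rmorphism _ -> _}) d = 0.
    by move=> dD; apply/pi0/JP/mem_in_ideal; apply: map_f.
  have /rmorph_Delta eqs := kill.
  have E F l : esymv ((pi \o change_coeff : {rmorphism _ -> _}) \o @edge_var G) F l = esymv x F l.
    by apply: eq_bigr => D _; apply: eq_bigr => e _; rewrite /= change_coeff_var.
  by move=> v l lv; have := eqs v l lv; rewrite !E.
have [R [rep [Ra repE repR]]] := balanced_representatives bal.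
exists #|R|; split; first exact: Ra.
pose psi : {rmorphism A -> {mpoly K[#|R|]}} := edge_eval (@mpolyC #|R| K)
  (fun e => if [pick i : 'I_#|R| | enum_val i == rep e] is Some i then 'X_i else 0).
pose theta : {rmorphism {mpoly K[#|R|]} -> A} :=
  mmap (@mpolyC #|edge G| K) (fun i => 'X_(enum_rank (enum_val i : edge G))).
have thetaC c : theta c%:MP = c%:MP by apply: mmapC.
have thetaX i : theta 'X_i = 'X_(enum_rank (enum_val i : edge G)).
  by apply: etrans (mmapX _ _ _) _; rewrite mmap1U.
exists psi, theta; split=> //.
have xP e f : x e = x f -> P ('X_(enum_rank e) - 'X_(enum_rank f)).
  by move=> ef; apply/pi0; rewrite rmorphB -/(x e) -/(x f) ef subrr.
apply: (mpoly_rmorph_mod idP) => [c|i].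
  by have -> : psi c%:MP = c%:MP by [apply: mmapC]; rewrite thetaC subrr.
rewrite -(enum_valK i); move: (enum_val i) => e.
have -> : psi 'X_(enum_rank e) = _ := edge_evalX _ _ e.
case: pickP => [j /eqP je|no].
  by rewrite thetaX je; apply: xP; rewrite repE.
rewrite rmorph0 subr0; apply/pi0/eqP/negPn; rewrite -repR; apply/negP => eR.
by have := no (enum_rank_in eR (rep e)); rewrite enum_rankK_in ?eqxx.
Qed.

Lemma reduction_box_poly (P : A -> Prop) k (psi : {rmorphism A -> {mpoly K[k]}})
    (theta : {rmorphism {mpoly K[k]} -> A}) N c (ys : seq A) :
    is_ideal P -> (forall c, theta c%:MP = c%:MP) -> (forall a, P (a - theta (psi a))) ->
    box_poly (@mpolyC k K : {rmorphism _ -> _}) N [seq psi y | y <- ys] c = 0 ->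
  P (box_poly (@mpolyC #|edge G| K : {rmorphism _ -> _}) N ys c).
Proof.
move=> idP thetaC mod rel; apply: (box_poly_mod (f := fun a => theta (psi a))) => //.
have := box_poly_rmorph (f := theta) N [seq psi y | y <- ys] c thetaC.
by rewrite rel rmorph0 -map_comp => <-; case: idP.
Qed.

Section LowerBound.
Variable C : 'I_(alpha G) -> {set edge G}.
Hypothesis dC : forall i, dicycle_set (C i).
Hypothesis disjC : forall i j, i != j -> [disjoint C i & C j].

Local Notation T := {mpoly K[alpha G]}.

Let cyc (e : edge G) : option 'I_(alpha G) := [pick j | e \in C j].

Let cycP e j : (cyc e == Some j) = (e \in C j).
Proof.
rewrite /cyc; case: pickP => [i ei|no]; last by rewrite no.
apply/eqP/idP => [[<-]//|ej]; congr Some; apply/eqP/negPn/negP => /disjC.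
by move/disjointFr/(_ ei); rewrite ej.
Qed.

Let x i (e : edge G) : T := if cyc e is Some j then (if (i <= j)%N then 'X_j else 0) else 0.

Let phi i : {rmorphism A -> T} := edge_eval (@mpolyC (alpha G) K) (x i).

Let phiX i e : phi i 'X_(enum_rank e) = x i e.
Proof. exact: edge_evalX. Qed.

Lemma mpolyX_neq0 n (j : 'I_n) : 'X_j != 0 :> {mpoly K[n]}.
Proof. by apply/negP => /eqP/(congr1 (fun p => p@_U_(j))) /eqP; rewrite mcoeffX eqxx mcoeff0 oner_eq0. Qed.

Lemma mpolyX_inj n (i j : 'I_n) : 'X_i = 'X_j :> {mpoly K[n]} -> i = j.
Proof.
move/(congr1 (fun p => p@_U_(j))); rewrite !mcoeffX eqxx.
have [/mnmP/(_ j)|_ /eqP] := eqVneq U_(i)%MM U_(j)%MM; last by rewrite eq_sym oner_eq0.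
by rewrite !mnm1E eqxx; case: eqP.
Qed.

Let x_balanced i z : z != 0 -> balanced [set e | x i e == z].
Proof.
move=> z0; have [[e0 e0z]|no] := pselect (exists e, x i e = z); last first.
  suff -> : [set e | x i e == z] = finset.set0 by apply: balanced0.
  by apply/setP => e; rewrite in_set0 inE; apply/negP => /eqP ez; apply: no; exists e.
move: e0z; rewrite /x; case ce: (cyc e0) => [j|] e0z; last by rewrite e0z eqxx in z0.
case ij: (i <= j)%N in e0z; last by rewrite e0z eqxx in z0.
suff -> : [set e | x i e == z] = C j by apply: dicycle_set_balanced.
apply/setP => e; rewrite inE -cycP /x -e0z; case: (cyc e) => [l|]; last first.
  by rewrite eq_sym (negPf (mpolyX_neq0 j)).
apply/eqP/eqP => [|[->]]; last by rewrite ij.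
case: ifP => _; last by move/eqP; rewrite eq_sym (negPf (mpolyX_neq0 j)).
by move/mpolyX_inj->.
Qed.

Lemma edge_eval_Delta_ideal (B : comNzRingType) (f : {rmorphism K -> B}) y a :
  (forall z, z != 0 -> balanced [set e | y e == z]) -> Delta_ideal a -> edge_eval f y a = 0.
Proof.
move=> bal; apply: rmorph_in_ideal => _ /mapP[d dD ->].
have E : (edge_eval f y \o change_coeff : {rmorphism _ -> _}) =1
    edge_eval (f \o intr : {rmorphism int -> B}) y.
  move=> p; elim/mpoly_subring_ind: p => [c|i|p q Ep Eq|p q Ep Eq].
  - rewrite /= [change_coeff _](map_mpolyC _ _); apply: etrans (mmapC _ _ _) _.
    by apply/esym; apply: mmapC.
  - rewrite -(enum_valK i) edge_evalX /= -/(edge_var _) change_coeff_var.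
    exact: edge_evalX.
  - by rewrite !rmorphD Ep Eq.
  - by rewrite !rmorphM Ep Eq.
by have := E d; rewrite /= => ->; apply: edge_eval_Delta dD.
Qed.

Let p i (a : A) : Prop := phi i a = 0.

Let p_prime i : is_prime (p i).
Proof. exact: is_prime_ker. Qed.

Let p_Delta i a : Delta_ideal a -> p i a.
Proof. by apply: edge_eval_Delta_ideal; apply: x_balanced. Qed.

Let p_strict i : (i < alpha G)%N -> (forall a, p i a -> p i.+1 a) /\ exists2 a, p i.+1 a & ~ p i a.
Proof.
move=> i_a; pose j := Ordinal i_a.
pose sigma : {rmorphism T -> T} :=
  mmap (@mpolyC (alpha G) K) (fun l => if l == j then 0 else 'X_l).
have E : phi i.+1 =1 (sigma \o phi i : {rmorphism _ -> _}).
  apply: mpoly_rmorph_ext => [c|k] /=.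
    have -> : phi i.+1 c%:MP = c%:MP by apply: mmapC.
    have -> : phi i c%:MP = c%:MP by apply: mmapC.
    by apply/esym; apply: mmapC.
  rewrite -(enum_valK k) !phiX /x; case: (cyc _) => [l|]; last by rewrite rmorph0.
  case: (ltngtP i l) => [il|li|il]; rewrite ?rmorph0 //.
    apply/esym; apply: etrans (mmapX _ _ _) _; rewrite mmap1U.
    by case: eqP => // lj; rewrite lj ltnn in il.
  apply/esym; apply: etrans (mmapX _ _ _) _; rewrite mmap1U.
  by rewrite (_ : l = j) ?eqxx //; apply: val_inj.
split=> [a pa|]; first by rewrite /p E /= pa rmorph0.
have /set0Pn[e eC] := dicycle_set_neq0 (dC j).
exists 'X_(enum_rank e); rewrite /p phiX /x; move: eC; rewrite -cycP => /eqP ->.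
  by rewrite ltnn.
by rewrite leqnn => /eqP; rewrite (negPf (mpolyX_neq0 j)).
Qed.

Lemma Delta_chain : chain_over Delta_ideal (alpha G).
Proof. by exists p. Qed.

Lemma Delta_chain_extend (F : idomainType) (f : {rmorphism K -> F}) c : c != 0 -> f c = 0 ->
  chain_over Delta_ideal (alpha G).+1.
Proof.
move=> c0 fc; pose phi' : {rmorphism A -> F} := edge_eval f (fun=> 0).
have phi'X e : phi' 'X_(enum_rank e) = 0 := edge_evalX f (fun=> 0) e.
pose p' i : A -> Prop := if (i <= alpha G)%N then p i else fun a => phi' a = 0.
have pE i : (i <= alpha G)%N -> p' i = p i by rewrite /p' => ->.
have pE' : p' (alpha G).+1 = (fun a => phi' a = 0) by rewrite /p' ltnn.
exists p'; split.
- by move=> i; rewrite /p'; case: (i <= alpha G)%N; [exact: p_prime | exact: is_prime_ker].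
- move=> i a Ja; rewrite /p'; case: (i <= alpha G)%N; first exact: p_Delta.
  apply: (@edge_eval_Delta_ideal F f (fun=> 0) a _ Ja) => z z0.
  suff -> : [set e : edge G | 0 == z] = finset.set0 by apply: balanced0.
  by apply/setP => e; rewrite in_set0 inE eq_sym (negPf z0).
move=> i; rewrite ltnS leq_eqVlt => /predU1P[->|ia]; last first.
  by rewrite (pE _ ia) (pE _ (ltnW ia)); apply: p_strict.
rewrite pE' (pE _ (leqnn _)); split.
  pose red : {rmorphism T -> F} := mmap f (fun=> 0).
  have E : phi' =1 (red \o phi (alpha G) : {rmorphism _ -> _}).
    apply: mpoly_rmorph_ext => [d|k] /=.
      have -> : phi (alpha G) d%:MP = d%:MP by apply: mmapC.
      by apply: etrans (mmapC _ _ _) _; apply/esym; apply: mmapC.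
    rewrite -(enum_valK k) phi'X phiX /x.
    case: (cyc _) => [l|]; last by rewrite (rmorph0 red).
    by rewrite leqNgt ltn_ord (rmorph0 red).
  by move=> a pa; rewrite E /= pa rmorph0.
exists c%:MP; first by apply: etrans (mmapC _ _ _) _.
rewrite /p; have -> : phi (alpha G) c%:MP = c%:MP by apply: mmapC.
by move/eqP; rewrite mpolyC_eq0 (negPf c0).
Qed.

Lemma Delta_ideal_proper : ~ Delta_ideal 1.
Proof. by move/(p_Delta 0); rewrite /p rmorph1 => /eqP; rewrite oner_eq0. Qed.

End LowerBound.
End GraphDimension.

Section Main.
Variable G : digraph.

Lemma alpha_cycles : exists C : 'I_(alpha G) -> {set edge G},
  (forall i, dicycle_set (C i)) /\ forall i j, i != j -> [disjoint C i & C j].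
Proof.
have [P [tP dP] cP] := alpha_witness G.
exists (fun i => enum_val (cast_ord (esym cP) i)); split=> [i|i j ij].
  by apply: dP; apply: enum_valP.
apply: (trivIsetP tP); try exact: enum_valP.
by apply: contra_neq ij => /enum_val_inj/cast_ord_inj.
Qed.

Lemma Kdim_H0Q : has_Kdim (KR_H0Q G) (alpha G).
Proof.
have [C [dC disjC]] := alpha_cycles.
apply/(@has_KdimP (edge_ringQ G) (@Delta_ideal rat G)) => [a||].
- exact: ann_base_change_homology0.
- exact: (Delta_ideal_proper (K := rat) dC disjC).
split; first exact: (Delta_chain rat dC disjC).
move=> n [p [pp pJ ps]]; have [k [ka [psi [theta [thetaC mod]]]]] := prime_reduction (pp 0%N) (pJ 0%N).
apply: leq_trans ka.
apply: (krull_bound (kappa := @mpolyC #|edge G| rat) pp ps) => [ys ysk|c pc].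
  have [|N [c [nz rel]]] := @algebraic_dependence _ k [seq psi y | y <- ys]; first by rewrite size_map.
  exists N, c; rewrite size_map in nz; split=> //.
  by apply: reduction_box_poly mod rel => //; case: (pp 0%N).
apply/eqP/negPn/negP => c0; have [[_ _ pM] p1 _] := pp n; apply: p1.
by have := pM c^-1%:MP _ pc; rewrite /= -mpolyCM mulVf // mpolyC1.
Qed.

Lemma Kdim_H0 : has_Kdim (KR_H0 G) (alpha G).+1.
Proof.
have [C [dC disjC]] := alpha_cycles.
have JE a : in_ideal (Delta G) a <-> @Delta_ideal int G a.
  rewrite /Delta_ideal (_ : [seq @change_coeff int G d | d <- Delta G] = Delta G) //.
  rewrite -[RHS]map_id; apply: eq_map => q.
  elim/mpoly_subring_ind: q => [c|i|q r Eq Er|q r Eq Er].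
  - by rewrite [LHS](map_mpolyC _ _) /= intz.
  - exact: map_mpolyX.
  - by rewrite rmorphD Eq Er.
  - by rewrite rmorphM Eq Er.
apply/(@has_KdimP (edge_ring G) (@Delta_ideal int G)) => [a||].
- by rewrite -JE; apply: ann_koszul_homology0.
- exact: (Delta_ideal_proper (K := int) dC disjC).
split.
  apply: (Delta_chain_extend dC disjC (f := intr : {rmorphism int -> 'F_2}) (c := 2)) => //.
  by apply: val_inj.
move=> n [p [pp pJ ps]]; have [k [ka [psi [theta [thetaC mod]]]]] := prime_reduction (pp 0%N) (pJ 0%N).
apply: leq_trans (_ : k.+1 <= _)%N; last by rewrite ltnS.
apply: (krull_bound_int (kappa := @mpolyC #|edge G| int) pp ps) => ys q q1 ysk.
have [|N [c [nz rel]]] := @algebraic_dependence _ k [seq psi y | y <- ys]; first by rewrite size_map.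
have [e [c' [cE c'P]]] := primitive_coefficients q1 nz.
exists N, c'; rewrite size_map in c'P; split; first exact: c'P.
have [id0 _ _] := pp 0%N; apply: (reduction_box_poly id0 thetaC mod).
move/eqP: rel; rewrite (box_polyZ _ cE) mulf_eq0 => /orP[|/eqP//].
by rewrite /= mpolyC_eq0 expf_eq0 (gt_eqF (lt_trans ltr01 q1)) andbF.
Qed.

Lemma Kdim_H0_unique d : has_Kdim (KR_H0 G) d -> d = (alpha G).+1.
Proof.
move=> Hd; have J1 : ~ in_ideal (Delta G) 1.
  move=> I1; have [I [IM _]] := Kdim_H0.
  have : 1 \in I by apply/IM/ann_koszul_homology0.
  by rewrite idealr1.
apply: (has_Kdim_unique _ J1 Hd Kdim_H0) => a; exact: ann_koszul_homology0.
Qed.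

Lemma Kdim_H0Q_unique d : has_Kdim (KR_H0Q G) d -> d = alpha G.
Proof.
move=> Hd; have J1 : ~ @Delta_ideal rat G 1.
  move=> I1; have [I [IM _]] := Kdim_H0Q.
  have : 1 \in I by apply/IM/ann_base_change_homology0.
  by rewrite idealr1.
apply: (has_Kdim_unique _ J1 Hd Kdim_H0Q) => a; exact: ann_base_change_homology0.
Qed.

End Main.

From mathcomp Require Import classical_sets topology normedtype derive.
Import numFieldNormedType.Exports.

(** * Plane drawings *)

Section PlaneArcs.
Local Open Scope classical_set_scope.
Variable R : realType.

Local Notation I := (`[0, 1] : set R).

Lemma within_fst (K : set (R * R)) (u : R -> R) : K `<=` I `*` I ->
  {within I, continuous u} -> {within K, continuous (fun st => u st.1)}.
Proof.
move=> KI /subspace_continuousP cu; apply/subspace_continuousP => -[s t] Kst.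
have [Is _] := KI _ Kst.
apply: cvg_comp (cu s Is) => U; rewrite /within /= => sU.
exists ([set x | I x -> U x], setT) => /=; first by split=> //; apply: filterT.
by move=> [s' t'] /= [H _] Kst'; apply: H; have [] := KI _ Kst'.
Qed.

Lemma within_snd (K : set (R * R)) (u : R -> R) : K `<=` I `*` I ->
  {within I, continuous u} -> {within K, continuous (fun st => u st.2)}.
Proof.
move=> KI /subspace_continuousP cu; apply/subspace_continuousP => -[s t] Kst.
have [_ It] := KI _ Kst.
apply: cvg_comp (cu t It) => U; rewrite /within /= => sU.
exists (setT, [set x | I x -> U x]) => /=; first by split=> //; apply: filterT.
by move=> [s' t'] /= [_ H] Kst'; apply: H; have [] := KI _ Kst'.
Qed.

Lemma within_dist (K : set (R * R)) (u v : R -> R) : K `<=` I `*` I ->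
  {within I, continuous u} -> {within I, continuous v} ->
  {within K, continuous (fun st => `|u st.1 - v st.2|)}.
Proof.
move=> KI cu cv x; apply: cvg_norm; apply: cvgB.
  exact: (within_fst KI cu).
exact: (within_snd KI cv).
Qed.

Lemma separated_arcs (u1 u2 v1 v2 : R -> R) (a b c d : R) :
    {within I, continuous u1} -> {within I, continuous u2} ->
    {within I, continuous v1} -> {within I, continuous v2} ->
    0 <= a -> b <= 1 -> 0 <= c -> d <= 1 ->
    (forall s t, a <= s <= b -> c <= t <= d -> u1 s = v1 t -> u2 s = v2 t -> False) ->
  exists2 e : R, 0 < e & forall s t, a <= s <= b -> c <= t <= d ->
    e <= `|u1 s - v1 t| + `|u2 s - v2 t|.
Proof.
move=> cu1 cu2 cv1 cv2 a0 b1 c0 d1 disj.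
pose K : set (R * R) := `[a, b] `*` `[c, d].
have KI : K `<=` I `*` I.
  by move=> [s t] [/=]; rewrite !in_itv /= => /andP[? ?] /andP[? ?]; split; lra.
have Kc : compact K by apply: compact_setX; apply: segment_compact.
have [K0|/set0P/negP/negPn/eqP K0] := pselect (K !=set0); last first.
  exists 1 => // s t sab tcd; have : K (s, t) by split; rewrite /= in_itv.
  by rewrite K0.
have cF : {within K, continuous (fun st : R * R => `|u1 st.1 - v1 st.2| + `|u2 st.1 - v2 st.2|)}.
  by move=> x; apply: cvgD; apply: within_dist.
have [[s t] /set_mem[/=]] := compact_EVT_min K0 Kc cF.
rewrite !in_itv /= => sab tcd min.
exists (`|u1 s - v1 t| + `|u2 s - v2 t|); last first.
  by move=> s' t' s'ab t'cd; apply: (min (s', t')); apply/mem_set; split; rewrite /= in_itv.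
rewrite lt_neqAle addr_ge0 // andbT eq_sym; apply/negP => /eqP.
move/eqP; rewrite paddr_eq0 // !normr_eq0 !subr_eq0 => /andP[/eqP E1 /eqP E2].
exact: disj E1 E2.
Qed.

(* The function below is positive on the square, so it has a positive minimum. *)
Lemma uniformly_continuous_arc (u : R -> R) (h : R) : {within I, continuous u} -> 0 < h ->
  exists2 e : R, 0 < e & forall s t, 0 <= s <= 1 -> 0 <= t <= 1 -> `|s - t| < e -> `|u s - u t| < h.
Proof.
move=> cu h0; pose K : set (R * R) := I `*` I.
have Kc : compact K by apply: compact_setX; apply: segment_compact.
have K0 : K !=set0 by exists (0, 0); split; rewrite /= in_itv /= lexx ler01.
have cid : {within I, continuous (fun x : R => x)} by apply: continuous_subspaceT => x; apply: cvg_id.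
pose z (st : R * R) := h - `|u st.1 - u st.2|.
pose F (st : R * R) := `|st.1 - st.2| + (`|z st| + z st).
have cz : {within K, continuous z}.
  by move=> x; apply: cvgB; [exact: cvg_cst | exact: (within_dist (fun _ H => H) cu cu)].
have cF : {within K, continuous F}.
  move=> x; apply: cvgD; first exact: (within_dist (fun _ H => H) cid cid).
  by apply: cvgD; [apply: cvg_norm|]; exact: cz.
have [[s t] /set_mem[/=]] := compact_EVT_min K0 Kc cF.
rewrite !in_itv /= => sab tcd min.
have z_ge0 x : 0 <= `|x| + x :> R by have := ler_norm (- x); rewrite normrN; lra.
exists (F (s, t)).
  rewrite /F /z /=; have [->|st] := eqVneq s t.
    by rewrite !subrr normr0 subr0 add0r gtr0_norm // addr_gt0.
  by rewrite ltr_pwDl ?normr_gt0 ?subr_eq0.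
move=> s' t' s'I t'I lt_st; rewrite ltNge; apply/negP => le_h.
have : F (s, t) <= F (s', t') by apply: min; apply/mem_set; split; rewrite /= in_itv.
rewrite leNgt => /negP; apply; apply: le_lt_trans lt_st.
have z_le0 : z (s', t') <= 0 by rewrite /z subr_le0.
by rewrite /F (ler0_norm z_le0) addNr addr0.
Qed.

Lemma bounded_arc (u : R -> R) : {within I, continuous u} ->
  exists B : R, forall s, 0 <= s <= 1 -> `|u s| <= B.
Proof.
move=> cu; have [|c _ max] := @EVT_max R (fun s => `|u s|) 0 1 ler01.
  by move=> x; apply: cvg_norm; apply: cu.
by exists `|u c| => s sI; apply: max; rewrite in_itv.
Qed.

End PlaneArcs.

Section PlanarGraphs.
Local Open Scope classical_set_scope.
Variable R : realType.

Local Notation I := (`[0, 1] : set R).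

Lemma uniform_threshold (J : finType) (P : J -> R -> Prop) :
    (forall j, exists2 e, 0 < e & P j e) ->
    (forall j e e', 0 < e' -> e' <= e -> P j e -> P j e') ->
  exists2 e, 0 < e & forall j, P j e.
Proof.
move=> exP mono; suff [e e0 eP] : exists2 e, 0 < e & {in enum J, forall j, P j e}.
  by exists e => // j; apply: eP; rewrite mem_enum.
elim: (enum J) => [|j s [e e0 eP]]; first by exists 1.
have [d d0 dP] := exP j; exists (Num.min d e); first by rewrite lt_min d0.
have m0 : 0 < Num.min d e by rewrite lt_min d0.
move=> i; rewrite inE => /predU1P[->|/eP].
  by apply: mono dP => //; rewrite ge_min lexx.
by apply: mono => //; rewrite ge_min lexx orbT.
Qed.

Lemma uniform_bound (J : finType) (P : J -> R -> Prop) :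
    (forall j, exists e, P j e) ->
    (forall j e e', e <= e' -> P j e -> P j e') ->
  exists e, forall j, P j e.
Proof.
move=> exP mono; suff [e eP] : exists e, {in enum J, forall j, P j e}.
  by exists e => j; apply: eP; rewrite mem_enum.
elim: (enum J) => [|j s [e eP]]; first by exists 0.
have [d dP] := exP j; exists (Num.max d e) => i.
rewrite inE => /predU1P[->|/eP].
  by apply: mono dP; rewrite le_max lexx.
by apply: mono; rewrite le_max lexx orbT.
Qed.

Variables (B h : R).
Hypothesis h_gt0 : 0 < h.

Definition grid_coord (r : R) : nat := (Num.truncn ((r + B) / h)).+1.

Lemma grid_coordP r : `|r| <= B -> (grid_coord r).-1%:R * h <= r + B < (grid_coord r)%:R * h.
Proof.
rewrite ler_norml => /andP[Br _]; rewrite -ler_pdivlMr // -ltr_pdivrMr //.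
by apply: truncn_itv; rewrite divr_ge0 ?(ltW h_gt0) //; lra.
Qed.

Lemma grid_coord_close r s : `|r| <= B -> `|s| <= B -> grid_coord r = grid_coord s ->
  `|r - s| < h.
Proof.
move=> /grid_coordP rB /grid_coordP sB eqg; move: rB sB; rewrite eqg /grid_coord /=.
set N := Num.truncn _; rewrite -natr1 mulrDl mul1r => /andP[? ?] /andP[? ?].
by rewrite ltr_norml; apply/andP; split; lra.
Qed.

Lemma grid_coord_step r s : `|r| <= B -> `|s| <= B -> `|r - s| < h ->
  [\/ grid_coord r = grid_coord s, grid_coord s = (grid_coord r).+1
    | grid_coord r = (grid_coord s).+1].
Proof.
have near x y : `|x| <= B -> `|y| <= B -> `|x - y| < h -> (grid_coord x <= (grid_coord y).+1)%N.
  move=> /grid_coordP/andP[xB _] /grid_coordP/andP[_ yB]; rewrite ltr_norml => /andP[_ xy].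
  have : (grid_coord x).-1%:R * h < (grid_coord y).+1%:R * h.
    by rewrite -natr1 mulrDl mul1r; lra.
  by rewrite ltr_pM2r // ltr_nat; lia.
move=> rB sB rs; have := near r s rB sB rs; have := near s r sB rB.
by rewrite distrC => /(_ rs) *; case: (ltngtP (grid_coord r) (grid_coord s)) => ?;
  [apply: Or32|apply: Or33|apply: Or31]; lia.
Qed.

Lemma grid_coord_lt r : `|r| <= B -> (grid_coord r < (Num.truncn (2 * B / h)).+2)%N.
Proof.
move=> rB; have B0 : 0 <= B by apply: le_trans rB.
rewrite /grid_coord !ltnS; move: rB; rewrite ler_norml => /andP[rl rr].
rewrite truncn_ge_nat; last by rewrite divr_ge0 ?(ltW h_gt0) //; lra.
apply: (le_trans (y := (r + B) / h)).
  by rewrite truncn_le divr_ge0 ?(ltW h_gt0) //; lra.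
by rewrite ler_pM2r ?invr_gt0 //; lra.
Qed.

End PlanarGraphs.

Section PlanarAlphaBeta.
Local Open Scope classical_set_scope.
Variables (R : realType) (G : digraph).
Variables (pos : vertex G -> R * R) (arc : edge G -> R -> R * R).
Hypothesis drawn : drawing pos arc.

Local Notation I := (`[0, 1] : set R).

Let x e t := (arc e t).1.
Let y e t := (arc e t).2.

Let arcE e f s t : x e s = x f t -> y e s = y f t -> arc e s = arc f t.
Proof. by rewrite /x /y; case: (arc e s) (arc f t) => ? ? [? ?] /= -> ->. Qed.

Let x_cont e : {within I, continuous (x e)}.
Proof.
by move=> t; apply: (cvg_comp _ _ (arc_continuous drawn (e := e) (x := t))); apply: cvg_fst.
Qed.

Let y_cont e : {within I, continuous (y e)}.
Proof.
by move=> t; apply: (cvg_comp _ _ (arc_continuous drawn (e := e) (x := t))); apply: cvg_snd.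
Qed.

Let third (k : nat) (s : R) := k%:R / 3 <= s <= k.+1%:R / 3.

Let third_sub k s : (k < 3)%N -> third k s -> 0 <= s <= 1.
Proof.
by case: k => [|[|[|//]]] _; rewrite /third; lra.
Qed.

Let common e f (s t : R) : 0 <= s <= 1 -> 0 <= t <= 1 -> arc e s = arc f t ->
  [\/ [/\ 0 < s < 1, e = f & s = t],
      (s = 0 \/ s = 1) /\ (t = 0 \/ t = 1) | False].
Proof.
move=> sI tI est.
have ends (r : R) : 0 <= r <= 1 -> 0 < r < 1 \/ (r = 0 \/ r = 1).
  move=> /andP[]; rewrite le_eqVlt => /predU1P[<-|r0]; first by right; left.
  by rewrite le_eqVlt => /predU1P[->|r1]; [right; right | left; rewrite r0].
have avoid g r : (r = 0 \/ r = 1) -> exists v, arc g r = pos v.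
  by case=> ->; [rewrite (arc_source drawn); exists (source g)
    | rewrite (arc_target drawn); exists (target g)].
case: (ends s sI) (ends t tI) => [s01|s01] [t01|t01].
- by have [ef st] := arc_disjoint drawn s01 t01 est; apply: Or31.
- by have [v pv] := avoid f t t01; case: (arc_avoids drawn (e := e) (v := v) s01); rewrite est.
- by have [v pv] := avoid e s s01; case: (arc_avoids drawn (e := f) (v := v) t01); rewrite -est.
- exact: Or32.
Qed.

Theorem drawing_alpha_beta : alpha G = beta G.
Proof.
have [d d0 sep] : exists2 d : R, 0 < d & forall p : (edge G * edge G) * ('I_3 * 'I_3),
    (forall s t, third p.2.1 s -> third p.2.2 t -> arc p.1.1 s = arc p.1.2 t -> False) ->
    forall s t, third p.2.1 s -> third p.2.2 t ->
      d <= `|x p.1.1 s - x p.1.2 t| + `|y p.1.1 s - y p.1.2 t|.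
  apply: uniform_threshold => [[[e f] [k l]]|p e e' _ le_e H disj s t ks lt]; last first.
    by apply: le_trans le_e _; apply: H.
  have [disj|ndisj] := pselect (forall s t, third k s -> third l t -> arc e s = arc f t -> False);
    last by exists 1.
  have b (m : 'I_3) : 0 <= m%:R / 3 :> R /\ m.+1%:R / 3 <= 1 :> R.
    by case: m => -[|[|[|//]]] ? /=; lra.
  have [bk1 bk2] := b k; have [bl1 bl2] := b l.
  have [//|c c0 H] := @separated_arcs R (x e) (y e) (x f) (y f) (k%:R / 3) (k.+1%:R / 3)
    (l%:R / 3) (l.+1%:R / 3) (@x_cont e) (@y_cont e) (@x_cont f) (@y_cont f) bk1 bk2 bl1 bl2.
    by move=> s t sk tl E1 E2; apply: (disj s t sk tl); apply: arcE.
  by exists c => // _; apply: H.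
pose h := d / 4; have h0 : 0 < h by rewrite divr_gt0.
have [B bnd] : exists B : R, forall e (s : R), 0 <= s <= 1 -> `|x e s| <= B /\ `|y e s| <= B.
  apply: uniform_bound => [e|e b b' le_b H s sI].
    have [b1 H1] := bounded_arc (@x_cont e); have [b2 H2] := bounded_arc (@y_cont e).
    by exists (Num.max b1 b2) => s sI; rewrite !le_max H1 // H2 // orbT.
  by have [H1 H2] := H s sI; split; apply: le_trans le_b.
have [w w0 unif] : exists2 w : R, 0 < w & forall e (s t : R), 0 <= s <= 1 -> 0 <= t <= 1 ->
    `|s - t| < w -> `|x e s - x e t| < h /\ `|y e s - y e t| < h.
  apply: uniform_threshold => [e|e b b' _ le_b H s t sI tI st]; last first.
    by apply: H => //; apply: lt_le_trans le_b.
  have [w1 w1p H1] := uniformly_continuous_arc (@x_cont e) h0.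
  have [w2 w2p H2] := uniformly_continuous_arc (@y_cont e) h0.
  exists (Num.min w1 w2) => [|s t sI tI]; first by rewrite lt_min w1p.
  by rewrite lt_min => /andP[? ?]; split; [apply: H1|apply: H2].
pose L := (Num.truncn w^-1).+1; pose n := (2 * L)%N.
pose tau (k : nat) : R := k%:R / (3 * L)%:R.
have L3_gt0 : 0 < (3 * L)%:R :> R by rewrite ltr0n.
have tau_third a k : (a * L <= k <= a.+1 * L)%N -> third a (tau k).
  have Lr : L%:R != 0 :> R by rewrite pnatr_eq0.
  have E m : m%:R / 3 = (m * L)%:R / (3 * L)%:R :> R by rewrite !natrM; field.
  by move=> /andP[? ?]; rewrite /third !E /tau !ler_pM2r ?invr_gt0 // !ler_nat; apply/andP.
have tauI k : (k <= 3 * L)%N -> 0 <= tau k <= 1.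
  by move=> kL; rewrite /tau divr_ge0 ?ler0n //= ler_pdivrMr // mul1r ler_nat.
have tau_step k : `|tau k - tau k.+1| < w.
  rewrite distrC /tau -mulrBl -natrB // subSnn mul1r ger0_norm ?invr_ge0 ?ler0n //.
  rewrite invf_plt ?posrE //; apply: lt_le_trans (truncnS_gt _) _.
  by rewrite ler_nat leq_pmull.
have xB e k : (k <= 3 * L)%N -> `|x e (tau k)| <= B by move/tauI/(bnd e) => [].
have yB e k : (k <= 3 * L)%N -> `|y e (tau k)| <= B by move/tauI/(bnd e) => [].
pose gc := grid_coord B h.
pose walk e i := (gc (x e (tau i./2)), gc (y e (tau (i./2 + odd i)%N))).
pose gpos v := (gc (pos v).1, gc (pos v).2).
have half_le i : (i <= 3 * n)%N -> (i./2 <= 3 * L)%N by rewrite /n; lia.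
have half_odd_le i : (i <= 3 * n)%N -> (i./2 + odd i <= 3 * L)%N by rewrite /n; lia.
have y_close e i : (i <= 3 * n)%N -> `|y e (tau i./2) - y e (tau (i./2 + odd i)%N)| < h.
  move=> i_n; have := half_odd_le i i_n; case: (odd i); last by rewrite addn0 subrr normr0.
  rewrite addn1 => le3; apply: (unif e _ _ _ _ _).2 => //; apply: tauI => //; exact: ltnW.
have meet e i f j (k l : 'I_3) : (i <= 3 * n)%N -> (j <= 3 * n)%N ->
    third k (tau i./2) -> third l (tau j./2) -> walk e i = walk f j ->
    exists s t, [/\ third k s, third l t & arc e s = arc f t].
  move=> i_n j_n ti tj eqw; have ex := congr1 fst eqw; have ey := congr1 snd eqw.
  have [//|no] := pselect (exists s t, [/\ third k s, third l t & arc e s = arc f t]).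
  have dx := grid_coord_close h0 (xB e _ (half_le i i_n)) (xB f _ (half_le j j_n)) ex.
  have dy := grid_coord_close h0 (yB e _ (half_odd_le i i_n)) (yB f _ (half_odd_le j j_n)) ey.
  have d1 := y_close e i i_n; have d2 := y_close f j j_n.
  have {}sep : d <= `|x e (tau i./2) - x f (tau j./2)| + `|y e (tau i./2) - y f (tau j./2)|.
    by apply: (@sep ((e, f), (k, l))) => // s t ks lt est; apply: no; exists s, t.
  exfalso; move: sep; apply/negP; rewrite -ltNge.
  move: d1 d2 dx dy; rewrite distrC [`|y f _ - _|]distrC.
  move: (x e _) (x f _) (y e (tau i./2)) (y f (tau j./2)) (y e _) (y f _) => a b u v u' v'.
  move=> d1 d2 dx dy.
  have : `|u - v| < 3 * h.
    move: d1 d2 dy; rewrite !ltr_norml => /andP[? ?] /andP[? ?] /andP[? ?]; apply/andP; split; lra.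
  by move: dx; rewrite /h; lra.
have endP e i v : at_end n e i v -> exists k : 'I_3, [/\ third k (tau i./2), (i <= 3 * n)%N
    & (k = 0 :> nat /\ source e = v) \/ (k = 2 :> nat /\ target e = v)].
  case=> -[i_n vE].
    by exists ord0; split; [apply: tau_third; rewrite /= /n; lia|lia|left].
  by exists (inord 2); rewrite inordK //; split;
    [apply: tau_third; move: i_n; rewrite /n; lia|lia|right].
pose mid : 'I_3 := Ordinal (isT : (1 < 3)%N).
have midP (e : edge G) i : (n <= i <= 2 * n)%N -> third mid (tau i./2) /\ (i <= 3 * n)%N.
  by move=> i_n; split; [apply: tau_third; move: i_n; rewrite /= /n; lia | lia].
have th1 s : third 1 s -> 0 < s < 1 by rewrite /third; lra.
have endE e v (k : 'I_3) s : (k = 0 :> nat /\ source e = v) \/ (k = 2 :> nat /\ target e = v) ->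
    third k s -> (s = 0 \/ s = 1) -> arc e s = pos v.
  rewrite /third; case=> -[-> <-] ks [] s01.
  - by rewrite s01 (arc_source drawn).
  - by exfalso; move: ks; rewrite s01; lra.
  - by exfalso; move: ks; rewrite s01; lra.
  - by rewrite s01 (arc_target drawn).
apply: (@grid_drawing_alpha_beta G (Num.truncn (2 * B / h)).+2 n gpos walk).
- by move=> e; rewrite /walk /gpos /x /y /= /tau !mul0r (arc_source drawn).
- move=> e; have n3 : (3 * n = (3 * L).*2)%N by rewrite /n -mul2n; lia.
  rewrite /walk /gpos n3 odd_double doubleK addn0 /tau divff ?gt_eqF //.
  by rewrite /x /y (arc_target drawn).
- move=> e i i_n; rewrite /walk.
  have i1 : (i.+1 <= 3 * n)%N by [].
  case: (boolP (odd i)) => io.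
    have -> : (i.+1)./2 = (i./2).+1 by rewrite -uphalfE uphalf_half io.
    have -> : odd i.+1 = false by rewrite /= io.
    rewrite addn0 addn1.
    have k3 : ((i./2).+1 <= 3 * L)%N by have := half_odd_le i (ltnW i_n); rewrite io addn1.
    have [|E|E|E] := grid_coord_step h0 (xB e _ (ltnW k3)) (xB e _ k3).
    + by apply: (unif e _ _ _ _ _).1 => //; apply: tauI => //; exact: ltnW.
    + by left; rewrite /gc E.
    + right; exists (true, (gc (x e (tau i./2)), gc (y e (tau (i./2).+1)))).
      by left; rewrite /gsrc /gtgt /gc /= E.
    + right; exists (true, (gc (x e (tau (i./2).+1)), gc (y e (tau (i./2).+1)))).
      by right; rewrite /gsrc /gtgt /gc /= E.
  have hE : (i.+1)./2 = i./2 by rewrite -uphalfE uphalf_half (negPf io).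
  have oE : odd i.+1 = true by rewrite /= io.
  rewrite hE oE addn0 addn1.
  have k3 : ((i./2).+1 <= 3 * L)%N.
    by have := half_odd_le _ i1; rewrite hE oE addn1.
  have [|E|E|E] := grid_coord_step h0 (yB e _ (ltnW k3)) (yB e _ k3).
  + by apply: (unif e _ _ _ _ _).2 => //; apply: tauI => //; exact: ltnW.
  + by left; rewrite /gc E.
  + right; exists (false, (gc (x e (tau i./2)), gc (y e (tau i./2)))).
    by left; rewrite /gsrc /gtgt /gc /= E.
  + right; exists (false, (gc (x e (tau i./2)), gc (y e (tau (i./2).+1)))).
    by right; rewrite /gsrc /gtgt /gc /= E.
- move=> e i i_n; rewrite /walk /=; split=> //; apply: grid_coord_lt => //.
    by apply: xB; apply: half_le.
  by apply: yB; apply: half_odd_le.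
- move=> e i v f j v' /endP[k [ki i_n kv]] /endP[l [lj j_n lw]].
  case/(meet e i f j k l i_n j_n ki lj) => s [t [ks lt est]].
  have sI := third_sub (ltn_ord k) ks; have tI := third_sub (ltn_ord l) lt.
  case: (common sI tI est) => // [[s01 ef st]|[se te]].
    subst f t; case: kv lw => -[k0 <-] [] [l0 <-] //; move: ks lt; rewrite k0 l0 /third => ks lt; exfalso;
      lra.
  by apply: (pos_inj drawn); rewrite -(endE e v k s) // -(endE f v' l t).
- move=> e i f j /(midP e)[ki i_n] /(midP f)[lj j_n].
  case/(meet e i f j mid mid i_n j_n ki lj) => s [t [/th1 ks /th1 lt est]].
  by have [] := arc_disjoint drawn ks lt est.
- move=> e i f j v /(midP e)[ki i_n] /endP[l [lj j_n lw]].
  case/(meet e i f j mid l i_n j_n ki lj) => s [t [/th1 ks lt est]].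
  have sI : 0 <= s <= 1 by case/andP: (ks) => /ltW-> /ltW->.
  case: (common sI (third_sub (ltn_ord l) lt) est) => // [[_ -> _]|[se _]].
    by case: lw => -[_ <-]; [left|right].
  by exfalso; move: ks; case: se => ->; rewrite ltxx ?andbF.
Qed.

End PlanarAlphaBeta.

Theorem planar_alpha_beta (R : realType) (G : digraph) : planar R G -> alpha G = beta G.
Proof. by case=> pos [arc drawn]; apply: drawing_alpha_beta drawn. Qed.

Theorem theorem1p11 (R : realType) (G : digraph) :
  [<-> acyclic G;
       fin_gen_Z (KR_H0 G);
       fin_gen_Z (KR_H G);
       exists2 n : nat, (1 <= n)%N &
         forall e : edge G, in_ideal (Delta G) (edge_var e ^+ n)%R;
       has_Kdim (KR_H0 G) 1;
       has_Kdim (KR_H0Q G) 0]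
  /\
  exists dQ dZ : nat,
    [/\ has_Kdim (KR_H0Q G) dQ,
        has_Kdim (KR_H0 G) dZ,
        alpha G = dQ /\ (dQ%:Z <= dZ%:Z - 1 <= (beta G)%:Z)%R
      & planar R G ->
          [/\ alpha G = dQ, (dQ%:Z = dZ%:Z - 1)%R & (dZ%:Z - 1 = (beta G)%:Z)%R]].
Proof.
have dicycle_contra (Q : Prop) : (forall C : {set edge G}, dicycle_set C -> ~ Q) -> Q -> acyclic G.
  by move=> nQ q; apply/acyclicP => C; apply/negP => /nQ.
split.
  tfae.
  - by case/acyclic_nilpotent=> n _; apply: fin_gen_KR_H0.
  - move/(dicycle_contra _ (@not_fin_gen_H0 G))/acyclic_nilpotent => [n _].
    exact: fin_gen_KR_H.
  - move/(dicycle_contra _ (@not_fin_gen_H G)).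
    exact: acyclic_nilpotent.
  - move=> nil; have /acyclic_alpha a0 : acyclic G.
      by apply: dicycle_contra nil => C dC [n _]; apply: (not_nilpotent dC).
    by have := Kdim_H0 G; rewrite a0.
  - by move/Kdim_H0_unique => [a0]; have := Kdim_H0Q G; rewrite -a0.
  - by move/Kdim_H0Q_unique => a0; apply/acyclic_alpha.
have le := alpha_le_beta G.
exists (alpha G), (alpha G).+1; split.
- exact: Kdim_H0Q.
- exact: Kdim_H0.
- by split=> //; lia.
- by move/planar_alpha_beta => <-; split=> //; lia.
Qed.
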